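(* Let $S\subset\mathbb{R}^n$ be a bounded measurable set. Then $H_S$ is contained in the joint domain $\bigcap_{j=1}^n D(Q_j)$ of the operators $Q_j$, and for every $\phi\in H_S$ and every $j\in\{1,\dots,n\}$ the equation $Q_j\phi=(x_j\check\phi)^{\wedge}$ holds in the sense of distributions.
   Context: Fix $n\ge 1$ and $m>0$, and let $E(\vec p)=\sqrt{|\vec p|^2+m^2}$ for $\vec p\in\mathbb{R}^n$. Let $L^2_r(\mathbb{R}^n)=L^2(\mathbb{R}^n,d\vec p/E(\vec p))$, with norm $\|\phi\|_r=\left(\int|\phi(\vec p)|^2\,\frac{d\vec p}{E(\vec p)}\right)^{1/2}$; note $L^2(\mathbb{R}^n)\subset L^2_r(\mathbb{R}^n)$. The Fourier transform is normalized to be unitary on $L^2(\mathbb{R}^n)$, $\hat\psi(\vec p)=(2\pi)^{-n/2}\int e^{-\mathrm{i}\vec p\cdot\vec x}\psi(\vec x)\,d\vec x$; $\check{\ }$ denotes its inverse, and both are extended to tempered distributions. The Klein-Gordon position operators are the unbounded operators $Q_j$ ($1\le j\le n$) on $L^2_r(\mathbb{R}^n)$ given by $Q_j\phi=\mathrm{i}\,\partial\phi/\partial p_j$, whose domain $D(Q_j)$ is the set of $\phi\in L^2_r(\mathbb{R}^n)$ whose restrictions to lines parallel to the $j$th coordinate axis are almost all locally absolutely continuous (for a suitable representative of $\phi$), and which satisfy $\partial\phi/\partial p_j\in L^2_r(\mathbb{R}^n)$. For measurable $S\subset\mathbb{R}^n$, $L^2(S)$ is the set of functions in $L^2(\mathbb{R}^n)$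 vanishing almost everywhere off $S$, and $H_S\subset L^2_r(\mathbb{R}^n)$ is the closure, with respect to $\|\cdot\|_r$, of $\{\hat\psi:\psi\in L^2(S)\}$. *)

(* Defs.v *)
From HB Require Import structures.
From mathcomp Require Import all_boot all_order all_algebra.
From mathcomp Require Import all_classical all_reals all_analysis.
From mathcomp Require Import complex.
Set Implicit Arguments.
Unset Strict Implicit.
Unset Printing Implicit Defensive.
Import Order.TTheory GRing.Theory Num.Theory numFieldNormedType.Exports.
Local Open Scope classical_set_scope.
Local Open Scope ring_scope.
Local Open Scope complex_scope.

(* Tuples carry the product sigma-algebra, i.e. the Borel sets of R^n. *)
Notation "'Rn[' R ]_ n" := (n.-tuple (measurableTypeR R))
  (at level 8, n at level 2, format "'Rn[' R ]_ n") : type_scope.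

Section lebesgue_measure_succ.
Context {R : realType} (n : nat).
Variable mu : {sigma_finite_measure set Rn[R]_n -> \bar R}.

Definition cons_pair (p : measurableTypeR R * Rn[R]_n) : Rn[R]_n.+1 :=
  [the n.+1.-tuple _ of p.1 :: p.2].

Lemma measurable_cons_pair : measurable_fun [set: _] cons_pair.
Proof. exact: measurable_cons. Qed.

Definition lebesgue_succ : set Rn[R]_n.+1 -> \bar R :=
  pushforward (lebesgue_measure \x mu)%E cons_pair.

Let lebesgue_succ0 : lebesgue_succ set0 = 0%E.
Proof. by rewrite /lebesgue_succ /pushforward preimage_set0 measure0. Qed.

Let lebesgue_succ_ge0 A : (0 <= lebesgue_succ A)%E.
Proof. by rewrite /lebesgue_succ /pushforward; exact: measure_ge0. Qed.

Let lebesgue_succ_sigma_additive : semi_sigma_additive lebesgue_succ.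
Proof.
move=> F mF tF mUF; rewrite /lebesgue_succ /pushforward preimage_bigcup.
apply: measure_semi_sigma_additive.
- by move=> k; rewrite -[X in measurable X]setTI; exact: measurable_cons_pair.
- apply/trivIsetP => /= i j _ _ ij; rewrite -preimage_setI.
  by move/trivIsetP : tF => /(_ _ _ _ _ ij) ->//; rewrite preimage_set0.
- by rewrite -preimage_bigcup -[X in measurable X]setTI;
    exact: measurable_cons_pair.
Qed.

HB.instance Definition _ := isMeasure.Build _ _ _ lebesgue_succ
  lebesgue_succ0 lebesgue_succ_ge0 lebesgue_succ_sigma_additive.

Let lebesgue_succ_sigma_finite : sigma_finite setT lebesgue_succ.
Proof.
have /sigma_finiteP[F [TF ndF Foo]] := sigma_finiteT (@lebesgue_measure R).
have /sigma_finiteP[G [TG ndG Goo]] := sigma_finiteT mu.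
pose unc (x : Rn[R]_n.+1) : measurableTypeR R * Rn[R]_n :=
  (tnth x ord0, [tuple of behead x]).
have consK : cancel cons_pair unc.
  by move=> [t x]; congr pair => //; exact: val_inj.
have munc : measurable_fun [set: _] unc.
  apply: measurable_fun_pair; first exact: measurable_tnth.
  exact: measurable_behead.
exists (fun k => unc @^-1` (F k `*` G k)).
  apply/seteqP; split => // x _.
  have [k _ Fk] : (\bigcup_k F k) (unc x).1 by rewrite -TF.
  have [l _ Gl] : (\bigcup_k G k) (unc x).2 by rewrite -TG.
  exists (maxn k l) => //; split.
    by move: Fk; exact/subsetPset/ndF/leq_maxl.
  by move: Gl; exact/subsetPset/ndG/leq_maxr.
move=> k; have [mF Fk] := Foo k; have [mG Gk] := Goo k; split.
  by rewrite -[X in measurable X]setTI; apply: munc => //; exact: measurableX.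
rewrite /lebesgue_succ /pushforward.
have -> : cons_pair @^-1` (unc @^-1` (F k `*` G k)) = F k `*` G k.
  rewrite -comp_preimage (_ : unc \o _ = id)//.
  by apply/funext => p /=; rewrite consK.
by rewrite product_measure1E// lte_mul_pinfty// ge0_fin_numE.
Qed.

HB.instance Definition _ := Measure_isSigmaFinite.Build _ _ _ lebesgue_succ
  lebesgue_succ_sigma_finite.

End lebesgue_measure_succ.

(* Iterated product of one-dimensional Lebesgue measure; see lebesgue_Rn_box. *)
Fixpoint lebesgue_Rn (R : realType) (n : nat) :
    {sigma_finite_measure set Rn[R]_n -> \bar R} :=
  match n return {sigma_finite_measure set Rn[R]_n -> \bar R} with
  | 0 => [the {sigma_finite_measure set Rn[R]_0 -> \bar R} of
           \d_([tuple] : Rn[R]_0)]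
  | k.+1 => [the {sigma_finite_measure set Rn[R]_k.+1 -> \bar R} of
              lebesgue_succ (lebesgue_Rn R k)]
  end.

Lemma lebesgue_Rn_box (R : realType) (n : nat)
    (A : 'I_n -> set (measurableTypeR R)) :
  (forall i, measurable (A i)) ->
  lebesgue_Rn R n [set x | forall i, A i (tnth x i)] =
  (\big[*%E/1%E]_(i < n) lebesgue_measure (A i))%E.
Proof.
elim: n A => [|n IHn] A mA.
  by rewrite big_ord0 /= diracE (_ : _ \in _ = true)//; apply/mem_set => -[].
rewrite big_ord_recl /= /lebesgue_succ /pushforward.
pose B : set Rn[R]_n := [set x | forall i, A (lift ord0 i) (tnth x i)].
have mB : measurable B.
  rewrite (_ : B = \bigcap_(i in [set: 'I_n])
    ((fun x : Rn[R]_n => tnth x i) @^-1` A (lift ord0 i))).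
    apply: fin_bigcap_measurable => // i _.
    rewrite -[X in measurable X]setTI.
    exact: (@measurable_tnth _ (measurableTypeR R) n i).
  by apply/seteqP; split => x /= h; [move=> i _; exact: h|move=> i; exact: h].
rewrite -IHn// -product_measure1E//; congr (_ _).
apply/seteqP; split => -[t x] /=.
  move=> h; split; first exact: (h ord0).
  by move=> i; have := h (lift ord0 i); rewrite tnthS.
move=> [At Bx] i; case: (unliftP ord0 i) => [k|] -> //.
by rewrite tnthS; exact: Bx.
Qed.

Section definitions.
Context {R : realType} {n : nat}.
Local Notation V := (Rn[R]_n).
Local Notation C := (R[i]).
Implicit Types (f g phi chi psi : V -> C) (x p : V) (S : set V) (j : 'I_n).

Definition coord x j : R := tnth x j.
Definition dotp x y : R := \sum_(j < n) coord x j * coord y j.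
Definition enorm x : R := Num.sqrt (dotp x x).
Definition setc x j (t : R) : V :=
  [tuple if i == j then t else tnth x i | i < n].

(* The point with jth coordinate t and the others given, in order, by w. *)
Definition insc j (w : Rn[R]_n.-1) (t : R) : V :=
  [tuple if unlift j i is Some k then tnth w k else t | i < n].

Definition bounded_Rn S := exists M : R, forall x, S x -> enorm x <= M.

(* Lebesgue measurability is Borel measurability up to a negligible set. *)
Definition lebesgue_measurable S := exists B : set V,
  measurable B /\ (lebesgue_Rn R n).-negligible ((S `\` B) `|` (B `\` S)).

Definition lebesgue_measurable_fun f := exists g,
  [/\ measurable_fun [set: V] (fun x => complex.Re (g x)),
      measurable_fun [set: V] (fun x => complex.Im (g x)) &
      {ae lebesgue_Rn R n, forall x, f x = g x}].

Definition cabs (z : C) : R := ComplexField.Normc.normc z.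

Definition cintegral f : C :=
  (Rintegral (lebesgue_Rn R n) setT (fun x => complex.Re (f x))) +i*
  (Rintegral (lebesgue_Rn R n) setT (fun x => complex.Im (f x))).

Definition expi (t : R) : C := cos t +i* sin t.

Definition fourier_cst : C := ((2 * pi) `^ (- (n%:R / 2)) : R)%:C.

Definition fourier f p : C :=
  fourier_cst * cintegral (fun x => expi (- dotp p x) * f x).
Definition inv_fourier f x : C :=
  fourier_cst * cintegral (fun p => expi (dotp p x) * f p).

Definition norm1 f : \bar R := (\int[lebesgue_Rn R n]_x (cabs (f x))%:E)%E.
Definition norm2 f : \bar R :=
  ((\int[lebesgue_Rn R n]_x (cabs (f x) ^+ 2)%:E) `^ (2^-1))%E.

Definition L1 : set (V -> C) :=
  [set f | lebesgue_measurable_fun f /\ (norm1 f < +oo)%E].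
Definition L2 : set (V -> C) :=
  [set f | lebesgue_measurable_fun f /\ (norm2 f < +oo)%E].

(* f represents the Fourier transform of psi, for the continuous extension to
   L^2 of the transform given on L^1 `&` L^2 by the integral. *)
Definition fourier_L2 psi f := [/\ L2 psi, L2 f &
  exists u : nat -> V -> C,
    [/\ forall k, (L1 `&` L2) (u k),
        norm2 (fun x => u k x - psi x) @[k --> \oo] --> 0%E &
        norm2 (fun p => fourier (u k) p - f p) @[k --> \oo] --> 0%E]].

Definition L2_on S : set (V -> C) :=
  [set psi | L2 psi /\ {ae lebesgue_Rn R n, forall x, ~ S x -> psi x = 0}].

Section klein_gordon.
Variable m : R.

Definition energy p : R := Num.sqrt (enorm p ^+ 2 + m ^+ 2).

Definition norm_r phi : \bar R :=
  ((\int[lebesgue_Rn R n]_p (cabs (phi p) ^+ 2 / energy p)%:E) `^ (2^-1))%E.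

Definition L2r : set (V -> C) :=
  [set phi | lebesgue_measurable_fun phi /\ (norm_r phi < +oo)%E].

Definition HS S : set (V -> C) := [set phi | L2r phi /\
  forall e : R, 0 < e -> exists psi f,
    [/\ L2_on S psi, fourier_L2 psi f &
        (norm_r (fun p => phi p - f p)%R < e%:E)%E]].

End klein_gordon.

Definition abs_continuous_on (a b : R) (h : R -> C) :=
  forall e : R, 0 < e -> exists2 d : R, 0 < d &
    forall (N : nat) (s t : 'I_N -> R),
      (forall k, [/\ a <= s k, s k <= t k & t k <= b]) ->
      (forall k l, k != l -> t k <= s l \/ t l <= s k) ->
      \sum_(k < N) (t k - s k) < d ->
      \sum_(k < N) cabs (h (t k) - h (s k)) < e.

Definition loc_abs_continuous (h : R -> C) :=
  forall a b : R, a <= b -> abs_continuous_on a b h.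

Definition is_cderive (h : R -> C) (t : R) (d : C) :=
  is_derive t (1 : R) (fun s => complex.Re (h s)) (complex.Re d) /\
  is_derive t (1 : R) (fun s => complex.Im (h s)) (complex.Im d).

(* The graph of Q_j; almost every line refers to (n-1)-dimensional Lebesgue
   measure on the hyperplane of the remaining coordinates. *)
Definition KGpos (m : R) j phi chi := [/\ L2r m phi, L2r m chi &
  exists g,
    [/\ {ae lebesgue_Rn R n, forall p, phi p = g p},
        {ae lebesgue_Rn R n.-1, forall w, loc_abs_continuous (g \o insc j w)} &
        {ae lebesgue_Rn R n, forall p, exists d : C,
           is_cderive (g \o setc p j) (coord p j) d /\ chi p = 'i%C * d}]].

Definition KGdom (m : R) j : set (V -> C) :=
  [set phi | exists chi, KGpos m j phi chi].

Definition cpartial j f x : C :=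
  (derive1 (fun t => complex.Re (f (setc x j t))) (coord x j)) +i*
  (derive1 (fun t => complex.Im (f (setc x j t))) (coord x j)).

Definition cpartials (s : seq 'I_n) f := foldr cpartial f s.

(* Existence and boundedness of the partial derivatives of every order also
   gives their continuity, hence smoothness. *)
Definition schwartz : set (V -> C) := [set f | forall s : seq 'I_n,
  (forall j x, exists d : C,
     is_cderive (cpartials s f \o setc x j) (coord x j) d) /\
  (forall N : nat, exists M : R, forall x,
     (1 + enorm x) ^+ N * cabs (cpartials s f x) <= M)].

(* Tempered distributions are handled through their values on Schwartz
   functions; the operations are defined by duality. *)
Definition functional := (V -> C) -> C.

Definition distr_of phi : functional :=
  fun f => cintegral (fun p => phi p * f p).
Definition distr_fourier (T : functional) : functional := fun f => T (fourier f).
Definition distr_inv_fourier (T : functional) : functional :=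
  fun f => T (inv_fourier f).
Definition distr_mulx j (T : functional) : functional :=
  fun f => T (fun x => (coord x j)%:C * f x).

Definition distr_eq (T U : functional) := forall f, schwartz f -> T f = U f.

End definitions.

(* Main.v *)
From HB Require Import structures.
From mathcomp Require Import all_boot all_order all_algebra.
From mathcomp Require Import all_classical all_reals all_analysis.
From mathcomp Require Import measurable_realfun complex ring lra.
Require Import Defs.
Set Implicit Arguments.
Unset Strict Implicit.
Unset Printing Implicit Defensive.
Import Order.TTheory GRing.Theory Num.Theory numFieldNormedType.Exports.
Local Open Scope classical_set_scope.
Local Open Scope ring_scope.

(** Choose a kernel [k] on the line, with [k] and [k'] of size O((1 + t^2)^-2),
whose Fourier transform is 1 on [-M, M] when S lies in the ball of radius M; set
K p = prod_i k (p_i). The transform f of any psi in L^2(S) satisfies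
f = K * f, and convolution with K is bounded on L^2_r because
E(q) <= c E(p) prod_i (1 + (p_i - q_i)^2); hence phi = K * phi on H_S. The
right-hand side is differentiable along every line, with derivative
(d_j K) * phi in L^2_r, so phi is in the domain of Q_j and Q_j phi is a.e.
equal to i (d_j K) * phi. For a Schwartz function f, Fourier inversion turns the
pairing of (x_j phi^vee)^wedge with f into the pairing of phi with - i d_j f,
and this is the pairing of Q_j phi with f by Fubini and integration by parts in
the kernel. *)

(** * Integration *)

(** Two demands fix the exponent of the kernel. In the weighted estimate Cauchy-Schwarz spreads the
    kernel over two factors, Peetre's inequality then consumes one power of [1 + t^2] in each
    coordinate, and what remains must still be integrable; hence the decay [(1 + t^2)^-2], obtained
    explicitly from a product of four sinc functions. A tensor product of one-dimensional kernels
    reduces integrals over R^n to integrals over the line, which is why the comparison of energies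
    carries a product weight. A function of L^2_r need not lie in L^2, so its inverse transform is
    only a distribution; this forces duality and Fourier inversion on Schwartz functions. The
    equation is claimed for every [chi] in the graph of Q_j, hence [chi] must also be shown unique
    up to null sets; absolute continuity on almost every line gives this. Finally, elements of the
    spaces are only almost everywhere equal to Borel functions, and the L^2 transform is given by
    approximating sequences, so Borel representatives and absolutely convergent integrals have to be
    produced before any computation. *)

Section general_integrals.
Context d (T : measurableType d) (R : realType).
Variable mu : {measure set T -> \bar R}.
Implicit Types f g : T -> R.

Lemma integrable_dom f g : measurable_fun setT f ->
  mu.-integrable setT (EFin \o g) -> (forall x, `|f x| <= g x) ->
  mu.-integrable setT (EFin \o f).
Proof.
move=> mf ig fg; apply: le_integrable ig => //; first exact/measurable_EFinP.
by move=> x _ /=; rewrite lee_fin (le_trans (fg x))// ler_norm.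
Qed.

Lemma integrable_measurable f : mu.-integrable setT (EFin \o f) ->
  measurable_fun setT f.
Proof. by move=> /measurable_int/measurable_EFinP. Qed.

Lemma integrableD_EFin f g : mu.-integrable setT (EFin \o f) ->
  mu.-integrable setT (EFin \o g) ->
  mu.-integrable setT (EFin \o (fun x => f x + g x)).
Proof. by move=> fi gi; exact: (integrableD measurableT fi gi). Qed.

Lemma integrableB_EFin f g : mu.-integrable setT (EFin \o f) ->
  mu.-integrable setT (EFin \o g) ->
  mu.-integrable setT (EFin \o (fun x => f x - g x)).
Proof. by move=> fi gi; exact: (integrableB measurableT fi gi). Qed.

Lemma integrableZ_EFin (k : R) f : mu.-integrable setT (EFin \o f) ->
  mu.-integrable setT (EFin \o (fun x => k * f x)).
Proof. by move=> fi; exact: (integrableZl measurableT k fi). Qed.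

Lemma ge0_integrable_lty f : measurable_fun setT f -> (forall x, 0 <= f x) ->
  (\int[mu]_x (f x)%:E < +oo)%E -> mu.-integrable setT (EFin \o f).
Proof.
move=> mf f0 fi; apply/integrableP; split; first exact/measurable_EFinP.
by under eq_integral do rewrite /= ger0_norm ?f0//.
Qed.

Lemma EFin_Rintegral f : mu.-integrable setT (EFin \o f) ->
  (\int[mu]_x f x)%:E = (\int[mu]_x (f x)%:E)%E.
Proof. by move=> fi; rewrite /Rintegral fineK//; exact: integrable_fin_num. Qed.

Lemma normr_Rintegral_le f g : measurable_fun setT f ->
  mu.-integrable setT (EFin \o g) -> (forall x, `|f x| <= g x) ->
  `|\int[mu]_x f x| <= \int[mu]_x g x.
Proof.
move=> mf ig fg; have fi := integrable_dom mf ig fg.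
apply: (le_trans (le_normr_Rintegral _ fi)) => //.
by apply: le_Rintegral => //; exact: integrable_norm.
Qed.

Import HBNNSimple.

(* The right-hand function is measurable, the left-hand one need not be. *)
Lemma ge0_ae_eq_integralT (f g : T -> \bar R) : (forall x, 0 <= f x)%E ->
  (forall x, 0 <= g x)%E -> measurable_fun setT g ->
  {ae mu, forall x, f x = g x} ->
  (\int[mu]_x f x = \int[mu]_x g x)%E.
Proof.
move=> f0 g0 mg [N [mN N0 fgN]].
have fgE x : (~` N) x -> f x = g x.
  by move=> Nx; apply: contrapT => nfg; apply: Nx; exact: fgN.
have mgN : measurable_fun setT (g \_ (~` N)).
  by apply/(measurable_restrictT g (measurableC mN)); exact: measurable_funTS.
have gE : (\int[mu]_x g x = \int[mu]_x (g \_ (~` N)) x)%E.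
  rewrite [RHS](_ : _ = \int[mu]_(x in ~` N) g x)%E; last by rewrite -integral_mkcond.
  by rewrite (ge0_negligible_integral mN)// setTD.
have g0N x : (0 <= (g \_ (~` N)) x)%E by rewrite patchE; case: ifPn.
apply/eqP; rewrite eq_le; apply/andP; split.
  (* The integral of [f] is a supremum over simple functions below it. Such a function, set to 0 on
     the null set [N], lies below [g] set to 0 on [N] and keeps its integral. *)
  rewrite ge0_integralTE//=; apply: ge_ereal_sup => _ /= [h hf <-].
  rewrite -integralT_nnsfun.
  have mh : measurable_fun setT (EFin \o h) by exact/measurable_EFinP.
  have h0 x : (0 <= (EFin \o h) x)%E by rewrite lee_fin.
  have -> : (\int[mu]_x (EFin \o h) x = \int[mu]_x ((EFin \o h) \_ (~` N)) x)%E.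
    rewrite [RHS](_ : _ = \int[mu]_(x in ~` N) (EFin \o h) x)%E;
      last by rewrite -integral_mkcond.
    by rewrite (ge0_negligible_integral mN)// setTD.
  rewrite gE; apply: ge0_le_integral => //.
  - by move=> x _; rewrite patchE; case: ifPn.
  - apply/(measurable_restrictT _ (measurableC mN)).
    exact: measurable_funTS.
  - by move=> x _; rewrite !patchE; case: ifPn => [/set_mem /fgE <-|_]; [exact: hf|].
rewrite gE ge0_integralTE// [leRHS]ge0_integralTE//=.
apply: ge_ereal_sup => _ /= [h hg <-]; apply: ereal_sup_ubound.
exists h => //= x; apply: (le_trans (hg x)).
rewrite patchE; case: ifPn => [/set_mem Nx|_]; last exact: f0.
by rewrite fgE.
Qed.

End general_integrals.

(** * Integrals along a measurable map *)

Section transfer.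
Context d1 d2 (X : measurableType d1) (Y : measurableType d2) (R : realType).
Variables (m1 : {measure set X -> \bar R}) (m2 : {measure set Y -> \bar R}).
Variables (phi : X -> Y) (mphi : measurable_fun setT phi).
Hypothesis m2E : forall A, measurable A -> m2 A = m1 (phi @^-1` A).

Let ge0_integral_transfer (f : Y -> \bar R) : measurable_fun setT f ->
  (forall y, 0 <= f y)%E -> (\int[m2]_y f y = \int[m1]_x f (phi x))%E.
Proof.
move=> mf f0.
have mixin := isMeasurableFun.Build _ _ _ _ _ mphi.
pose p : {mfun X >-> Y} := HB.pack phi mixin.
rewrite (eq_measure_integral (pushforward m1 p)).
  by rewrite ge0_integral_pushforward// => y _; exact: f0.
by move=> A mA _; exact: m2E.
Qed.

Lemma integral_transfer (f : Y -> \bar R) : measurable_fun setT f ->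
  (\int[m2]_y f y = \int[m1]_x f (phi x))%E.
Proof.
move=> mf; rewrite integralE [RHS]integralE; congr (_ - _)%E.
  rewrite ge0_integral_transfer//; last exact: measurable_funepos.
  by apply: eq_integral => x _; rewrite !funeposE.
rewrite ge0_integral_transfer//; last exact: measurable_funeneg.
by apply: eq_integral => x _; rewrite !funenegE.
Qed.

Lemma integrable_transfer (f : Y -> R) : measurable_fun setT f ->
  m2.-integrable setT (EFin \o f) <-> m1.-integrable setT (EFin \o (f \o phi)).
Proof.
move=> mf.
have E : (\int[m2]_y `|(EFin \o f) y| = \int[m1]_x `|(EFin \o (f \o phi)) x|)%E.
  by rewrite integral_transfer//; apply: measurableT_comp => //;
     exact/measurable_EFinP.
split=> /integrableP[mf' fi]; apply/integrableP; split.
- by apply/measurable_EFinP; exact: measurableT_comp.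
- by rewrite -E.
- exact/measurable_EFinP.
- by rewrite E.
Qed.

Lemma Rintegral_transfer (f : Y -> R) : measurable_fun setT f ->
  \int[m2]_y f y = \int[m1]_x f (phi x).
Proof.
by move=> mf; rewrite /Rintegral integral_transfer//; exact/measurable_EFinP.
Qed.

End transfer.

(** * Affine change of variables on the line *)

Section affine.
Context {R : realType}.
Local Notation mu := (@lebesgue_measure R).

Lemma measurable_affine (a b : R) : measurable_fun setT (fun x : measurableTypeR R => a * x + b : measurableTypeR R).
Proof. by apply: measurable_funD => //; exact: measurable_funM. Qed.

(** Uniqueness of Lebesgue measure: the scaled image measure has the right value on every interval
    []u, v]]. *)
Lemma lebesgue_affine (a b : R) A : a != 0 -> measurable A ->
  mu A = (`|a|%:E * mu ((fun x : R => a * x + b)%R @^-1` A))%E.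
Proof.
move=> a0 mA.
have mixin := isMeasurableFun.Build _ _ _ _ _ (measurable_affine a b).
pose p : {mfun measurableTypeR R >-> measurableTypeR R} :=
  HB.pack (fun x : measurableTypeR R => a * x + b) mixin.
have -> : (`|a|%:E * mu ((fun x : R => a * x + b)%R @^-1` A))%E =
  mscale `|a|%:nng (pushforward mu p) A by [].
apply: (@lebesgue_measure_unique R (mscale `|a|%:nng (pushforward mu p))) => //.
move=> _ [[u v] _ <-] /=.
rewrite -[RHS]/(`|a|%:E * mu ((fun x : R => a * x + b)%R @^-1` `]u, v]))%E.
(* For negative [a] the endpoints are exchanged and the preimage is closed on the left and open on
   the right; its length is the same. *)
have [an|ap] := ltP a 0.
  have -> : (fun x => a * x + b) @^-1` `]u, v] = `[(v - b) / a, (u - b) / a[%classic.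
    apply/seteqP; split => x /=; rewrite !in_itv/=.
      by rewrite ler_ndivrMr// ltr_ndivlMr// => /andP[h1 h2]; apply/andP; split; nra.
    by rewrite ler_ndivrMr// ltr_ndivlMr// => /andP[h1 h2]; apply/andP; split; nra.
  rewrite !lebesgue_measure_itv/= !lte_fin.
  have -> : ((v - b) / a < (u - b) / a) = (u < v).
    by rewrite ltr_ndivrMr// divfK// ltrD2r.
  case: ifPn => _; last by rewrite mule0.
  by rewrite -!EFinD -EFinM ltr0_norm//; congr EFin; field.
have {}ap : 0 < a by rewrite lt_neqAle eq_sym a0.
have -> : (fun x => a * x + b) @^-1` `]u, v] = `](u - b) / a, (v - b) / a]%classic.
  apply/seteqP; split => x /=; rewrite !in_itv/=.
    by rewrite ltr_pdivrMr// ler_pdivlMr// => /andP[h1 h2]; apply/andP; split; nra.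
  by rewrite ltr_pdivrMr// ler_pdivlMr// => /andP[h1 h2]; apply/andP; split; nra.
rewrite !lebesgue_measure_itv/= !lte_fin.
have -> : ((u - b) / a < (v - b) / a) = (u < v).
  by rewrite ltr_pdivrMr// divfK// ltrD2r.
case: ifPn => _; last by rewrite mule0.
by rewrite -!EFinD -EFinM gtr0_norm//; congr EFin; field.
Qed.

Lemma ge0_integral_affine (a b : R) (f : R -> R) : a != 0 ->
  measurable_fun setT f -> (forall x, 0 <= f x) ->
  (\int[mu]_x (f x)%:E = `|a|%:E * \int[mu]_x (f (a * x + b)%R)%:E)%E.
Proof.
move=> a0 mf f0.
rewrite (@integral_transfer _ _ _ _ _ (mscale `|a|%:nng mu) mu _ (measurable_affine a b)).
- rewrite ge0_integral_mscale//=.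
  + apply/measurable_EFinP; apply: measurableT_comp => //.
    exact: measurable_affine.
  + by move=> x _; rewrite lee_fin.
- by move=> A mA; exact: (@lebesgue_affine a b A a0 mA).
- exact/measurable_EFinP.
Qed.

Lemma integrable_affine (a b : R) (f : R -> R) : a != 0 ->
  mu.-integrable setT (EFin \o f) ->
  mu.-integrable setT (EFin \o (fun x => f (a * x + b))).
Proof.
move=> a0 fi; have mf := integrable_measurable fi.
have mg : measurable_fun setT (fun x => f (a * x + b)).
  by apply: (measurableT_comp mf); exact: measurable_affine.
apply/integrableP; split; first exact/measurable_EFinP.
move/integrableP : fi => [_].
under eq_integral do rewrite /=.
rewrite (@ge0_integral_affine a b (fun x => `|f x|))//; last exact: measurableT_comp.
rewrite -[X in _ -> (X < _)%E]/(\int[mu]_x (`|f (a * x + b)|)%:E)%E.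
rewrite [(\int[mu]_x _ < +oo)%E in X in _ -> X]ltey; apply: contraTN => /eqP ->.
by rewrite gt0_muley ?ltxx// lte_fin normr_gt0.
Qed.

Lemma Rintegral_affine (a b : R) (f : R -> R) : a != 0 ->
  mu.-integrable setT (EFin \o f) ->
  \int[mu]_x f x = `|a| * \int[mu]_x f (a * x + b).
Proof.
move=> a0 fi; have mf := integrable_measurable fi.
have fi' := integrable_affine b a0 fi.
rewrite /Rintegral.
rewrite (@integral_transfer _ _ _ _ _ (mscale `|a|%:nng mu) mu _ (measurable_affine a b))//; last first.
- exact/measurable_EFinP.
- by move=> A mA; exact: (@lebesgue_affine a b A a0 mA).
have mg := measurable_int _ fi'.
rewrite integralE (ge0_integral_mscale _ measurableT)//; last exact: measurable_funepos.
rewrite (ge0_integral_mscale _ measurableT)//; last exact: measurable_funeneg.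
have pf := integrable_fin_num measurableT (integrable_funepos measurableT fi').
have nf := integrable_fin_num measurableT (integrable_funeneg measurableT fi').
rewrite /= fineB ?fineM ?fin_numM// -mulrBr -fineB//; congr (_ * fine _).
by rewrite [RHS]integralE.
Qed.

End affine.

(** * Integrals of derivatives over the line *)

Section calculus_on_R.
Context {R : realType}.
Local Notation mu := (@lebesgue_measure R).

Lemma continuous_measurable_R (f : R -> R) : continuous f ->
  measurable_fun setT f.
Proof. exact: continuous_measurable_fun. Qed.

Lemma derive_continuous (F f : R -> R) :
  (forall x, is_derive x (1 : R) F (f x)) -> continuous F.
Proof.
by move=> dF x; apply: differentiable_continuous; apply/derivable1_diffP;
  exact: ex_derive.
Qed.

Lemma Rintegral_FTC2 (F f : R -> R) (a b : R) : a < b ->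
  (forall x, is_derive x (1 : R) F (f x)) -> continuous f ->
  \int[mu]_(x in `[a, b]) f x = F b - F a.
Proof.
move=> ab dF cf; have cF := derive_continuous dF.
rewrite /Rintegral (continuous_FTC2 (F := F))//.
- exact: continuous_subspaceT.
- split.
  + by move=> x _; exact: ex_derive.
  + by apply: cvg_at_right_filter; exact: cF.
  + by apply: cvg_at_left_filter; exact: cF.
- by move=> x _; rewrite derive1E; exact: derive_val.
Qed.

Lemma cvg_Rintegral_itv (f : R -> R) : mu.-integrable setT (EFin \o f) ->
  \int[mu]_(x in `[- n.+1%:R, n.+1%:R]) f x @[n --> \oo] --> \int[mu]_x f x.
Proof.
move=> fi; have mf : measurable_fun setT (f : R -> R) := integrable_measurable fi.
have H := @dominated_convergence _ _ _ mu setT measurableT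
  (fun n => (EFin \o (f \_ `[- n.+1%:R, n.+1%:R]))) (EFin \o f)
  (EFin \o (fun x => `|f x|)).
have [||||//|_ _] := H.
- move=> n; apply/measurable_EFinP.
  apply/(measurable_restrictT f) => //. by apply: measurable_funTS; exact: mf.
- exact/measurable_EFinP.
- apply: aeW => x _.
  apply: cvg_near_cst; exists (Num.truncn `|x|).+1 => // n /= xn.
  congr EFin; rewrite patchE mem_set//= in_itv/= -ler_norml.
  apply: ltW; apply: (lt_le_trans (truncnS_gt _)).
  by rewrite ler_nat ltnW.
- exact: integrable_norm.
- apply: aeW => x n _; rewrite lee_fin patchE.
  by case: ifPn => // _; rewrite normr0.
rewrite -(EFin_Rintegral fi) => /fine_cvg.
set u := (X in X @ _ --> _ -> _); set v := (X in _ -> X @ _ --> _).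
suff -> : v = u by [].
apply/funext => n; congr fine.
rewrite integral_mkcond; apply: eq_integral => x _; rewrite /= !patchE.
by case: ifPn.
Qed.

(** The integral over the line is the limit of the integrals over [[-(n+1), n+1]], so limits of [F]
    along the integers suffice. *)
Lemma Rintegral_derive_eq0 (F f : R -> R) :
  (forall x, is_derive x (1 : R) F (f x)) -> continuous f ->
  mu.-integrable setT (EFin \o f) ->
  F n.+1%:R @[n --> \oo] --> 0 -> F (- n.+1%:R) @[n --> \oo] --> 0 ->
  \int[mu]_x f x = 0.
Proof.
move=> dF cf fi Fp Fm; apply: (cvg_unique _ (cvg_Rintegral_itv fi)) => //.
rewrite [X in X @ _](_ : _ = fun n => F n.+1%:R - F (- n.+1%:R)).
  by have H := cvgB Fp Fm; rewrite subr0 in H; exact: H.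
by apply/funext => n; rewrite (Rintegral_FTC2 _ dF)// gtrN.
Qed.

(** The integrand is even, and its integral over the half line is the known arctangent integral. *)
Lemma integrable_oneDsqrV : mu.-integrable setT (EFin \o (fun t : R => (1 + t ^+ 2)^-1)).
Proof.
have pos (t : R) : 0 < 1 + t ^+ 2 by rewrite ltr_pwDl// sqr_ge0.
have c : continuous (fun t : R => (1 + t ^+ 2)^-1) by exact: continuous_oneDsqrV.
apply: ge0_integrable_lty.
- exact: continuous_measurable_R.
- by move=> x; rewrite invr_ge0 ltW.
- rewrite ge0_symfun_integralT//=.
  + rewrite (_ : [set x | _] = `[0, +oo[%classic).
      have := @integral0y_oneDsqr R; rewrite /oneDsqr => ->.
      by rewrite -EFinM ltry.
    by apply/seteqP; split => x/=; rewrite in_itv/= andbT.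
  + by move=> x; rewrite invr_ge0 ltW.
  + by move=> x /=; rewrite sqrrN.
Qed.

End calculus_on_R.

(** * Fubini's theorem under domination by a product *)

Section fubini_dominated.
Context d1 d2 (T1 : measurableType d1) (T2 : measurableType d2) (R : realType).
Variable m1 : {sigma_finite_measure set T1 -> \bar R}.
Variable m2 : {sigma_finite_measure set T2 -> \bar R}.
Variables (F : T1 * T2 -> R) (a : T1 -> R) (b : T2 -> R).
Hypothesis mF : measurable_fun setT F.
Hypothesis ia : m1.-integrable setT (EFin \o a).
Hypothesis ib : m2.-integrable setT (EFin \o b).
Hypothesis Fab : forall x y, `|F (x, y)| <= a x * b y.

Lemma measurable_fun_slice1 x : measurable_fun setT (fun y => F (x, y)).
Proof. by apply: (measurableT_comp mF); exact: measurable_fun_pair. Qed.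

Lemma measurable_fun_slice2 y : measurable_fun setT (fun x => F (x, y)).
Proof. by apply: (measurableT_comp mF); exact: measurable_fun_pair. Qed.

(** Since the domination holds at every point, every slice is integrable and not merely almost every
    one; iterated integrals can then be rewritten without exceptional sets. *)
Lemma integrable_slice1 x : m2.-integrable setT (EFin \o (fun y => F (x, y))).
Proof.
apply: (integrable_dom (measurable_fun_slice1 x) (integrableZ_EFin (a x) ib)).
by move=> y; exact: Fab.
Qed.

Lemma integrable_slice2 y : m1.-integrable setT (EFin \o (fun x => F (x, y))).
Proof.
apply: (integrable_dom (measurable_fun_slice2 y) (integrableZ_EFin (b y) ia)).
by move=> x /=; rewrite mulrC; exact: Fab.
Qed.

Lemma integrable_prod_dom : (m1 \x m2)%E.-integrable setT (EFin \o F).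
Proof.
apply/integrable12ltyP; first exact/measurable_EFinP.
have mnF : measurable_fun setT (fun z => `|F z|) by exact: measurableT_comp.
apply: (@le_lt_trans _ _ (\int[m1]_x (a x * \int[m2]_y b y)%:E)%E).
  apply: ge0_le_integral => //.
  - by move=> x _; exact: integral_ge0.
  - apply: (measurable_fun_fubini_tonelli_F (fun z => (`|F z|)%:E)) => //.
    exact/measurable_EFinP.
  - apply/measurable_EFinP; apply: measurable_funM => //.
    exact: (integrable_measurable ia).
  - move=> x _; rewrite -RintegralZl// EFin_Rintegral; last exact: integrableZ_EFin.
    apply: ge0_le_integral => //.
    + by apply: measurableT_comp => //; apply/measurable_EFinP; exact: measurable_fun_slice1.
    + apply/measurable_EFinP; apply: measurable_funM => //.
      exact: (integrable_measurable ib).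
    + by move=> y _; rewrite lee_fin Fab.
apply: integrable_lty => //.
apply: eq_integrable (integrableZ_EFin (\int[m2]_y b y) ia) => //.
by move=> x _ /=; rewrite mulrC.
Qed.

Let I1 : (EFin \o (fun x => \int[m2]_y F (x, y))) =
  fubini_F m2 (EFin \o F).
Proof.
by apply/funext => x /=; rewrite EFin_Rintegral//; exact: integrable_slice1.
Qed.

Let I2 : (EFin \o (fun y => \int[m1]_x F (x, y))) =
  fubini_G m1 (EFin \o F).
Proof.
by apply/funext => x /=; rewrite EFin_Rintegral//; exact: integrable_slice2.
Qed.

Lemma integrable_Rfubini1 :
  m1.-integrable setT (EFin \o (fun x => \int[m2]_y F (x, y))).
Proof. by rewrite I1; exact: integrable_fubini_F integrable_prod_dom. Qed.

Lemma Rfubini1 : \int[(m1 \x m2)%E]_z F z = \int[m1]_x (\int[m2]_y F (x, y)).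
Proof.
rewrite /Rintegral -(integral12_prod_meas1 integrable_prod_dom).
by congr fine; have := I1; rewrite /Rintegral => <-.
Qed.

Lemma Rfubini2 : \int[(m1 \x m2)%E]_z F z = \int[m2]_y (\int[m1]_x F (x, y)).
Proof.
rewrite /Rintegral -(integral21_prod_meas1 integrable_prod_dom).
by congr fine; have := I2; rewrite /Rintegral => <-.
Qed.

End fubini_dominated.

(** * Lebesgue measure on R^n: boxes, coordinate lines, tensor products *)

Section boxes.
Context {R : realType}.
Local Notation mu := (@lebesgue_measure R).

Definition box n (A : 'I_n -> set R) : set Rn[R]_n :=
  [set x | forall i, A i (tnth x i)].

Definition ocbox n : set (set Rn[R]_n) :=
  [set X | exists a b : 'I_n -> R, X = box (fun i => `]a i, b i]%classic)].

Definition cube n (k : nat) : set Rn[R]_n :=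
  box (fun=> `](- k%:R), k%:R]%classic).

Lemma measurable_box n (A : 'I_n -> set R) : (forall i, measurable (A i)) ->
  measurable (box A).
Proof.
move=> mA; rewrite (_ : box A = \bigcap_(i in [set: 'I_n])
    ((fun x : Rn[R]_n => tnth x i) @^-1` A i)); last first.
  by apply/seteqP; split => x /= h; [move=> i _; exact: h|move=> i; exact: h].
apply: fin_bigcap_measurable => // i _.
rewrite -[X in measurable X]setTI.
by apply: (@measurable_tnth _ (measurableTypeR R) n i) => //; exact: mA.
Qed.

Lemma measurable_ocbox n X : @ocbox n X -> measurable X.
Proof. by move=> [a [b ->]]; apply: measurable_box => i; exact: measurable_itv. Qed.

Lemma ocbox_setI n : setI_closed (@ocbox n).
Proof.
move=> _ _ [a [b ->]] [a' [b' ->]].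
exists (fun i => Num.max (a i) (a' i)), (fun i => Num.min (b i) (b' i)).
apply/seteqP; split => x /=.
  move=> [h1 h2] i; have := h1 i; have := h2 i; rewrite /= !in_itv/=.
  by rewrite gt_max le_min => /andP[-> ->] /andP[-> ->].
move=> h; split => i; have := h i; rewrite /= !in_itv/= gt_max le_min.
  by move=> /andP[/andP[-> _] /andP[-> _]].
by move=> /andP[/andP[_ ->] /andP[_ ->]].
Qed.

Lemma cube_ocbox n k : ocbox (@cube n k).
Proof. by exists (fun=> - k%:R), (fun=> k%:R). Qed.

Lemma cube_cover n : \bigcup_k @cube n k = setT.
Proof.
apply/seteqP; split => // x _.
exists (\max_(i < n) (Num.truncn `|tnth x i|).+1)%N => // i /=.
rewrite in_itv/=; have : `|tnth x i| < (\max_(i < n) (Num.truncn `|tnth x i|).+1)%N%:R.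
  apply: (lt_le_trans (truncnS_gt _)); rewrite ler_nat.
  exact: (leq_bigmax i).
by rewrite ltr_norml => /andP[-> /ltW ->].
Qed.

(** The product sigma-algebra is generated by preimages of coordinates, and the preimage of []u, v]]
    under one coordinate is the increasing union of the boxes whose other sides are [](- k), k]]. *)
Lemma measurable_ocboxE n : @measurable _ Rn[R]_n = <<s @ocbox n >>.
Proof.
apply/seteqP; split; last first.
  apply: smallest_sub; first exact: sigma_algebra_measurable.
  by move=> X /measurable_ocbox.
apply: smallest_sub; first exact: smallest_sigma_algebra.
move=> X /=; rewrite -bigcup_seq => -[i _ [B mB <-]].
rewrite setTI.
(* The sets whose preimage under the [i]th coordinate is generated by boxes form a sigma-algebra, so
   only intervals need to be examined. *)
have sB : sigma_algebra setT [set B : set R | <<s @ocbox n >> ((fun x : Rn[R]_n => tnth x i) @^-1` B)].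
  split => /=.
  - by rewrite preimage_set0; exact: sigma_algebra0.
  - move=> A sA; rewrite setTD preimage_setC -setTD.
    exact: sigma_algebraCD.
  - by move=> A sA; rewrite preimage_bigcup; exact: sigma_algebra_bigcup.
apply: (smallest_sub sB _ mB) => _ [[u v] _ <-] /=.
rewrite (_ : _ @^-1` _ = \bigcup_k box (fun l => if l == i then `]u, v]%classic else
  `](- k%:R), k%:R]%classic)).
  apply: sigma_algebra_bigcup => k; apply: sub_gen_smallest.
  exists (fun l => if l == i then u else - k%:R), (fun l => if l == i then v else k%:R).
  by congr box; apply/funext => l; case: ifPn.
apply/seteqP; split => x /=.
  move=> uv; have : (\bigcup_k @cube n k) x by rewrite cube_cover.
  move=> [k _ xk]; exists k => // l; case: ifPn => [/eqP ->//|_]; exact: xk.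
by move=> [k _] /(_ i) /=; rewrite eqxx.
Qed.

Lemma lebesgue_cube_lty n k : (lebesgue_Rn R n (@cube n k) < +oo)%E.
Proof.
rewrite lebesgue_Rn_box; last by move=> i; exact: measurable_itv.
rewrite (eq_bigr (fun=> (k%:R - (- k%:R))%:E)); last first.
  move=> i _; rewrite lebesgue_measure_itv/= lte_fin; case: ifPn => [_|]; first by rewrite -EFinD.
  (* Here [k = 0]: the interval is empty and both sides are 0. *)
  by rewrite -leNgt => h; have k0 := ler0n R k; rewrite -[LHS]/(0%:E); congr EFin; lra.
by rewrite prodEFin ltry.
Qed.

(** Half-open boxes form a pi-system that generates the Borel sets and contains cubes of finite
    measure exhausting the space, so the uniqueness theorem for measures applies. *)
Lemma lebesgue_Rn_unique n (m : {measure set Rn[R]_n -> \bar R}) :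
  (forall A : 'I_n -> set R, (forall i, measurable (A i)) ->
    m (box A) = (\big[*%E/1%E]_(i < n) mu (A i))%E) ->
  forall X, measurable X -> lebesgue_Rn R n X = m X.
Proof.
move=> mbox X mX; apply: (measure_unique (@ocbox n) (@cube n)) => //.
- exact: measurable_ocboxE.
- exact: ocbox_setI.
- exact: cube_ocbox.
- exact: cube_cover.
- move=> A [a [b ->]]; rewrite mbox; last by move=> i; exact: measurable_itv.
  by rewrite -lebesgue_Rn_box//; move=> i; exact: measurable_itv.
- exact: lebesgue_cube_lty.
Qed.

End boxes.

Lemma measurable_fun_bigprod d (T : measurableType d) (R : realType) (I : Type)
    (s : seq I) (P : pred I) (f : I -> T -> R) :
  (forall i, measurable_fun setT (f i)) ->
  measurable_fun setT (fun x => \prod_(i <- s | P i) f i x).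
Proof.
move=> mf; elim: s => [|i s IHs].
  by under eq_fun do rewrite big_nil; exact: measurable_cst.
under eq_fun do rewrite big_cons.
by case: (P i) => //; exact: measurable_funM.
Qed.

Section slices.
Context {R : realType}.
Local Notation mu := (@lebesgue_measure R).

Lemma tnth_insc n (j : 'I_n.+1) (w : Rn[R]_n) (t : R) (i : 'I_n.+1) :
  tnth (@insc R n.+1 j w t) i = if unlift j i is Some k then tnth w k else t.
Proof. by rewrite tnth_mktuple. Qed.

Lemma tnth_insc_id n (j : 'I_n.+1) (w : Rn[R]_n) (t : R) :
  tnth (@insc R n.+1 j w t) j = t.
Proof. by rewrite tnth_insc unlift_none. Qed.

Lemma tnth_insc_lift n (j : 'I_n.+1) (w : Rn[R]_n) (t : R) k :
  tnth (@insc R n.+1 j w t) (lift j k) = tnth w k.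
Proof. by rewrite tnth_insc liftK. Qed.

Definition delc n (j : 'I_n.+1) (p : Rn[R]_n.+1) : Rn[R]_n :=
  [tuple tnth p (lift j k) | k < n].

Lemma inscK n (j : 'I_n.+1) (p : Rn[R]_n.+1) :
  @insc R n.+1 j (delc j p) (tnth p j) = p.
Proof.
apply: eq_from_tnth => i; rewrite tnth_insc.
by case: unliftP => [k ->|->//]; rewrite tnth_mktuple.
Qed.

Lemma setc_insc n (j : 'I_n.+1) (w : Rn[R]_n) (s t : R) :
  setc (@insc R n.+1 j w s) j t = @insc R n.+1 j w t.
Proof.
apply: eq_from_tnth => i; rewrite tnth_mktuple !tnth_insc.
by case: unliftP => [k ->|->]; rewrite ?eqxx// eq_sym (negbTE (neq_lift _ _)).
Qed.

Lemma setc_delc n (j : 'I_n.+1) (p : Rn[R]_n.+1) (t : R) :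
  setc p j t = @insc R n.+1 j (delc j p) t.
Proof. by rewrite -{1}(inscK j p) setc_insc. Qed.

Definition pair_insc n (j : 'I_n.+1) (z : measurableTypeR R * Rn[R]_n) : Rn[R]_n.+1 :=
  @insc R n.+1 j z.2 z.1.

Lemma measurable_pair_insc n (j : 'I_n.+1) : measurable_fun setT (pair_insc j).
Proof.
apply/measurable_fun_tnthP => i.
have [k ->|->] := unliftP j i.
  rewrite (_ : _ \o _ = fun z => tnth z.2 k); last first.
    by apply/funext => z /=; rewrite tnth_insc_lift.
  apply: (@measurableT_comp _ _ _ _ _ _ (fun x : Rn[R]_n => tnth x k)) => //.
  exact: measurable_tnth.
rewrite (_ : _ \o _ = fst)//.
by apply/funext => z /=; rewrite tnth_insc_id.
Qed.

(** The recursion that defines [lebesgue_Rn] splits off coordinate 0 only. The product formula on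
    boxes is symmetric in the coordinates, so by uniqueness any coordinate [j] may be split off
    instead. *)
Lemma lebesgue_Rn_insc n (j : 'I_n.+1) A : measurable A ->
  lebesgue_Rn R n.+1 A =
  (mu \x lebesgue_Rn R n)%E (pair_insc j @^-1` A).
Proof.
have mixin := isMeasurableFun.Build _ _ _ _ _ (measurable_pair_insc j).
pose p : {mfun _ >-> _} := HB.pack (pair_insc j) mixin.
apply: (@lebesgue_Rn_unique _ _ (pushforward (mu \x lebesgue_Rn R n)%E p)).
move=> {}A mA; rewrite -[LHS]/((mu \x lebesgue_Rn R n)%E (pair_insc j @^-1` box A)).
have -> : pair_insc j @^-1` box A = A j `*` box (fun k => A (lift j k)).
  apply/seteqP; split => -[t w] /=.
    move=> h; split; first by have := h j; rewrite tnth_insc_id.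
    by move=> k; have := h (lift j k); rewrite tnth_insc_lift.
  move=> [h0 h] i; have [k ->|->] := unliftP j i.
    by rewrite tnth_insc_lift; exact: h.
  by rewrite tnth_insc_id.
rewrite product_measure1E//; last by apply: measurable_box => k; exact: mA.
rewrite lebesgue_Rn_box; last by move=> k; exact: mA.
rewrite [RHS](bigD1 j)//=; congr (_ * _)%E.
rewrite (reindex_omap (lift j) (unlift j)) /=; last first.
  by move=> i; rewrite eq_sym => /unlift_some[k -> _] /=; rewrite liftK.
by apply: eq_bigl => k; rewrite liftK eqxx andbT eq_sym neq_lift.
exact: mA.
Qed.

Lemma measurable_delc n (j : 'I_n.+1) : measurable_fun setT (@delc n j).
Proof.
apply/measurable_fun_tnthP => i.
rewrite (_ : _ \o _ = fun p => tnth p (lift j i)); first exact: measurable_tnth.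
by apply/funext => z /=; rewrite tnth_mktuple.
Qed.

Lemma negligible_delc n (j : 'I_n.+1) (N : set Rn[R]_n) :
  (lebesgue_Rn R n).-negligible N ->
  (lebesgue_Rn R n.+1).-negligible (@delc n j @^-1` N).
Proof.
move=> [B [mB B0 NB]]; exists (@delc n j @^-1` B); split.
- by rewrite -[X in measurable X]setTI; exact: measurable_delc.
- rewrite (lebesgue_Rn_insc j); last first.
    by rewrite -[X in measurable X]setTI; exact: measurable_delc.
  have -> : pair_insc j @^-1` (@delc n j @^-1` B) = setT `*` B.
    have dK (z : R * Rn[R]_n) : delc j (pair_insc j z) = z.2.
      by apply: eq_from_tnth => i; rewrite tnth_mktuple tnth_insc_lift.
    by apply/seteqP; split => z /=; rewrite dK// => -[].
  (* The cylinder over a null set has measure [+oo * 0], which is 0 in the extended reals. *)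
  rewrite product_measure1E// (_ : lebesgue_Rn R n B = 0%E) ?mule0//.
- by move=> p /= /NB.
Qed.

(** Tonelli: the measure of a Borel null set containing [N] is the integral of the lengths of its
    slices, so almost all of these lengths vanish. *)
Lemma negligible_insc n (j : 'I_n.+1) (N : set Rn[R]_n.+1) :
  (lebesgue_Rn R n.+1).-negligible N ->
  {ae lebesgue_Rn R n, forall w, mu.-negligible [set t | N (@insc R n.+1 j w t)]}.
Proof.
move=> [B [mB B0 NB]].
pose B' := pair_insc j @^-1` B.
have mB' : measurable B'.
  by rewrite -[X in measurable X]setTI; exact: measurable_pair_insc.
have B'0 : (mu \x lebesgue_Rn R n)%E B' = 0%E by rewrite -lebesgue_Rn_insc.
have mI : measurable_fun setT (EFin \o (\1_B' : _ -> R)).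
  by apply/measurable_EFinP; exact: measurable_indic.
have I0 z : (0 <= (EFin \o (\1_B' : _ -> R)) z)%E by rewrite lee_fin.
have G0 : (\int[mu \x lebesgue_Rn R n]_z (EFin \o (\1_B' : _ -> R)) z = 0)%E.
  by rewrite integral_indic// setIT.
rewrite fubini_tonelli2// in G0.
pose G := fubini_G mu (EFin \o (\1_B' : _ -> R)).
have mG : measurable_fun setT G by exact: measurable_fun_fubini_tonelli_G.
have G_ge0 w : (0 <= G w)%E by exact: integral_ge0.
have : ae_eq (lebesgue_Rn R n) setT G (cst 0%E).
  apply/ae_eq_integral_abs => //.
  by under eq_integral do rewrite gee0_abs//.
apply: filterS => w /(_ I) Gw0.
exists [set t | B (@insc R n.+1 j w t)]; split => /=.
- have := measurable_ysection w mB'; congr (measurable _).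
  by apply/seteqP; split => t; rewrite /ysection /= inE.
- rewrite -[RHS]Gw0 /G /fubini_G.
  have -> : [set t | B (@insc R n.+1 j w t)] = ysection B' w.
    by apply/seteqP; split => t; rewrite /ysection /= inE.
  rewrite -[ysection B' w]setIT -integral_indic//; last exact: measurable_ysection.
  by apply: eq_integral => t _; rewrite !indicE mem_ysection.
- by move=> t /= /NB.
Qed.

Lemma measurable_tensor n (a : 'I_n -> R -> R) (P : pred 'I_n) :
  (forall i, measurable_fun setT (a i)) ->
  measurable_fun setT (fun x : Rn[R]_n => \prod_(i | P i) a i (tnth x i)).
Proof.
move=> ma; apply: measurable_fun_bigprod => i.
by apply: (measurableT_comp (ma i)); exact: measurable_tnth.
Qed.

Lemma integral_lebesgue_R0 (f : Rn[R]_0 -> \bar R) : measurable_fun setT f ->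
  (\int[lebesgue_Rn R 0]_x f x = f [tuple])%E.
Proof.
move=> mf; rewrite -[LHS]/(\int[\d_([tuple] : Rn[R]_0)]_x f x)%E.
by rewrite integral_dirac// diracT mul1e.
Qed.

(** Induction on [n]: Fubini splits off coordinate 0, and in dimension 0 the integral is evaluation
    at the only point. *)
Lemma integrable_Rintegral_tensor n (a : 'I_n -> R -> R) :
  (forall i, mu.-integrable setT (EFin \o a i)) ->
  (lebesgue_Rn R n).-integrable setT
    (EFin \o (fun x : Rn[R]_n => \prod_i a i (tnth x i))) /\
  \int[lebesgue_Rn R n]_x (\prod_i a i (tnth x i)) =
  \prod_i \int[mu]_t a i t.
Proof.
elim: n a => [|n IHn] a ia.
  have E : (fun x : Rn[R]_0 => \prod_i a i (tnth x i)) = cst 1.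
    by apply/funext => x; rewrite big_ord0.
  rewrite E big_ord0; split.
    apply: ge0_integrable_lty => //.
    by rewrite integral_lebesgue_R0; [rewrite ltry|exact/measurable_EFinP].
  by rewrite /Rintegral integral_lebesgue_R0; [|exact/measurable_EFinP].
have ma i : measurable_fun setT (a i) := integrable_measurable (ia i).
have [iB IB] := IHn (fun k => a (lift ord0 k)) (fun k => ia (lift ord0 k)).
have mf := measurable_tensor xpredT ma.
set f := (X in measurable_fun _ X) in mf *.
have fE z : f (pair_insc ord0 z) =
    a ord0 z.1 * \prod_(k < n) a (lift ord0 k) (tnth z.2 k).
  rewrite /f big_ord_recl tnth_insc_id; congr (_ * _).
  by apply: eq_bigr => k _; rewrite tnth_insc_lift.
have T := lebesgue_Rn_insc (ord0 : 'I_n.+1).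
have mfp : measurable_fun setT (f \o pair_insc ord0).
  by apply: (measurableT_comp mf); exact: measurable_pair_insc.
have dom (x : R) (y : Rn[R]_n) : `|f (pair_insc ord0 (x, y))| <=
    `|a ord0 x| * `|\prod_(k < n) a (lift ord0 k) (tnth y k)|.
  by rewrite fE normrM.
have iP := integrable_prod_dom mfp (integrable_norm (ia ord0)) (integrable_norm iB) dom.
split.
  apply/(integrable_transfer (measurable_pair_insc ord0) T) => //.
rewrite (Rintegral_transfer (measurable_pair_insc ord0) T)//.
rewrite (Rfubini1 mfp (integrable_norm (ia ord0)) (integrable_norm iB) dom).
rewrite big_ord_recl -IB -RintegralZr//.
by apply: eq_Rintegral => t _; rewrite -RintegralZl//; apply: eq_Rintegral => w _; rewrite /= fE.
Qed.

End slices.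

(** Inside a fixed cube the Borel sets over which [h] integrates to 0 form a lambda-system
    containing the pi-system of half-open boxes, hence are all the Borel sets. The argument is run
    cube by cube because [h] is integrable only locally. *)
Lemma ae_eq0_ocbox (R : realType) n (h : Rn[R]_n -> R) :
  measurable_fun setT h ->
  (forall k, (lebesgue_Rn R n).-integrable (@cube R n k) (EFin \o h)) ->
  (forall X, @ocbox R n X -> \int[lebesgue_Rn R n]_(x in X) h x = 0) ->
  {ae lebesgue_Rn R n, forall x, h x = 0}.
Proof.
move=> mh ih h0.
set mu := (lebesgue_Rn R n : {measure set _ -> \bar R}).
have mcube k : measurable (@cube R n k) by apply: measurable_ocbox; exact: cube_ocbox.
have ihE k E : measurable E -> mu.-integrable (E `&` @cube R n k) (EFin \o h).
  move=> mE; apply: integrableS (ih k) => //; first exact: measurableI.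
have intcube k : forall E, measurable E -> (\int[mu]_(x in E `&` @cube R n k) (h x)%:E = 0)%E.
  pose H := [set E | measurable E /\ (\int[mu]_(x in E `&` @cube R n k) (h x)%:E = 0)%E].
  move=> E; suff : <<s @ocbox R n >> `<=` H.
    by rewrite -measurable_ocboxE => sub mE; have [] := sub _ mE.
  have fin X : ocbox X -> (\int[mu]_(x in X `&` @cube R n k) (h x)%:E = 0)%E.
    move=> oX; have oXk : ocbox (X `&` @cube R n k) by apply: ocbox_setI => //; exact: cube_ocbox.
    have := h0 _ oXk; rewrite /Rintegral => h0X.
    rewrite -[LHS]fineK; first by rewrite [X in X%:E]h0X.
    by apply: integrable_fin_num; [exact: (@measurable_ocbox _ _ _ oXk)|by apply: ihE; exact: measurable_ocbox].
  apply: (lambda_system_subset (@ocbox_setI R n)) => //; last first.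
    by move=> X oX; split; [exact: measurable_ocbox|exact: fin].
  split => //.
  - split; first exact: measurableT.
    by rewrite setTI -[@cube R n k]setIid; apply: fin; exact: cube_ocbox.
  - move=> A B BA [mA A0] [mB B0]; split; first exact: measurableD.
    have mAk : measurable (A `&` @cube R n k) by exact: measurableI.
    have mBk : measurable (B `&` @cube R n k) by exact: measurableI.
    have AkE : A `&` @cube R n k = ((A `\` B) `&` @cube R n k) `|` (B `&` @cube R n k).
      apply/seteqP; split => x /=.
        by move=> [Ax kx]; have [Bx|Bx] := pselect (B x); [right|left].
      by move=> [[[Ax _] kx]//|[/BA Ax kx]].
    move: A0; rewrite {1}AkE integral_setU_EFin//; first last.
    + by rewrite disj_set2E; apply/eqP/seteqP; split => x //= [[[_ Bx] _] [Bx' _]].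
    + rewrite -AkE; exact: measurable_funTS.
    + by apply: measurableI => //; exact: measurableD.
    by rewrite B0 adde0.
  (* Increasing unions: dominated convergence, with [|h|] on the cube as dominating function. *)
  - move=> F ndF HF; split; first by apply: bigcup_measurable => i _; have [] := HF i.
    have mF i : measurable (F i) by have [] := HF i.
    rewrite setI_bigcupl.
    have ndFk : nondecreasing_seq (fun i => F i `&` @cube R n k).
      by move=> i j ij; apply/subsetPset; apply: setSI; exact/subsetPset/ndF.
    rewrite integral_mkcond.
    have [|||||_ _] := @dominated_convergence _ _ _ mu setT measurableT
      (fun i => ((EFin \o h) \_ (F i `&` @cube R n k)))
      ((EFin \o h) \_ (\bigcup_i (F i `&` @cube R n k)))
      ((fun x => `|h x|%:E) \_ (@cube R n k)).
    + move=> i; apply/(measurable_restrictT _ (measurableI _ _ (mF i) (mcube k))).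
      by apply: measurable_funTS; exact/measurable_EFinP.
    + have mU : measurable (\bigcup_i (F i `&` @cube R n k)).
        by apply: bigcup_measurable => i _; exact: measurableI.
      apply/(measurable_restrictT _ mU).
      by apply: measurable_funTS; exact/measurable_EFinP.
    + apply: aeW => x _; have [[i _ Fix]|nx] := pselect ((\bigcup_i (F i `&` @cube R n k)) x).
        apply: cvg_near_cst; exists i => // j /= ij.
        have /subsetPset sub := ndFk _ _ ij.
        by rewrite !patchE (mem_set (sub _ Fix)) mem_set//; exists i.
      apply: cvg_near_cst; apply: nearW => j.
      rewrite !patchE memNset ?memNset//; first by move=> Fj; apply: nx; exists j.
    + by apply/(integrable_mkcond _ (mcube k)); exact: integrable_norm.
    + apply: aeW => x i _; rewrite !patchE.
      case: ifPn => [/set_mem[_ kx]|_]; first by rewrite mem_set.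
      (* Off the set, a restricted function takes the default value [point], which is 0 in the
         extended reals. *)
      by have -> : (point : \bar R) = 0%E by []; rewrite abse0; case: ifPn.
    rewrite [X in X @ _ --> _](_ : _ = fun=> 0%E); last first.
      apply/funext => i; have [_] := HF i.
      by rewrite integral_mkcond.
    by move=> /cvg_lim <-//; rewrite lim_cst.
have aek k : {ae mu, forall x, @cube R n k x -> h x = 0}.
  have : ae_eq mu (@cube R n k) (EFin \o h) (cst 0%E).
    apply: integral_ae_eq => // E Ek mE.
    by rewrite integral0 -(intcube k _ mE) setIidl.
  by apply: filterS => x + kx => /(_ kx) [].
have : mu.-negligible (\bigcup_k ~` [set x | @cube R n k x -> h x = 0]).
  by apply: negligible_bigcup => k; exact: aek.
apply: negligibleS => x /= hx.
have : (\bigcup_k @cube R n k) x by rewrite cube_cover.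
move=> [k _ kx]; exists k => //= /(_ kx); exact: hx.
Qed.

(** * Complex-valued integrals *)

Section complex_integral.
Context d (T : measurableType d) (R : realType).
Variable mu : {measure set T -> \bar R}.
Local Notation C := (R[i]).
Implicit Types (z w : C) (f g : T -> C).

Lemma cReM z w : complex.Re (z * w) =
  complex.Re z * complex.Re w - complex.Im z * complex.Im w.
Proof. by case: z w => [a b] [a' b']. Qed.

Lemma cImM z w : complex.Im (z * w) =
  complex.Re z * complex.Im w + complex.Im z * complex.Re w.
Proof. by case: z w => [a b] [a' b']. Qed.

Lemma cReD z w : complex.Re (z + w) = complex.Re z + complex.Re w.
Proof. by case: z w => [a b] [a' b']. Qed.

Lemma cImD z w : complex.Im (z + w) = complex.Im z + complex.Im w.
Proof. by case: z w => [a b] [a' b']. Qed.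

Lemma cReN z : complex.Re (- z) = - complex.Re z.
Proof. by case: z. Qed.

Lemma cImN z : complex.Im (- z) = - complex.Im z.
Proof. by case: z. Qed.

Lemma cabsM z w : cabs (z * w) = cabs z * cabs w.
Proof. exact: ComplexField.Normc.normcM. Qed.

Lemma cabsD z w : cabs (z + w) <= cabs z + cabs w.
Proof. exact: le_normcD. Qed.

Lemma cabsN z : cabs (- z) = cabs z.
Proof. exact: normcN. Qed.

Lemma cabs_ge0 z : 0 <= cabs z.
Proof. by case: z => a b; exact: sqrtr_ge0. Qed.

Lemma cabs0 : cabs (0 : C) = 0.
Proof. exact: ComplexField.Normc.normc0. Qed.

Lemma sqr_cabs z : cabs z ^+ 2 = complex.Re z ^+ 2 + complex.Im z ^+ 2.
Proof. by case: z => a b; rewrite /cabs /= sqr_sqrtr// addr_ge0// sqr_ge0. Qed.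

Lemma cRe_le z : `|complex.Re z| <= cabs z.
Proof.
rewrite -(ler_pXn2r (_ : (0 < 2)%N)) ?nnegrE ?cabs_ge0// sqr_cabs real_normK ?num_real//.
by rewrite lerDl sqr_ge0.
Qed.

Lemma cIm_le z : `|complex.Im z| <= cabs z.
Proof.
rewrite -(ler_pXn2r (_ : (0 < 2)%N)) ?nnegrE ?cabs_ge0// sqr_cabs real_normK ?num_real//.
by rewrite lerDr sqr_ge0.
Qed.

Lemma cabs_le z : cabs z <= `|complex.Re z| + `|complex.Im z|.
Proof.
have h : 0 <= `|complex.Re z| + `|complex.Im z| by exact: addr_ge0.
rewrite -(ler_pXn2r (_ : (0 < 2)%N)) ?nnegrE ?cabs_ge0// sqr_cabs.
rewrite -(real_normK (num_real (complex.Re z))) -(real_normK (num_real (complex.Im z))).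
have := normr_ge0 (complex.Re z); have := normr_ge0 (complex.Im z); nra.
Qed.

Lemma cabs_real (a : R) : cabs (a%:C)%C = `|a|.
Proof. by rewrite /cabs /= expr0n/= addr0 sqrtr_sqr. Qed.

Lemma cabs_expi (t : R) : cabs (expi t) = 1.
Proof. by rewrite /cabs /expi /= cos2Dsin2 sqrtr1. Qed.

Lemma expiD (s t : R) : expi (s + t) = expi s * expi t.
Proof.
apply/eqP; rewrite eq_complex; apply/andP; split; apply/eqP => /=.
  by rewrite cosD.
by rewrite sinD addrC.
Qed.

Lemma expi0 : expi (0 : R) = 1.
Proof. by rewrite /expi cos0 sin0. Qed.

Definition cmeas f := measurable_fun setT (fun x => complex.Re (f x)) /\
  measurable_fun setT (fun x => complex.Im (f x)).

(** The formula of [cintegral] for an arbitrary measure, so that [cintegralE] holds by conversion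
    while products and line integrals are covered too. *)
Definition cint f : C := ((Rintegral mu setT (fun x => complex.Re (f x))) +i*
  (Rintegral mu setT (fun x => complex.Im (f x))))%C.

Definition cintegrable f := mu.-integrable setT (EFin \o (fun x => complex.Re (f x))) /\
  mu.-integrable setT (EFin \o (fun x => complex.Im (f x))).

Lemma complex_eq z w : complex.Re z = complex.Re w ->
  complex.Im z = complex.Im w -> z = w.
Proof. by case: z w => [a b] [a' b'] /= -> ->. Qed.

Lemma cmeas_cst z : cmeas (cst z).
Proof. by split; exact: measurable_cst. Qed.

Lemma cmeasM f g : cmeas f -> cmeas g -> cmeas (fun x => f x * g x).
Proof.
move=> [fr fi] [gr gi]; split.
  under eq_fun do rewrite cReM.
  by apply: measurable_funB; exact: measurable_funM.
under eq_fun do rewrite cImM.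
by apply: measurable_funD; exact: measurable_funM.
Qed.

Lemma cmeasD f g : cmeas f -> cmeas g -> cmeas (fun x => f x + g x).
Proof.
move=> [fr fi] [gr gi]; split.
  by under eq_fun do rewrite cReD; exact: measurable_funD.
by under eq_fun do rewrite cImD; exact: measurable_funD.
Qed.

Lemma cmeasN f : cmeas f -> cmeas (fun x => - f x).
Proof.
move=> [fr fi]; split.
  by under eq_fun do rewrite cReN; exact: measurable_funN.
by under eq_fun do rewrite cImN; exact: measurable_funN.
Qed.

Lemma cmeas_real (a : T -> R) : measurable_fun setT a ->
  cmeas (fun x => (a x)%:C%C).
Proof. by move=> ma; split => //=; exact: measurable_cst. Qed.

Lemma cmeas_expi (a : T -> R) : measurable_fun setT a ->
  cmeas (fun x => expi (a x)).
Proof.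
move=> ma; split => /=; apply: (measurableT_comp _ ma).
  by apply: continuous_measurable_fun; exact: continuous_cos.
by apply: continuous_measurable_fun; exact: continuous_sin.
Qed.

Lemma measurable_cabs f : cmeas f -> measurable_fun setT (fun x => cabs (f x)).
Proof.
move=> [mr mi].
have -> : (fun x => cabs (f x)) = (fun x => Num.sqrt (complex.Re (f x) ^+ 2 + complex.Im (f x) ^+ 2)).
  by apply/funext => x; case: (f x).
apply: (measurableT_comp (continuous_measurable_fun (@sqrt_continuous R))).
by apply: measurable_funD; exact: measurable_funX.
Qed.

Lemma cintegrable_dom f (G : T -> R) : cmeas f ->
  mu.-integrable setT (EFin \o G) -> (forall x, cabs (f x) <= G x) ->
  cintegrable f.
Proof.
move=> [mr mi] iG fG; split.
  by apply: integrable_dom iG _ => // x; apply: le_trans (fG x); exact: cRe_le.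
by apply: integrable_dom iG _ => // x; apply: le_trans (fG x); exact: cIm_le.
Qed.

Lemma cintegrable_cmeas f : cintegrable f -> cmeas f.
Proof. by move=> [fr fi]; split; [exact: (integrable_measurable fr)|exact: (integrable_measurable fi)]. Qed.

Lemma cintegrable_cabs f : cintegrable f ->
  mu.-integrable setT (EFin \o (fun x => cabs (f x))).
Proof.
move=> fi; have mf := cintegrable_cmeas fi; have [ir ii] := fi.
apply: (integrable_dom (measurable_cabs mf)).
  exact: (integrableD_EFin (integrable_norm ir) (integrable_norm ii)).
by move=> x /=; rewrite ger0_norm ?cabs_ge0//; exact: cabs_le.
Qed.

(** The factor 2 comes from estimating real and imaginary parts separately; all applications are
    insensitive to constants. *)
Lemma cabs_cint f (G : T -> R) : cmeas f ->
  mu.-integrable setT (EFin \o G) -> (forall x, cabs (f x) <= G x) ->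
  cabs (cint f) <= 2 * \int[mu]_x G x.
Proof.
move=> [mr mi] iG fG; apply: (le_trans (cabs_le _)) => /=.
rewrite mulr_natl mulr2n; apply: lerD; apply: normr_Rintegral_le => // x.
  by apply: le_trans (fG x); exact: cRe_le.
by apply: le_trans (fG x); exact: cIm_le.
Qed.

Lemma cintZ z f : cintegrable f -> cint (fun x => z * f x) = z * cint f.
Proof.
move=> [ir ii]; apply: complex_eq.
  rewrite cReM /cint/= -!RintegralZl// -RintegralB//; try exact: integrableZ_EFin.
  by apply: eq_Rintegral => x _; rewrite cReM.
rewrite cImM /cint/= -!RintegralZl// -RintegralD//; try exact: integrableZ_EFin.
by apply: eq_Rintegral => x _; rewrite cImM.
Qed.

Lemma cintD f g : cintegrable f -> cintegrable g ->
  cint (fun x => f x + g x) = cint f + cint g.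
Proof.
move=> [fr fi] [gr gi]; apply: complex_eq.
  rewrite cReD /cint/= -RintegralD//.
  by apply: eq_Rintegral => x _; rewrite cReD.
rewrite cImD /cint/= -RintegralD//.
by apply: eq_Rintegral => x _; rewrite cImD.
Qed.

Lemma cintB f g : cintegrable f -> cintegrable g ->
  cint (fun x => f x - g x) = cint f - cint g.
Proof.
move=> [fr fi] [gr gi]; apply: complex_eq.
  rewrite cReD cReN /cint/= -RintegralB//.
  by apply: eq_Rintegral => x _; rewrite cReD cReN.
rewrite cImD cImN /cint/= -RintegralB//.
by apply: eq_Rintegral => x _; rewrite cImD cImN.
Qed.

Lemma cint_real (a : T -> R) : cint (fun x => (a x)%:C%C) = (\int[mu]_x a x)%:C%C.
Proof.
apply: complex_eq => //=; rewrite /Rintegral (eq_integral (cst 0%E))//.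
by rewrite integral0.
Qed.

Lemma eq_cint f g : f =1 g -> cint f = cint g.
Proof. by move=> /funext ->. Qed.

End complex_integral.

(** * Fubini's theorem and tensor products for complex integrands *)

Section complex_fubini.
Context d1 d2 (T1 : measurableType d1) (T2 : measurableType d2) (R : realType).
Variable m1 : {sigma_finite_measure set T1 -> \bar R}.
Variable m2 : {sigma_finite_measure set T2 -> \bar R}.
Variables (F : T1 * T2 -> R[i]) (a : T1 -> R) (b : T2 -> R).
Hypothesis mF : cmeas F.
Hypothesis ia : m1.-integrable setT (EFin \o a).
Hypothesis ib : m2.-integrable setT (EFin \o b).
Hypothesis Fab : forall x y, cabs (F (x, y)) <= a x * b y.

Let Re_ab x y : `|complex.Re (F (x, y))| <= a x * b y.
Proof. by apply: le_trans (Fab x y); exact: cRe_le. Qed.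

Let Im_ab x y : `|complex.Im (F (x, y))| <= a x * b y.
Proof. by apply: le_trans (Fab x y); exact: cIm_le. Qed.

Lemma cintegrable_fubini1 : cintegrable m1 (fun x => cint m2 (fun y => F (x, y))).
Proof.
by split; [exact: (integrable_Rfubini1 mF.1 ia ib Re_ab)|exact: (integrable_Rfubini1 mF.2 ia ib Im_ab)].
Qed.

Lemma cfubini1 : cint (m1 \x m2)%E F = cint m1 (fun x => cint m2 (fun y => F (x, y))).
Proof.
by apply: complex_eq => /=; [exact: (Rfubini1 mF.1 ia ib Re_ab)|exact: (Rfubini1 mF.2 ia ib Im_ab)].
Qed.

Lemma cfubini2 : cint (m1 \x m2)%E F = cint m2 (fun y => cint m1 (fun x => F (x, y))).
Proof.
by apply: complex_eq => /=; [exact: (Rfubini2 mF.1 ia ib Re_ab)|exact: (Rfubini2 mF.2 ia ib Im_ab)].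
Qed.

Lemma cfubini : cint m1 (fun x => cint m2 (fun y => F (x, y))) =
  cint m2 (fun y => cint m1 (fun x => F (x, y))).
Proof. by rewrite -cfubini1 cfubini2. Qed.

End complex_fubini.

Section cabs_big.
Context {R : realType}.

Lemma cabs_prod (I : Type) (s : seq I) (P : pred I) (f : I -> R[i]) :
  cabs (\prod_(i <- s | P i) f i) = \prod_(i <- s | P i) cabs (f i).
Proof.
apply: (big_morph (@cabs R) (@cabsM R)).
exact: ComplexField.Normc.normc1.
Qed.

Lemma cmeas_bigprod d (T : measurableType d) (I : Type)
    (s : seq I) (P : pred I) (f : I -> T -> R[i]) :
  (forall i, cmeas (f i)) -> cmeas (fun x => \prod_(i <- s | P i) f i x).
Proof.
move=> mf; elim: s => [|i s IHs].
  under eq_fun do rewrite big_nil; exact: cmeas_cst.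
under eq_fun do rewrite big_cons.
by case: (P i) => //; exact: cmeasM.
Qed.

Lemma cmeas_comp d1 d2 (T1 : measurableType d1) (T2 : measurableType d2)
    (f : T2 -> R[i]) (g : T1 -> T2) :
  cmeas f -> measurable_fun setT g -> cmeas (f \o g).
Proof. by move=> [fr fi] mg; split; [exact: (measurableT_comp fr mg)|exact: (measurableT_comp fi mg)]. Qed.

Lemma cint_insc n (j : 'I_n.+1) (f : Rn[R]_n.+1 -> R[i]) : cmeas f ->
  cint (lebesgue_Rn R n.+1) f =
  cint (@lebesgue_measure R \x lebesgue_Rn R n)%E (f \o pair_insc j).
Proof.
move=> [fr fi]; have T := @lebesgue_Rn_insc R n j.
by apply: complex_eq => /=; rewrite (Rintegral_transfer (measurable_pair_insc j) T).
Qed.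

Lemma cintegrable_cint_tensor n (h : 'I_n -> R -> R[i]) :
  (forall i, cintegrable (@lebesgue_measure R) (h i)) ->
  cintegrable (lebesgue_Rn R n) (fun x => \prod_i h i (tnth x i)) /\
  cint (lebesgue_Rn R n) (fun x => \prod_i h i (tnth x i)) =
  \prod_i cint (@lebesgue_measure R) (h i).
Proof.
move=> ih.
have mh m (g : 'I_m -> R -> R[i]) : (forall i, cintegrable (@lebesgue_measure R) (g i)) ->
    cmeas (fun x : Rn[R]_m => \prod_i g i (tnth x i)).
  move=> ig; apply: cmeas_bigprod => i.
  apply: (@cmeas_comp _ _ _ _ (g i) (fun x : Rn[R]_m => tnth x i)).
    exact: (cintegrable_cmeas (ig i)).
  exact: measurable_tnth.
have dom m (g : 'I_m -> R -> R[i]) : (forall i, cintegrable (@lebesgue_measure R) (g i)) ->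
    (lebesgue_Rn R m).-integrable setT (EFin \o (fun x => \prod_i cabs (g i (tnth x i)))).
  move=> ig; have [] // := @integrable_Rintegral_tensor R m (fun i t => cabs (g i t)).
  by move=> i; exact: cintegrable_cabs.
have ci m (g : 'I_m -> R -> R[i]) (ig : forall i, cintegrable (@lebesgue_measure R) (g i)) :
    cintegrable (lebesgue_Rn R m) (fun x : Rn[R]_m => \prod_i g i (tnth x i)).
  by apply: (cintegrable_dom (mh _ _ ig) (dom _ _ ig)) => x; rewrite cabs_prod.
split; first exact: ci.
elim: n h ih => [|n IHn] h ih.
  rewrite big_ord0; apply: complex_eq => /=.
    rewrite /Rintegral integral_lebesgue_R0; last by apply/measurable_EFinP; exact: (mh _ _ ih).1.
    by rewrite big_ord0.
  rewrite /Rintegral integral_lebesgue_R0; last by apply/measurable_EFinP; exact: (mh _ _ ih).2.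
  by rewrite big_ord0.
have fE (t : R) (w : Rn[R]_n) : \prod_i h i (tnth (pair_insc ord0 (t, w)) i) =
    h ord0 t * \prod_(k < n) h (lift ord0 k) (tnth w k).
  rewrite big_ord_recl tnth_insc_id; congr (_ * _).
  by apply: eq_bigr => k _; rewrite tnth_insc_lift.
rewrite (cint_insc ord0 (mh _ _ ih)).
have mfp := cmeas_comp (mh _ _ ih) (measurable_pair_insc ord0).
have ih' (k : 'I_n) : cintegrable (@lebesgue_measure R) (h (lift ord0 k)) by [].
have domF (t : R) (w : Rn[R]_n) : cabs (\prod_i h i (tnth (pair_insc ord0 (t, w)) i)) <=
    cabs (h ord0 t) * \prod_(k < n) cabs (h (lift ord0 k) (tnth w k)).
  by rewrite fE cabsM cabs_prod.
rewrite (cfubini1 mfp (cintegrable_cabs (ih ord0)) (dom _ _ ih') domF).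
rewrite big_ord_recl -IHn// mulrC -cintZ//; apply: eq_cint => t /=.
rewrite mulrC -(cintZ _ (ci _ _ ih')).
by apply: eq_cint => w; rewrite fE.
Qed.

End cabs_big.

(** * The Cauchy-Schwarz inequality *)

Section cauchy_schwarz.
Context d (T : measurableType d) (R : realType).
Variable mu : {measure set T -> \bar R}.
Variables u v : T -> R.
Hypotheses (mu_u : measurable_fun setT u) (mu_v : measurable_fun setT v).
Hypothesis iu : mu.-integrable setT (EFin \o (fun x => u x ^+ 2)).
Hypothesis iv : mu.-integrable setT (EFin \o (fun x => v x ^+ 2)).

Lemma integrable_mul_sqr : mu.-integrable setT (EFin \o (fun x => u x * v x)).
Proof.
apply: (integrable_dom (measurable_funM mu_u mu_v) (integrableD_EFin iu iv)) => x.
rewrite normrM; have := normr_ge0 (u x); have := normr_ge0 (v x).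
rewrite -(real_normK (num_real (u x))) -(real_normK (num_real (v x))); nra.
Qed.

(** The integral of [(t u - v)^2] is a nonnegative quadratic polynomial in [t]; evaluate it at its
    minimum [t = B / A]. *)
Lemma Rintegral_cauchy_schwarz :
  (\int[mu]_x (u x * v x)) ^+ 2 <= \int[mu]_x (u x ^+ 2) * \int[mu]_x (v x ^+ 2).
Proof.
set A := \int[mu]_x (u x ^+ 2); set B := \int[mu]_x (u x * v x).
set D := \int[mu]_x (v x ^+ 2).
have iuv := integrable_mul_sqr.
have q t : 0 <= t ^+ 2 * A - 2 * t * B + D.
  rewrite /A /B /D -!RintegralZl// -RintegralB//; [|exact: integrableZ_EFin..].
  rewrite -RintegralD//; last by apply: integrableB_EFin; exact: integrableZ_EFin.
  apply: Rintegral_ge0 => x _.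
  have -> : t ^+ 2 * u x ^+ 2 - 2 * t * (u x * v x) + v x ^+ 2 = (t * u x - v x) ^+ 2 by ring.
  exact: sqr_ge0.
have A0 : 0 <= A by apply: Rintegral_ge0 => x _; exact: sqr_ge0.
have [AE|An0] := eqVneq A 0.
  rewrite AE mul0r; have [->|Bn0] := eqVneq B 0; first by rewrite expr0n.
  (* For [A = 0] the polynomial is affine in [t]; if its slope were nonzero, its value at this [t]
     would be -1. *)
  have := q ((D + 1) / (2 * B)); rewrite AE mulr0 add0r.
  have -> : - (2 * ((D + 1) / (2 * B)) * B) + D = - 1 by field.
  by rewrite lerNr oppr0 ler10.
have Ap : 0 < A by rewrite lt_neqAle eq_sym An0.
have := q (B / A).
have -> : (B / A) ^+ 2 * A - 2 * (B / A) * B + D = (A * D - B ^+ 2) / A by field.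
by rewrite pmulr_lge0 ?invr_gt0// subr_ge0.
Qed.

End cauchy_schwarz.

(** Measurability is assumed of [g] only, since [f] will be an element of a function space that is
    merely almost everywhere equal to a Borel function. *)
Lemma cint_ae d (T : measurableType d) (R : realType)
    (mu : {measure set T -> \bar R}) (f g : T -> R[i]) : cmeas g ->
  {ae mu, forall x, f x = g x} -> cint mu f = cint mu g.
Proof.
move=> [gr gi] fg.
have E (u v : T -> R) : measurable_fun setT v -> {ae mu, forall x, u x = v x} ->
    \int[mu]_x u x = \int[mu]_x v x.
  move=> mv uv; rewrite /Rintegral integralE [in RHS]integralE; congr (fine (_ - _)%E).
    apply: ge0_ae_eq_integralT => //; first by apply: measurable_funepos; exact/measurable_EFinP.
    by apply: filterS uv => x uvx; rewrite !funeposE uvx.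
  apply: ge0_ae_eq_integralT => //; first by apply: measurable_funeneg; exact/measurable_EFinP.
  by apply: filterS uv => x uvx; rewrite !funenegE uvx.
by apply: complex_eq => /=; apply: E => //; apply: filterS fg => x ->.
Qed.

(** * A kernel with Fourier transform equal to 1 on an interval *)

Section derive_rules.
Context {R : realType}.
Implicit Types (f g : R -> R) (t a b : R).

Lemma is_derive_ext f g t a b : f =1 g -> a = b ->
  is_derive t (1 : R) f a -> is_derive t (1 : R) g b.
Proof. by move=> /funext <- <-. Qed.

Lemma der_mul f g t a b : is_derive t (1 : R) f a -> is_derive t (1 : R) g b ->
  is_derive t (1 : R) (fun t => f t * g t) (a * g t + f t * b).
Proof.
move=> df dg; apply: is_derive_ext (is_deriveM df dg) => //.
by rewrite addrC; congr (_ + _); exact: mulrC.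
Qed.

Lemma der_add f g t a b : is_derive t (1 : R) f a -> is_derive t (1 : R) g b ->
  is_derive t (1 : R) (fun t => f t + g t) (a + b).
Proof. by move=> df dg; exact: (is_deriveD df dg). Qed.

Lemma der_opp f t a : is_derive t (1 : R) f a ->
  is_derive t (1 : R) (fun t => - f t) (- a).
Proof. by move=> df; exact: (is_deriveN df). Qed.

Lemma der_sub f g t a b : is_derive t (1 : R) f a -> is_derive t (1 : R) g b ->
  is_derive t (1 : R) (fun t => f t - g t) (a - b).
Proof. by move=> df dg; exact: (is_deriveB df dg). Qed.

Lemma der_scale f t a b : is_derive t (1 : R) f a ->
  is_derive t (1 : R) (fun t => b * f t) (b * a).
Proof. by move=> df; exact: (is_deriveZ b df). Qed.

Lemma der_comp f g t a b : is_derive (g t) (1 : R) f a ->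
  is_derive t (1 : R) g b -> is_derive t (1 : R) (fun t => f (g t)) (a * b).
Proof. by move=> df dg; exact: (is_derive1_comp df dg). Qed.

Lemma der_id t : is_derive t (1 : R) (fun t => t) 1.
Proof. exact: is_derive_id. Qed.

Lemma der_cst t a : is_derive t (1 : R) (fun=> a) 0.
Proof. exact: is_derive_cst. Qed.

Lemma der_mulr t a : is_derive t (1 : R) (fun t => t * a) a.
Proof.
apply: is_derive_ext (der_mul (der_id t) (der_cst t a)) => //.
by rewrite mul1r mulr0 addr0.
Qed.

Lemma der_mull t a : is_derive t (1 : R) (fun t => a * t) a.
Proof.
apply: is_derive_ext (der_mulr t a) => // x.
by rewrite mulrC.
Qed.

Lemma der_cosM t a : is_derive t (1 : R) (fun t => cos (t * a)) (- (a * sin (t * a))).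
Proof.
apply: is_derive_ext (@der_comp cos (fun t => t * a) t _ _ (is_derive_cos _) (der_mulr t a)) => //.
by rewrite mulNr mulrC.
Qed.

Lemma der_sinM t a : is_derive t (1 : R) (fun t => sin (t * a)) (a * cos (t * a)).
Proof.
apply: is_derive_ext (@der_comp sin (fun t => t * a) t _ _ (is_derive_sin _) (der_mulr t a)) => //.
by rewrite mulrC.
Qed.

End derive_rules.

Section under_integral.
Context d (T : measurableType d) (R : realType).
Variable mu : {measure set T -> \bar R}.
Variables (B : set T) (mB : measurable B).
Variables (f df : R -> T -> R) (G : T -> R) (a : R).
Hypothesis intf : forall x, mu.-integrable B (EFin \o f x).
Hypothesis intG : mu.-integrable B (EFin \o G).
Hypothesis derf : forall x y, is_derive x (1 : R) (f ^~ y) (df x y).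
Hypothesis dfG : forall x y, a - 1 < x -> x < a + 1 -> `|df x y| <= G y.

(** The bound is asked for in a window of radius 1 around [a] only, because the bounds available for
    convolution kernels grow with the point. *)
Lemma is_derive_Rintegral :
  is_derive a (1 : R) (fun x => \int[mu]_(y in B) f x y) (\int[mu]_(y in B) df a y).
Proof.
have Ia : `]a - 1, a + 1[%classic a.
  by rewrite /= in_itv/=; apply/andP; split; lra.
have d1 x y : partial1of2 f x y = df x y.
  by rewrite partial1of2E; have := derf x y => dd; exact: derive_val.
have derf1 x y : `]a - 1, a + 1[%classic x -> B y -> derivable (f ^~ y) x 1.
  by move=> _ _; have := derf x y => dd; exact: ex_derive.
have G_ub x y : `]a - 1, a + 1[%classic x -> B y -> `|partial1of2 f x y| <= `|G y|.
  by move=> /=; rewrite in_itv/= d1 => /andP[h1 h2] _; rewrite (le_trans (dfG _ h1 h2))// ler_norm.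
have iG : mu.-integrable B (EFin \o (fun y => `|G y|)) by exact: integrable_norm.
have G0 y : 0 <= `|G y| by [].
apply: DeriveDef.
  exact: (derivable_under_integral mB Ia (fun x _ => intf x) derf1 G0 iG G_ub).
have := differentiation_under_integral mB Ia (fun x _ => intf x) derf1 G0 iG G_ub.
rewrite derive1E => ->.
by apply: eq_Rintegral => y _; rewrite -d1.
Qed.

End under_integral.

(** * The function sin t / t and its derivative *)

Section sinc.
Context {R : realType}.
Local Notation mu := (@lebesgue_measure R).
Local Notation I01 := (`[0%R, 1%R]%classic).

(* sin t / t, written as an integral so as to be differentiable at 0. *)
Definition sinc (t : R) : R := \int[mu]_(s in I01) cos (t * s).
Definition dsinc (t : R) : R := \int[mu]_(s in I01) (- (s * sin (t * s))).

Lemma integrable_bounded_I01 (f : R -> R) (M : R) : continuous f ->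
  mu.-integrable I01 (EFin \o f).
Proof.
move=> cf; apply: continuous_compact_integrable; first exact: segment_compact.
exact: continuous_subspaceT.
Qed.

Lemma continuous_cosMr (t : R) : continuous (fun s => cos (t * s)).
Proof.
move=> s; apply: (@continuous_comp _ _ _ (fun s => t * s) cos); last exact: continuous_cos.
exact: mulrl_continuous.
Qed.

Lemma continuous_sinMr (t : R) : continuous (fun s => sin (t * s)).
Proof.
move=> s; apply: (@continuous_comp _ _ _ (fun s => t * s) sin); last exact: continuous_sin.
exact: mulrl_continuous.
Qed.

Lemma is_derive_sinc (t : R) : is_derive t (1 : R) sinc (dsinc t).
Proof.
apply: (@is_derive_Rintegral _ _ _ mu I01 (measurable_itv _) (fun t s => cos (t * s)) (fun t s => - (s * sin (t * s))) (fun s => `|s|)) => //.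
- by move=> x; apply: integrable_bounded_I01 => //; exact: continuous_cosMr.
- by apply: integrable_bounded_I01 => // s; exact: norm_continuous.
- by move=> x s; exact: der_cosM.
- by move=> x s _ _; rewrite normrN normrM ler_piMr// ler_norml sin_geN1 sin_le1.
Qed.

Lemma continuous_dsinc : continuous dsinc.
Proof.
apply: (@derive_continuous _ _ (fun t => \int[mu]_(s in I01) (- (s * (s * cos (t * s)))))).
move=> t.
apply: (@is_derive_Rintegral _ _ _ mu I01 (measurable_itv _) (fun t s => - (s * sin (t * s))) (fun t s => - (s * (s * cos (t * s)))) (fun s => `|s * s|)) => //.
- move=> x; apply: integrable_bounded_I01 => // s.
  apply: cvgN; apply: cvgM; last exact: continuous_sinMr.
  exact: cvg_id.
- apply: integrable_bounded_I01 => // s.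
  by apply: cvg_norm; apply: cvgM; exact: cvg_id.
- by move=> x s; apply: der_opp; apply: der_scale; exact: der_sinM.
- move=> x s _ _; rewrite normrN mulrA normrM ler_piMr//.
  by rewrite ler_norml cos_geN1 cos_le1.
Qed.

Lemma sincE (t : R) : t * sinc t = sin t.
Proof.
have c : continuous (fun s : R => t * cos (s * t)).
  have -> : (fun s : R => t * cos (s * t)) = (fun s : R => t * cos (t * s)).
    by apply/funext => s; rewrite [s * t]mulrC.
  by move=> s; apply: cvgM; [exact: cvg_cst|exact: continuous_cosMr].
have := Rintegral_FTC2 ltr01 (fun s => der_sinM s t) c.
rewrite mul1r mul0r sin0 subr0 => <-.
rewrite -RintegralZl//; first by apply: eq_Rintegral => s _; rewrite [s * t]mulrC.
by apply: integrable_bounded_I01 => //; exact: continuous_cosMr.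
Qed.

Lemma Rintegral_I01_1 : \int[mu]_(s in I01) 1 = 1 :> R.
Proof.
rewrite Rintegral_cst// mul1r -[RHS]/(fine 1%:E); congr fine.
rewrite -[LHS]/(lebesgue_measure I01).
by rewrite lebesgue_measure_itv/= lte_fin ltr01 -EFinD subr0.
Qed.

Lemma normr_sinc_le1 (t : R) : `|sinc t| <= 1.
Proof.
apply: (le_trans (le_normr_Rintegral _ _)) => //.
  by apply: integrable_bounded_I01 => //; exact: continuous_cosMr.
rewrite -[leRHS]Rintegral_I01_1.
apply: le_Rintegral => //.
- apply: integrable_norm; apply: integrable_bounded_I01 => //; exact: continuous_cosMr.
- by apply: integrable_bounded_I01 => // s; exact: cvg_cst.
- by move=> s _; rewrite ler_norml cos_geN1 cos_le1.
Qed.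

Lemma normr_dsinc_le1 (t : R) : `|dsinc t| <= 1.
Proof.
have ci : continuous (fun s : R => - (s * sin (t * s))).
  move=> s; apply: cvgN; apply: cvgM; last exact: continuous_sinMr.
  exact: cvg_id.
apply: (le_trans (le_normr_Rintegral _ _)) => //.
  exact: integrable_bounded_I01.
rewrite -[leRHS]Rintegral_I01_1.
apply: le_Rintegral => //.
- by apply: integrable_norm; exact: integrable_bounded_I01.
- by apply: integrable_bounded_I01 => // s; exact: cvg_cst.
- move=> s /=; rewrite in_itv/= => /andP[s0 s1]; rewrite normrN normrM ger0_norm//.
  by rewrite mulr_ile1// ler_norml sin_geN1 sin_le1.
Qed.

Lemma sinc_decay (t : R) : `|sinc t| * (1 + `|t|) <= 2.
Proof.
rewrite mulrDr mulr1 -normrM [_ * t]mulrC sincE.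
have : `|sin t| <= 1 by rewrite ler_norml sin_geN1 sin_le1.
by have := normr_sinc_le1 t; lra.
Qed.

(** Both sides of [t * sinc t = sin t] are differentiated. Together with [sincE] this gives the
    decay of [sinc] and [dsinc] like 1 / |t|. *)
Lemma dsincE (t : R) : sinc t + t * dsinc t = cos t.
Proof.
have d1 := der_mul (der_id t) (is_derive_sinc t).
have d2 : is_derive t (1 : R) (fun t => t * sinc t) (cos t).
  by apply: is_derive_ext (is_derive_sin t) => // x; rewrite sincE.
have := derive_val (is_derive := d1); rewrite (derive_val (is_derive := d2)) => ->.
by rewrite mul1r.
Qed.

Lemma dsinc_decay (t : R) : `|dsinc t| * (1 + `|t|) <= 3.
Proof.
rewrite mulrDr mulr1 -normrM [_ * t]mulrC.
have -> : t * dsinc t = cos t - sinc t by rewrite -dsincE addrC addKr.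
have : `|cos t| <= 1 by rewrite ler_norml cos_geN1 cos_le1.
have := ler_normB (cos t) (sinc t).
by have := normr_sinc_le1 t; have := normr_dsinc_le1 t; lra.
Qed.

End sinc.

(** * Fejer kernels and products of sinc functions *)

Section flat_kernel.
Context {R : realType}.
Local Notation mu := (@lebesgue_measure R).
Local Notation I01 := (`[0%R, 1%R]%classic).

Lemma sinc_even (t : R) : sinc (- t) = sinc t.
Proof. by apply: eq_Rintegral => s _; rewrite mulNr cosN. Qed.

Lemma sinc0 : sinc 0 = 1 :> R.
Proof. by have := @dsincE R 0; rewrite mul0r addr0 cos0. Qed.

Lemma continuous_sinc : continuous (@sinc R).
Proof. exact: (derive_continuous (@is_derive_sinc R)). Qed.

Lemma continuous_sincM (a : R) : continuous (fun t => sinc (a * t)).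
Proof.
move=> s; apply: (@continuous_comp _ _ _ (fun s => a * s) sinc); last exact: continuous_sinc.
exact: mulrl_continuous.
Qed.

Lemma oneDabs_oneDsqr (t : R) : 1 + t ^+ 2 <= (1 + `|t|) ^+ 2.
Proof. by rewrite -(real_normK (num_real t)); have := normr_ge0 t; nra. Qed.

Lemma oneDsqr_gt0 (t : R) : 0 < 1 + t ^+ 2.
Proof. by rewrite ltr_pwDl// sqr_ge0. Qed.

Lemma normr_sinc_le (a t : R) : 1 <= a -> `|sinc (a * t)| <= 2 / (1 + `|t|).
Proof.
move=> a1; have t0 := normr_ge0 t.
rewrite ler_pdivlMr; last by rewrite ltr_pwDl.
apply: le_trans (sinc_decay (a * t)); rewrite ler_wpM2l// lerD2l normrM.
by rewrite ler_peMl// (le_trans a1)// ler_norm.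
Qed.

Lemma normr_dsinc_le (a t : R) : 1 <= a -> `|dsinc (a * t)| <= 3 / (1 + `|t|).
Proof.
move=> a1; have t0 := normr_ge0 t.
rewrite ler_pdivlMr; last by rewrite ltr_pwDl.
apply: le_trans (dsinc_decay (a * t)); rewrite ler_wpM2l// lerD2l normrM.
by rewrite ler_peMl// (le_trans a1)// ler_norm.
Qed.

Lemma sinc_mul_le (a b t : R) : 1 <= a -> 1 <= b ->
  `|sinc (a * t) * sinc (b * t)| <= 4 * (1 + t ^+ 2)^-1.
Proof.
move=> a1 b1; have t0 := normr_ge0 t.
have p : 0 < 1 + `|t| by rewrite ltr_pwDl.
rewrite normrM; apply: (@le_trans _ _ (2 / (1 + `|t|) * (2 / (1 + `|t|)))).
  by apply: ler_pM => //; exact: normr_sinc_le.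
have -> : 2 / (1 + `|t|) * (2 / (1 + `|t|)) = 4 * ((1 + `|t|) ^+ 2)^-1.
  by field; rewrite gt_eqF.
by rewrite ler_pM2l// lef_pV2 ?posrE ?exprn_gt0 ?oneDsqr_gt0// oneDabs_oneDsqr.
Qed.

Lemma integrable_sinc_mul (a b : R) : 1 <= a -> 1 <= b ->
  mu.-integrable setT (EFin \o (fun t => sinc (a * t) * sinc (b * t))).
Proof.
move=> a1 b1; apply: (integrable_dom _ (integrableZ_EFin 4 integrable_oneDsqrV)).
  apply: continuous_measurable_R => t.
  by apply: cvgM; exact: continuous_sincM.
by move=> t; exact: sinc_mul_le.
Qed.

Lemma integrable_sinc_sqr : mu.-integrable setT (EFin \o (fun t : R => sinc t ^+ 2)).
Proof.
have := integrable_sinc_mul (lexx 1) (lexx (1 : R)).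
by congr (mu.-integrable _ (_ \o _)); apply/funext => t; rewrite mul1r expr2.
Qed.

Definition sinc_mass : R := \int[mu]_t (sinc t ^+ 2).

(** If the integral vanished, [sinc] would be 0 almost everywhere, whereas it is positive on []0,
    pi[]. *)
Lemma sinc_mass_gt0 : 0 < sinc_mass.
Proof.
rewrite lt_neqAle eq_sym; apply/andP; split; last first.
  by apply: Rintegral_ge0 => t _; exact: sqr_ge0.
apply/eqP => S0.
have : ae_eq mu setT (EFin \o (fun t : R => sinc t ^+ 2)) (cst 0%E).
  apply/ae_eq_integral_abs => //.
    exact: (measurable_int _ integrable_sinc_sqr).
  rewrite -[RHS]/(0%:E) -S0 /sinc_mass (EFin_Rintegral integrable_sinc_sqr).
  by apply: eq_integral => t _ /=; rewrite ger0_norm ?sqr_ge0.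
move=> [N [mN N0 sN]].
have : (mu `]0%R, (pi : R)[%classic <= mu N)%E.
  apply: le_measure; rewrite ?inE//.
  move=> t /=; rewrite in_itv/= => /andP[t0 tpi]; apply: sN => /= /(_ I) [] /eqP.
  rewrite sqrf_eq0 => /eqP s0; have := sincE t; rewrite s0 mulr0.
  have t0pi : 0 < t < pi by rewrite t0 tpi.
  by have := sin_gt0_pi t0pi => /[swap] <-; rewrite ltxx.
rewrite [X in (_ <= X)%E -> _]N0 lebesgue_measure_itv/= lte_fin pi_gt0.
by rewrite -EFinD subr0 lee_fin leNgt pi_gt0.
Qed.

Lemma integrable_sinc_scaled (b : R) :
  mu.-integrable setT (EFin \o (fun q => b ^+ 2 * sinc (b * q) ^+ 2)).
Proof.
have [->|b0] := eqVneq b 0.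
  rewrite (_ : EFin \o _ = cst 0%E); first exact: integrable0.
  by apply/funext => t /=; rewrite expr0n mul0r.
apply: integrableZ_EFin.
have := integrable_affine 0 b0 integrable_sinc_sqr.
by congr (mu.-integrable _ (_ \o _)); apply/funext => t; rewrite addr0.
Qed.

Lemma Rintegral_sinc_scaled (b : R) :
  \int[mu]_q (b ^+ 2 * sinc (b * q) ^+ 2) = `|b| * sinc_mass.
Proof.
have [->|b0] := eqVneq b 0.
  rewrite normr0 mul0r /Rintegral (eq_integral (cst 0%E)) ?integral0//.
  by move=> t _; rewrite expr0n mul0r.
have iS := integrable_affine 0 b0 integrable_sinc_sqr.
have E : (fun q => sinc (b * q + 0) ^+ 2) = (fun q => sinc (b * q) ^+ 2).
  by apply/funext => q; rewrite addr0.
rewrite E in iS.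
have H := Rintegral_affine 0 b0 integrable_sinc_sqr; rewrite E in H.
rewrite (RintegralZl _ measurableT iS) [sinc_mass]H.
by rewrite -(real_normK (num_real b)); ring.
Qed.

Lemma sin_mul_sub (u v : R) : sin (u + v) * sin (u - v) = sin u ^+ 2 - sin v ^+ 2.
Proof.
have c2 w : cos w ^+ 2 = 1 - sin w ^+ 2 :> R by rewrite -(cos2Dsin2 w) addrK.
rewrite sinD sinB.
transitivity (sin u ^+ 2 * cos v ^+ 2 - cos u ^+ 2 * sin v ^+ 2); first by ring.
by rewrite !c2; ring.
Qed.

(* Writes [sinc (a q) sinc q cos (q x)] as a combination of Fejer kernels, whose
   integrals are known by scaling. *)
Lemma sinc_product (a x q : R) :
  a * (sinc (a * q) * sinc q * cos (q * x)) =
  2^-1 * ((((a + 1 + x) / 2) ^+ 2 * sinc ((a + 1 + x) / 2 * q) ^+ 2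
         - ((a - 1 - x) / 2) ^+ 2 * sinc ((a - 1 - x) / 2 * q) ^+ 2)
        + (((a + 1 - x) / 2) ^+ 2 * sinc ((a + 1 - x) / 2 * q) ^+ 2
         - ((a - 1 + x) / 2) ^+ 2 * sinc ((a - 1 + x) / 2 * q) ^+ 2)).
Proof.
have [->|q0] := eqVneq q 0.
  by rewrite !mulr0 mul0r sinc0 cos0; field.
(* Multiplied by [q^2], every [sinc] becomes a sine, and the claim follows from [sin_mul_sub] and
   the addition formulas. *)
apply: (mulfI (expf_neq0 2 q0)).
have sq b : q ^+ 2 * (b ^+ 2 * sinc (b * q) ^+ 2) = sin (b * q) ^+ 2.
  by rewrite -(sincE (b * q)); ring.
transitivity (sin (a * q) * sin q * cos (q * x)).
  by rewrite -(sincE (a * q)) -(sincE q); ring.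
rewrite mulrCA mulrDr !mulrBr !sq -!sin_mul_sub.
have -> : (a + 1 + x) / 2 * q + (a - 1 - x) / 2 * q = a * q by field.
have -> : (a + 1 + x) / 2 * q - (a - 1 - x) / 2 * q = q + q * x by field.
have -> : (a + 1 - x) / 2 * q + (a - 1 + x) / 2 * q = a * q by field.
have -> : (a + 1 - x) / 2 * q - (a - 1 + x) / 2 * q = q - q * x by field.
by rewrite sinD sinB; field.
Qed.

(** For [|x| <= a - 1] the four scales [(a + 1 + x) / 2], [(a - 1 - x) / 2], [(a + 1 - x) / 2],
    [(a - 1 + x) / 2] are nonnegative, so in the signed sum of their absolute values [x] cancels.
    The transform is a trapezoid, and this is its flat top. *)
Lemma Rintegral_sinc_product (a x : R) : 1 <= a -> `|x| <= a - 1 ->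
  \int[mu]_q (sinc (a * q) * sinc q * cos (q * x)) = sinc_mass / a.
Proof.
move=> a1 xa; have a0 : a != 0 by rewrite gt_eqF// (lt_le_trans ltr01).
apply: (mulfI a0); rewrite mulrCA divff// mulr1.
have ii : mu.-integrable setT (EFin \o (fun q => sinc (a * q) * sinc q * cos (q * x))).
  apply: (integrable_dom _ (integrable_norm (integrable_sinc_mul a1 (lexx 1)))).
    apply: continuous_measurable_R => t; apply: cvgM.
      by apply: cvgM; [exact: continuous_sincM|exact: continuous_sinc].
    exact: (derive_continuous (fun t => der_cosM t x)).
  by move=> t /=; rewrite mul1r normrM ler_piMr// ler_norml cos_geN1 cos_le1.
rewrite -RintegralZl//.
under eq_Rintegral do rewrite sinc_product.
have i := integrable_sinc_scaled.
rewrite RintegralZl//; last first.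
  by apply: integrableD_EFin; apply: integrableB_EFin; exact: i.
rewrite RintegralD//; [|by apply: integrableB_EFin; exact: i..].
rewrite !RintegralB//; [|exact: i..].
rewrite !Rintegral_sinc_scaled.
move: xa; rewrite ler_norml => /andP[x1 x2].
by rewrite !ger0_norm; [field|lra..].
Qed.

(* [sinc] is the Fourier transform of a probability density on [-1, 1], so
   multiplication by it averages the transform of [k] over [x - 1, x + 1]. *)
Lemma flat_mul_sinc (k : R -> R) (a : R) : mu.-integrable setT (EFin \o k) ->
  (forall x : R, `|x| <= a -> \int[mu]_q (k q * cos (q * x)) = 1) ->
  forall x : R, `|x| <= a - 1 -> \int[mu]_q (k q * sinc q * cos (q * x)) = 1.
Proof.
move=> ik flat x xa; have mk : measurable_fun setT k := integrable_measurable ik.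
pose b (s : R) : R := \1_I01 s.
have ib : mu.-integrable setT (EFin \o b) by exact: integrable_indic_itv.
have mb : measurable_fun setT b := integrable_measurable ib.
pose F (z : measurableTypeR R * measurableTypeR R) : R :=
    k z.1 * cos ((z.1 : R) * (z.2 : R)) * cos ((z.1 : R) * x) * b z.2.
have mcos : measurable_fun setT (@cos R) by apply: continuous_measurable_R; exact: continuous_cos.
have mF : measurable_fun setT F.
  apply: measurable_funM; last exact: (measurableT_comp mb).
  apply: measurable_funM; last by apply: (measurableT_comp mcos); exact: measurable_funM.
  apply: measurable_funM; first exact: (measurableT_comp mk).
  by apply: (measurableT_comp mcos); exact: measurable_funM.
have cos1 t : `|cos t| <= 1 :> R by rewrite ler_norml cos_geN1 cos_le1.
have dom q s : `|F (q, s)| <= `|k q| * b s.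
  rewrite /F /= !normrM [`|b s|]ger0_norm// ler_wpM2r//.
  by rewrite -mulrA ler_piMr// mulr_ile1.
have iI (q : R) : mu.-integrable setT (EFin \o ((fun s => cos (q * s)) \_ I01)).
  apply: (integrable_dom _ ib).
    apply/(measurable_restrictT (fun s => cos (q * s))) => //.
    apply: measurable_funTS; apply: (@continuous_measurable_R R).
    exact: continuous_cosMr.
  move=> s; rewrite /b indicE patchE; case: ifPn => _; first exact: cos1.
  by rewrite normr0.
have := Rfubini1 mF (integrable_norm ik) ib dom.
rewrite (Rfubini2 mF (integrable_norm ik) ib dom).
have -> : \int[mu]_q \int[mu]_s F (q, s) = \int[mu]_q (k q * sinc q * cos (q * x)).
  apply: eq_Rintegral => q _; rewrite /sinc [X in k q * X]Rintegral_mkcond.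
  rewrite -RintegralZl//.
  rewrite -RintegralZr//; last by apply: integrableZ_EFin; exact: iI.
  apply: eq_Rintegral => s _; rewrite /F /b /= indicE patchE.
  case: ifPn => _; first by rewrite mulr1 mulrAC.
  (* Outside [[0, 1]] the restricted cosine has the default value [point], which is 0. *)
  by rewrite -[point]/(0 : R) !mulr0 mul0r.
move=> <-.
rewrite (_ : (fun s => _) = b); last first.
  apply/funext => s; rewrite /F /= RintegralZr//; last first.
    apply: (integrable_dom _ (integrable_norm ik)).
      apply: measurable_funM; last by apply: (measurableT_comp mcos); exact: measurable_funM.
      by apply: measurable_funM => //; apply: (measurableT_comp mcos); exact: measurable_funM.
    by move=> q /=; rewrite !normrM -mulrA ler_piMr// mulr_ile1.
  rewrite /b indicE; case: (boolP (s \in I01)) => [|_]; last by rewrite mulr0.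
  rewrite inE /= in_itv/= => /andP[s0 s1]; rewrite mulr1.
  move: xa; rewrite ler_norml => /andP[x1 x2].
  have ic y : mu.-integrable setT (EFin \o (fun q => k q * cos (q * y))).
    apply: (integrable_dom _ (integrable_norm ik)).
      by apply: measurable_funM => //; apply: (measurableT_comp mcos); exact: measurable_funM.
    by move=> q /=; rewrite !normrM ler_piMr.
  (* Product to sum: the frequency [x] moves to [x + s] and [x - s], and both stay within [a]
     because [0 <= s <= 1]. *)
  have -> : (fun q => k q * cos (q * s) * cos (q * x)) =
      (fun q => 2^-1 * (k q * cos (q * (x + s)) + k q * cos (q * (x - s)))).
    by apply/funext => q; rewrite (mulrDr q) (mulrBr q) cosD cosB; field.
  rewrite RintegralZl//; last by apply: integrableD_EFin; exact: ic.
  by rewrite RintegralD// !flat; [field| rewrite ler_norml; lra..].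
by rewrite /b /Rintegral integral_indic// setIT -[LHS]/(fine (lebesgue_measure I01)) lebesgue_measure_itv/= lte_fin ltr01 -EFinD subr0.
Qed.

End flat_kernel.

(** * Decay weights, Peetre's inequality and the flat kernel *)

Section decay.
Context {R : realType}.
Local Notation mu := (@lebesgue_measure R).
Implicit Types t s : R.

Definition lorentz t : R := (1 + t ^+ 2)^-1.
(** A square, so that after one factor [lorentz] has paid for the growth of the ratio of energies an
    integrable factor is left. *)
Definition decay t : R := lorentz t ^+ 2.

Lemma lorentz_gt0 t : 0 < lorentz t.
Proof. by rewrite invr_gt0 oneDsqr_gt0. Qed.

Lemma lorentz_le1 t : lorentz t <= 1.
Proof. by rewrite invf_le1 ?oneDsqr_gt0// lerDl sqr_ge0. Qed.

Lemma decay_gt0 t : 0 < decay t.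
Proof. by rewrite exprn_gt0// lorentz_gt0. Qed.

Lemma decay_le_lorentz t : decay t <= lorentz t.
Proof.
have := lorentz_gt0 t; have := lorentz_le1 t.
by rewrite /decay => h1 h0; rewrite expr2 ler_piMl// ltW.
Qed.

(** Equivalent to [1 + s^2 <= 2 (1 + t^2) (1 + (t - s)^2)], which follows from
    [s^2 <= 2 t^2 + 2 (t - s)^2]. *)
Lemma lorentz_peetre t s : lorentz (t - s) <= 2 * (1 + t ^+ 2) * lorentz s.
Proof.
have h1 := oneDsqr_gt0 (t - s); have h2 := oneDsqr_gt0 s.
rewrite /lorentz ler_pdivlMr// mulrC ler_pdivrMr//.
have := sqr_ge0 (2 * t - s); have := sqr_ge0 (t * (t - s)); nra.
Qed.

Lemma decay_peetre t s : decay (t - s) <= (2 * (1 + t ^+ 2)) ^+ 2 * decay s.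
Proof.
rewrite /decay -exprMn ler_pXn2r ?nnegrE ?lorentz_peetre//; first exact/ltW/lorentz_gt0.
by rewrite !mulr_ge0// ltW ?oneDsqr_gt0 ?lorentz_gt0.
Qed.

Lemma continuous_lorentz : continuous lorentz.
Proof. exact: continuous_oneDsqrV. Qed.

Lemma measurable_lorentz : measurable_fun setT lorentz.
Proof. by apply: continuous_measurable_R; exact: continuous_lorentz. Qed.

Lemma measurable_decay : measurable_fun setT decay.
Proof. by apply: measurable_funX; exact: measurable_lorentz. Qed.

Lemma integrable_lorentz : mu.-integrable setT (EFin \o lorentz).
Proof. exact: integrable_oneDsqrV. Qed.

Lemma integrable_decay : mu.-integrable setT (EFin \o decay).
Proof.
apply: integrable_dom integrable_lorentz _; first exact: measurable_decay.
by move=> t; rewrite ger0_norm ?decay_le_lorentz// ltW// decay_gt0.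
Qed.

Lemma integrable_shift (f : R -> R) (s : R) : mu.-integrable setT (EFin \o f) ->
  mu.-integrable setT (EFin \o (fun t => f (t - s))).
Proof.
move=> fi; have := integrable_affine (- s) (oner_neq0 R) fi.
by congr (mu.-integrable _ (_ \o _)); apply/funext => t; rewrite mul1r.
Qed.

Lemma Rintegral_shift (f : R -> R) (s : R) : mu.-integrable setT (EFin \o f) ->
  \int[mu]_t f (t - s) = \int[mu]_t f t.
Proof.
move=> fi; rewrite (Rintegral_affine (- s) (oner_neq0 R) fi) normr1 mul1r.
by apply: eq_Rintegral => t _; rewrite mul1r.
Qed.

Lemma integrable_reflect (f : R -> R) (s : R) : mu.-integrable setT (EFin \o f) ->
  mu.-integrable setT (EFin \o (fun t => f (s - t))).
Proof.
move=> fi; have n1 : - 1 != 0 :> R by rewrite oppr_eq0 oner_neq0.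
have := integrable_affine s n1 fi.
by congr (mu.-integrable _ (_ \o _)); apply/funext => t; rewrite mulN1r addrC.
Qed.

Lemma Rintegral_reflect (f : R -> R) (s : R) : mu.-integrable setT (EFin \o f) ->
  \int[mu]_t f (s - t) = \int[mu]_t f t.
Proof.
move=> fi; have n1 : - 1 != 0 :> R by rewrite oppr_eq0 oner_neq0.
rewrite (Rintegral_affine s n1 fi) normrN1 mul1r.
by apply: eq_Rintegral => t _; rewrite mulN1r addrC.
Qed.

Lemma Rintegral_odd (f : R -> R) : mu.-integrable setT (EFin \o f) ->
  (forall t, f (- t) = - f t) -> \int[mu]_t f t = 0.
Proof.
move=> fi fodd; have := Rintegral_reflect 0 fi.
rewrite (_ : \int[mu]_t f (0 - t) = \int[mu]_t (-1 * f t)); last first.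
  by apply: eq_Rintegral => t _; rewrite sub0r fodd mulN1r.
by rewrite RintegralZl//; lra.
Qed.

(** The kernel is [c * sinc (a t) * sinc t ^ 3]. The factors [sinc (a t) * sinc t] have a trapezoid
    as transform, with a flat top of height 1 for [c = a / sinc_mass]. Each further [sinc t]
    averages the transform over a window of radius 1 and improves the decay by one power. *)
Lemma flat_kernel (M : R) : 0 <= M -> exists (k k' : R -> R) (C : R),
  [/\ forall t, is_derive t (1 : R) k (k' t), continuous k',
      forall t, `|k t| <= C * decay t, forall t, `|k' t| <= C * decay t &
      forall x, `|x| <= M -> cint mu (fun t => expi (t * x) * (k t)%:C%C) = 1].
Proof.
(* The flat top has half-width [a - 1 = M + 2], and the two averagings shorten it by 1 each. *)
move=> M0; pose a := M + 3; pose c := a / sinc_mass.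
have a1 : 1 <= a by rewrite /a; lra.
have S0 := @sinc_mass_gt0 R.
have c0 : 0 < c by rewrite divr_gt0// (lt_le_trans ltr01).
have cE : c = a / sinc_mass by [].
clearbody c.
pose k t := c * (sinc (a * t) * sinc t) * sinc t * sinc t.
pose k' t := c * (a * dsinc (a * t) * sinc t ^+ 3 + 3 * (sinc (a * t) * sinc t ^+ 2 * dsinc t)).
pose u t := (1 + `|t|)^-1.
have u0 t : 0 < u t by rewrite invr_gt0 ltr_pwDl.
have u4 t : u t ^+ 4 <= decay t.
  rewrite (exprM (u t) 2 2) /decay ler_pXn2r ?nnegrE//.
  - by rewrite /u /lorentz exprVn lef_pV2 ?posrE ?exprn_gt0 ?oneDsqr_gt0 ?oneDabs_oneDsqr// ltr_pwDl.
  - by rewrite ltW// exprn_gt0.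
  - exact/ltW/lorentz_gt0.
have s1 t : `|sinc t| <= 2 * u t by have := normr_sinc_le t (lexx 1); rewrite mul1r.
have sa t : `|sinc (a * t)| <= 2 * u t by exact: normr_sinc_le.
have d1 t : `|dsinc t| <= 3 * u t by have := normr_dsinc_le t (lexx 1); rewrite mul1r.
have da t : `|dsinc (a * t)| <= 3 * u t by exact: normr_dsinc_le.
have dk t : is_derive t (1 : R) k (k' t).
  have ds := @is_derive_sinc R t.
  have dsa := @der_comp _ sinc (fun t => a * t) t _ _ (is_derive_sinc _) (der_mull t a).
  apply: is_derive_ext (der_mul (der_mul (der_scale c (der_mul dsa ds)) ds) ds) => //.
  by rewrite /k'; ring.
(* With bounds 2 for [sinc] and 3 for [dsinc], [16 = 2^4] serves for [k], while [24 a = a * 3 * 2^3]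
   and [72 = 3 * 2 * 2^2 * 3] serve for the two terms of [k']; the sum covers both functions. *)
pose C := c * (16 + 24 * a + 72).
have kC t : `|k t| <= C * decay t.
  apply: (@le_trans _ _ (c * 16 * u t ^+ 4)).
    rewrite /k !normrM (gtr0_norm c0).
    have -> : c * 16 * u t ^+ 4 = c * (2 * u t * (2 * u t)) * (2 * u t) * (2 * u t) by ring.
    have uu := ltW (u0 t); have c0' := ltW c0.
    by repeat first [done | exact: s1 | exact: sa | apply: mulr_ge0 | apply: ler_pM].
  apply: ler_pM => //; first by rewrite mulr_ge0// ltW.
  - by rewrite exprn_ge0// ltW.
  - by rewrite ler_pM2l//; lra.
have k'C t : `|k' t| <= C * decay t.
  apply: (@le_trans _ _ (c * (24 * a + 72) * u t ^+ 4)); last first.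
    apply: ler_pM => //; first by rewrite mulr_ge0// ltW//; lra.
    - by rewrite exprn_ge0// ltW.
    - by rewrite ler_pM2l//; lra.
  rewrite /k' normrM (gtr0_norm c0) -[leRHS]mulrA ler_pM2l//.
  apply: (le_trans (ler_normD _ _)).
  have -> : (24 * a + 72) * u t ^+ 4 =
     (a * (3 * u t)) * (2 * u t) ^+ 3 + 3 * ((2 * u t) * (2 * u t) ^+ 2 * (3 * u t)) by ring.
  have uu := u0 t; have a0 : 0 <= a by rewrite (le_trans ler01).
  have p3 : `|sinc t| ^+ 3 <= (2 * u t) ^+ 3 by rewrite lerXn2r ?nnegrE ?mulr_ge0 ?s1// ltW.
  have p2 : `|sinc t| ^+ 2 <= (2 * u t) ^+ 2 by rewrite lerXn2r ?nnegrE ?mulr_ge0 ?s1// ltW.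
  apply: lerD.
    rewrite 2!normrM normrX (ger0_norm a0).
    apply: ler_pM; [by rewrite mulr_ge0|by rewrite exprn_ge0| |exact: p3].
    by rewrite ler_wpM2l.
  rewrite 3!normrM normrX (ger0_norm (ler0n R 3)) ler_pM2l//.
  by repeat first [done | exact: sa | exact: d1 | exact: p2 | apply: mulr_ge0
    | apply: exprn_ge0 | apply: ler_pM].
have ik : mu.-integrable setT (EFin \o k).
  apply: (integrable_dom _ (integrableZ_EFin C integrable_decay) kC).
  by apply: continuous_measurable_R; exact: (derive_continuous dk).
exists k, k', C; split => //.
- have csa : continuous (fun t : R => dsinc (a * t)).
    move=> s; apply: (@continuous_comp _ _ _ (fun s => a * s) dsinc); last exact: continuous_dsinc.
    exact: mulrl_continuous.
  have cs := @continuous_sinc R; have cds := @continuous_dsinc R.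
  have csa' := @continuous_sincM R a.
  have cX (f : R -> R) n : continuous f -> continuous (fun t => f t ^+ n).
    move=> cf t; apply: (@continuous_comp _ _ _ f (fun x => x ^+ n)); first exact: cf.
    exact: exprn_continuous.
  move=> t; rewrite /k'; apply: cvgM; first exact: cvg_cst.
  apply: cvgD; apply: cvgM.
  + by apply: cvgM; [exact: cvg_cst|exact: csa].
  + exact: cX.
  + exact: cvg_cst.
  + by apply: cvgM; [apply: cvgM; [exact: csa'|exact: cX]|exact: cds].
- pose k0 q := c * (sinc (a * q) * sinc q).
  have iss : mu.-integrable setT (EFin \o (fun q => sinc (a * q) * sinc q)).
    have := integrable_sinc_mul a1 (lexx 1).
    by congr (mu.-integrable _ (_ \o _)); apply/funext => t; rewrite mul1r.
  have ik0 : mu.-integrable setT (EFin \o k0) by exact: integrableZ_EFin.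
  have mcos y : measurable_fun setT (fun q : R => cos (q * y)).
    by apply: continuous_measurable_R; exact: (derive_continuous (fun t => der_cosM t y)).
  have cos1 t : `|cos t| <= 1 :> R by rewrite ler_norml cos_geN1 cos_le1.
  have f0 x : `|x| <= M + 2 -> \int[mu]_q (k0 q * cos (q * x)) = 1.
    move=> xM; rewrite /k0; under eq_Rintegral do rewrite -mulrA.
    rewrite RintegralZl//.
      rewrite Rintegral_sinc_product//; last by rewrite /a; lra.
      by rewrite cE; field; rewrite !gt_eqF// (lt_le_trans ltr01).
    apply: (integrable_dom _ (integrable_norm iss)).
      exact: (measurable_funM (integrable_measurable iss) (mcos x)).
    by move=> t /=; rewrite [`|_ * cos _|]normrM ler_piMr.
  have isinc (f : R -> R) : mu.-integrable setT (EFin \o f) ->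
      mu.-integrable setT (EFin \o (fun q => f q * sinc q)).
    move=> fi; apply: (integrable_dom _ (integrable_norm fi)).
      apply: measurable_funM; first exact: (integrable_measurable fi).
      by apply: continuous_measurable_R; exact: continuous_sinc.
    by move=> t /=; rewrite normrM ler_piMr// normr_sinc_le1.
  have f1 := flat_mul_sinc ik0 f0.
  have f2 := flat_mul_sinc (isinc _ ik0) f1.
  move=> x xM; apply: complex_eq => /=.
    transitivity (\int[mu]_q (k q * cos (q * x))); last by apply: f2; lra.
    by apply: eq_Rintegral => q _; rewrite /k0 /k mulr0 subr0 mulrC.
  transitivity (\int[mu]_q (k q * sin (q * x))).
    by apply: eq_Rintegral => q _; rewrite mulr0 add0r mulrC.
  (* The kernel is even, so its sine transform vanishes. *)
  apply: Rintegral_odd.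
    apply: (integrable_dom _ (integrable_norm ik)).
      apply: measurable_funM; first exact: (integrable_measurable ik).
      by apply: continuous_measurable_R; exact: (derive_continuous (fun t => der_sinM t x)).
    by move=> t /=; rewrite normrM ler_piMr// ler_norml sin_geN1 sin_le1.
  move=> t; rewrite /k mulNr sinN mulrN !sinc_even; congr (- (_ * _)).
  by rewrite mulrN sinc_even.
Qed.

End decay.

(** * Convolution on the weighted space *)

Section energy.
Context {R : realType} {n : nat}.
Implicit Types p q x : Rn[R]_n.

Lemma dotp_ge0 x : 0 <= dotp x x.
Proof. by apply: sumr_ge0 => i _; rewrite -expr2 sqr_ge0. Qed.

Lemma sqr_enorm x : enorm x ^+ 2 = \sum_i tnth x i ^+ 2.
Proof.
by rewrite sqr_sqrtr ?dotp_ge0//; apply: eq_bigr => i _; rewrite expr2.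
Qed.

Lemma sum_le_prod (I : Type) (s : seq I) (a : I -> R) : (forall i, 0 <= a i) ->
  1 + \sum_(i <- s) a i <= \prod_(i <- s) (1 + a i).
Proof.
move=> a0; elim: s => [|i s IHs]; first by rewrite !big_nil addr0.
rewrite !big_cons.
have s0 : 0 <= \sum_(j <- s) a j by exact: sumr_ge0.
have := a0 i; nra.
Qed.

(** A product weight that dominates [1 + |x|^2]; being a tensor product, it can be integrated one
    coordinate at a time. *)
Definition prodsqr x : R := \prod_i (1 + tnth x i ^+ 2).

Lemma prodsqr_ge1 x : 1 <= prodsqr x.
Proof.
apply: le_trans (sum_le_prod _ _) => [|i]; last exact: sqr_ge0.
by rewrite lerDl sumr_ge0// => i _; rewrite sqr_ge0.
Qed.

Lemma prodsqr_gt0 x : 0 < prodsqr x.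
Proof. exact: lt_le_trans ltr01 (prodsqr_ge1 x). Qed.

Lemma sqr_enorm_prodsqr x : 1 + enorm x ^+ 2 <= prodsqr x.
Proof. by rewrite sqr_enorm; apply: sum_le_prod => i; exact: sqr_ge0. Qed.

Lemma prod_lorentz x : \prod_i lorentz (tnth x i) = (prodsqr x)^-1.
Proof. by rewrite /prodsqr prodfV. Qed.

Lemma prod_decay x : \prod_i decay (tnth x i) = (prodsqr x)^-1 ^+ 2.
Proof. by rewrite -prod_lorentz -prodrXl. Qed.

Lemma measurable_coord (i : 'I_n) : measurable_fun setT (fun x : Rn[R]_n => tnth x i : R).
Proof. exact: measurable_tnth. Qed.

Variable m : R.
Hypothesis m0 : 0 < m.

Lemma sqr_energy p : energy m p ^+ 2 = enorm p ^+ 2 + m ^+ 2.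
Proof. by rewrite sqr_sqrtr// addr_ge0// sqr_ge0. Qed.

Lemma energy_ge p : m <= energy m p.
Proof.
rewrite -(ler_pXn2r (_ : (0 < 2)%N)) ?nnegrE ?sqrtr_ge0// ?(ltW m0)//.
by rewrite sqr_energy lerDr sqr_ge0.
Qed.

Lemma energy_gt0 p : 0 < energy m p.
Proof. exact: lt_le_trans m0 (energy_ge p). Qed.

Lemma energy_le p : energy m p <= (1 + m ^+ 2) * prodsqr p.
Proof.
have m2 := sqr_ge0 m; have P1 := prodsqr_ge1 p.
rewrite -(ler_pXn2r (_ : (0 < 2)%N)) ?nnegrE ?sqrtr_ge0//; last first.
  by rewrite mulr_ge0 ?addr_ge0// ltW// prodsqr_gt0.
rewrite sqr_energy; have := sqr_enorm_prodsqr p.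
set P := prodsqr p in P1 *; set e := enorm p ^+ 2; move=> eP.
apply: (@le_trans _ _ ((1 + m ^+ 2) * P)); first by nra.
by rewrite -[leLHS]mulr1 expr2 ler_pM//; nra.
Qed.

(** Chosen so that [energy_cst * m^2 = 2 (m^2 + 1)]. Positivity of the mass keeps the ratio of
    energies under control near [p = 0]. *)
Definition energy_cst : R := 2 * (1 + (m ^+ 2)^-1).

Lemma energy_cst_gt0 : 0 < energy_cst.
Proof. by rewrite mulr_gt0// addr_gt0// invr_gt0 exprn_gt0. Qed.

(** The squares are compared: [|q|^2 <= 2 |p|^2 + 2 |p - q|^2], the choice of [energy_cst] absorbs
    the terms without [|p|^2], and [1 + |p - q|^2] is at most the product. *)
Lemma energy_peetre p q :
  energy m q <= energy_cst * energy m p * \prod_i (1 + (tnth p i - tnth q i) ^+ 2).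
Proof.
have K0 := energy_cst_gt0.
set P := \prod_i _; have P1 : 1 + \sum_i (tnth p i - tnth q i) ^+ 2 <= P.
  by apply: sum_le_prod => i; exact: sqr_ge0.
have s0 : 0 <= \sum_i (tnth p i - tnth q i) ^+ 2 by apply: sumr_ge0 => i _; exact: sqr_ge0.
have P0 : 1 <= P by apply: le_trans P1; rewrite lerDl.
have E0 := energy_gt0 p.
rewrite -(ler_pXn2r (_ : (0 < 2)%N)) ?nnegrE ?sqrtr_ge0//; last first.
  exact: mulr_ge0 (mulr_ge0 (ltW K0) (ltW E0)) (le_trans ler01 P0).
rewrite (exprMn 2 (energy_cst * energy m p) P) (exprMn 2 energy_cst).
rewrite !sqr_energy !sqr_enorm.
have tri : \sum_i tnth q i ^+ 2 <=
    2 * \sum_i tnth p i ^+ 2 + 2 * \sum_i (tnth p i - tnth q i) ^+ 2.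
  rewrite !big_distrr -big_split /=; apply: ler_sum => i _.
  by have := sqr_ge0 (2 * tnth p i - tnth q i); nra.
set A := \sum_i tnth q i ^+ 2 in tri *; set B := \sum_i tnth p i ^+ 2 in tri *.
set S := \sum_i (tnth p i - tnth q i) ^+ 2 in tri s0 P1 *.
have B0 : 0 <= B by apply: sumr_ge0 => i _; exact: sqr_ge0.
have M0 : 0 < m ^+ 2 by rewrite exprn_gt0.
set M := m ^+ 2 in M0 *.
have KM : energy_cst * M = 2 * (M + 1).
  by rewrite /energy_cst -/M; field; rewrite gt_eqF.
apply: (@le_trans _ _ (energy_cst * (B + M) * P)).
  apply: (@le_trans _ _ (energy_cst * (B + M) * (1 + S))); last first.
    by rewrite ler_wpM2l// mulr_ge0 ?addr_ge0// ltW.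
  have -> : energy_cst * (B + M) * (1 + S) = energy_cst * B * (1 + S) + energy_cst * M * (1 + S) by ring.
  have K2 : 2 <= energy_cst by rewrite /energy_cst ler_peMr// lerDl invr_ge0 ltW.
  rewrite KM; have : 2 * B <= energy_cst * B * (1 + S).
    rewrite -[leLHS]mulr1; apply: ler_pM => //; [by rewrite mulr_ge0| |by rewrite lerDl].
    by rewrite ler_wpM2r.
  by nra.
(* The constant and the product are at least 1, so replacing them by the squares on the right-hand
   side only weakens the bound. *)
have K2 : 1 <= energy_cst.
  by rewrite /energy_cst (@le_trans _ _ 2)// ?ler_peMr ?lerDl ?invr_ge0 ?ltW// ltrDl.
have K22 : energy_cst <= energy_cst ^+ 2 by rewrite expr2 ler_peMl// ltW.
have P22 : P <= P ^+ 2 by rewrite expr2 ler_peMl// (le_trans ler01).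
have BM0 : 0 <= B + M by rewrite addr_ge0// ltW.
exact: (ler_pM (mulr_ge0 (ltW K0) BM0) (le_trans ler01 P0) (ler_wpM2r BM0 K22) P22).
Qed.

Lemma measurable_energy : measurable_fun setT (@energy R n m).
Proof.
have -> : @energy R n m = fun p => Num.sqrt (\sum_i tnth p i ^+ 2 + m ^+ 2).
  by apply/funext => p; rewrite /energy sqr_enorm.
apply: (measurableT_comp (continuous_measurable_fun (@sqrt_continuous R))) => //.
apply: measurable_funD => //; apply: measurable_sum => i.
by apply: measurable_funX; exact: measurable_coord.
Qed.

End energy.

(** Tonelli's measurability statement is applied to the positive and negative parts separately;
    [fine] of their difference is measurable even where the integrals diverge. *)
Lemma measurable_fun_Rintegral d1 d2 (T1 : measurableType d1) (T2 : measurableType d2)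
    (R : realType) (m2 : {sigma_finite_measure set T2 -> \bar R}) (F : T1 * T2 -> R) :
  measurable_fun setT F -> measurable_fun setT (fun x => \int[m2]_y F (x, y)).
Proof.
move=> mF; have mE : measurable_fun setT (EFin \o F) by exact/measurable_EFinP.
have -> : (fun x => \int[m2]_y F (x, y)) =
    (fun x => fine ((\int[m2]_y (EFin \o F)^\+ (x, y)) - (\int[m2]_y (EFin \o F)^\- (x, y))))%E.
  apply/funext => x; rewrite /Rintegral integralE; congr (fine (_ - _)%E).
    by apply: eq_integral => y _; rewrite !funeposE.
  by apply: eq_integral => y _; rewrite !funenegE.
apply: measurableT_comp; first exact: fine_measurable.
apply: emeasurable_funB.
  by apply: measurable_fun_fubini_tonelli_F => //; exact: measurable_funepos.
by apply: measurable_fun_fubini_tonelli_F => //; exact: measurable_funeneg.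
Qed.

Lemma real_sqr_normr (R : realDomainType) (x : R) : `|x| ^+ 2 = x ^+ 2.
Proof. exact: real_normK (num_real x). Qed.

(** * Tensor kernels: local domination and a weighted Young inequality *)

Section convolution.
Context {R : realType} {n : nat}.
Local Notation V := (Rn[R]_n).
Local Notation lam := (lebesgue_Rn R n).
Implicit Types p q a : V.

Definition ker (kap : 'I_n -> R -> R) p q : R := \prod_i kap i (tnth p i - tnth q i).

Definition conv (kap : 'I_n -> R -> R) (phi : V -> R) p : R :=
  \int[lam]_q (ker kap p q * phi q).

(* Peetre's inequality bounds a kernel centred near [a] by [localcst a] times
   the same kernel centred at 0. *)
Definition localcst a : R := \prod_i (2 * (3 + 2 * tnth a i ^+ 2)) ^+ 2.

Lemma localcst_ge0 a : 0 <= localcst a.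
Proof. by apply: prodr_ge0 => i _; exact: sqr_ge0. Qed.

Lemma prod_decay_sub a p q : (forall i, `|tnth p i - tnth a i| <= 1) ->
  \prod_i decay (tnth p i - tnth q i) <= localcst a * \prod_i decay (tnth q i).
Proof.
move=> pa; rewrite /localcst -big_split /=; apply: ler_prod => i _.
rewrite (ltW (decay_gt0 _))/=; apply: (le_trans (decay_peetre _ _)).
rewrite ler_wpM2r ?(ltW (decay_gt0 _))//.
set t := tnth p i; set s := tnth a i.
have ts : (t - s) ^+ 2 <= 1 by rewrite -real_sqr_normr expr_le1// pa.
(* Indeed [t^2 <= 2 s^2 + 2 (t - s)^2 <= 2 s^2 + 2]. *)
have h : 2 * (1 + t ^+ 2) <= 2 * (3 + 2 * s ^+ 2).
  by have := sqr_ge0 (t - 2 * s); nra.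
have t0 : 0 <= 2 * (1 + t ^+ 2) by have := sqr_ge0 t; lra.
by rewrite lerXn2r// nnegrE (le_trans t0).
Qed.

Lemma measurable_ker_pair (kap : 'I_n -> R -> R) :
  (forall i, measurable_fun setT (kap i)) ->
  measurable_fun setT (fun z : V * V => ker kap z.1 z.2).
Proof.
move=> mk; apply: measurable_fun_bigprod => i; apply: (measurableT_comp (mk i)).
apply: measurable_funB.
  by apply: (measurableT_comp (@measurable_coord R n i)).
by apply: (measurableT_comp (@measurable_coord R n i)).
Qed.

Variables (kap : 'I_n -> R -> R) (C : R).
Hypothesis mk : forall i, measurable_fun setT (kap i).
Hypothesis kC : forall i t, `|kap i t| <= C * decay t.

Lemma ker_le p q : `|ker kap p q| <= C ^+ n * \prod_i decay (tnth p i - tnth q i).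
Proof.
rewrite normr_prod -[in X in C ^+ X](card_ord n) -prodr_const -big_split /=.
by apply: ler_prod => i _; rewrite normr_ge0 kC.
Qed.

(** If there is a coordinate, the kernel bound at 0 forces [C] to be nonnegative; in dimension 0 the
    power is 1 whatever [C] is. *)
Lemma decay_cst_ge0 : 0 <= C ^+ n.
Proof.
case: n kap kC => [|n'] k' kC'; first by rewrite expr0.
rewrite exprn_ge0//; have := le_trans (normr_ge0 _) (kC' ord0 0).
by rewrite pmulr_lge0 ?decay_gt0.
Qed.

(** The bound depends on [q] alone and is uniform for [p] in a unit cube around [a], as
    differentiation under the integral requires. *)
Lemma ker_dom a p q : (forall i, `|tnth p i - tnth a i| <= 1) ->
  `|ker kap p q| <= C ^+ n * localcst a * \prod_i decay (tnth q i).
Proof.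
move=> pa; apply: (le_trans (ker_le p q)); rewrite -mulrA.
by rewrite ler_wpM2l ?decay_cst_ge0// prod_decay_sub.
Qed.

Lemma measurable_ker p : measurable_fun setT (ker kap p).
Proof.
have := measurable_fun_slice1 (measurable_ker_pair mk) p.
by apply: eq_measurable_fun.
Qed.

Lemma near_self a (i : 'I_n) : `|tnth a i - tnth a i| <= 1.
Proof. by rewrite subrr normr0. Qed.

Section weighted.
Variables (m : R) (m0 : 0 < m) (phi : V -> R).
Hypothesis mphi : measurable_fun setT phi.
Hypothesis iphi : lam.-integrable setT (EFin \o (fun q => phi q ^+ 2 / energy m q)).

Lemma integrable_prod_decay : lam.-integrable setT (EFin \o (fun q => \prod_i decay (tnth q i))).
Proof. by have [] := @integrable_Rintegral_tensor R n (fun=> decay) (fun=> integrable_decay). Qed.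

Lemma integrable_prod_lorentz : lam.-integrable setT (EFin \o (fun q => \prod_i lorentz (tnth q i))).
Proof. by have [] := @integrable_Rintegral_tensor R n (fun=> lorentz) (fun=> integrable_lorentz). Qed.

Lemma measurable_prod_decay : measurable_fun setT (fun q : V => \prod_i decay (tnth q i)).
Proof. exact: (@measurable_tensor R n (fun=> decay) xpredT (fun=> @measurable_decay R)). Qed.

Lemma energy_prod_decay_le q : energy m q * (\prod_i decay (tnth q i)) <=
  (1 + m ^+ 2) * \prod_i lorentz (tnth q i).
Proof.
rewrite prod_decay prod_lorentz; have P0 := prodsqr_gt0 q.
have h : energy m q / prodsqr q <= 1 + m ^+ 2 by rewrite ler_pdivrMr// energy_le.
have -> : energy m q * (prodsqr q)^-1 ^+ 2 = energy m q / prodsqr q * (prodsqr q)^-1.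
  by rewrite -mulrA -expr2.
by rewrite ler_wpM2r// invr_ge0 ltW.
Qed.

Lemma prod_decay_ge0 q : 0 <= \prod_i decay (tnth q i).
Proof. by apply: prodr_ge0 => i _; exact/ltW/decay_gt0. Qed.

Lemma prod_decay_le1 q : \prod_i decay (tnth q i) <= 1.
Proof.
apply: prodr_ile1 => i _; rewrite (ltW (decay_gt0 _))/=.
exact: le_trans (decay_le_lorentz _) (lorentz_le1 _).
Qed.

(** With [d] the product of decays, [d <= 1] gives [d |phi| <= phi^2 / E + E d], and [E d] is at
    most a multiple of an integrable product. Hence convolution integrals of elements of L^2_r
    converge absolutely at every point. *)
Lemma integrable_decay_mul :
  lam.-integrable setT (EFin \o (fun q => \prod_i decay (tnth q i) * `|phi q|)).
Proof.
have iD := integrableD_EFin iphi (integrableZ_EFin (1 + m ^+ 2) integrable_prod_lorentz).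
apply: (integrable_dom _ iD).
  by apply: measurable_funM; [exact: measurable_prod_decay|exact: measurableT_comp].
move=> q; rewrite ger0_norm ?mulr_ge0 ?prod_decay_ge0//=.
apply: le_trans (lerD (lexx _) (energy_prod_decay_le q)).
have E0 := energy_gt0 m0 q; set E := energy m q in E0 *.
have d0 := prod_decay_ge0 q; have d1 := prod_decay_le1 q.
set d := \prod_i _ in d0 d1 *.
rewrite -(ler_pM2r E0) mulrDl divfK ?gt_eqF// -[phi q ^+ 2]real_normK ?num_real//.
have x0 := normr_ge0 (phi q); set x := `|phi q| in x0 *.
have h := sqr_ge0 (2 * x - d * E).
have : 0 <= E * d * E - d * E * (d * E).
  have -> : E * d * E - d * E * (d * E) = E * E * d * (1 - d) by ring.
  by rewrite !mulr_ge0 ?subr_ge0// ltW.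
by nra.
Qed.

Lemma integrable_ker_mul p : lam.-integrable setT (EFin \o (fun q => ker kap p q * phi q)).
Proof.
apply: (integrable_dom _ (integrableZ_EFin (C ^+ n * localcst p) integrable_decay_mul)).
  by apply: measurable_funM => //; exact: measurable_ker.
move=> q /=; rewrite normrM mulrA ler_wpM2r//; apply: ker_dom => i; exact: near_self.
Qed.

Lemma measurable_conv : measurable_fun setT (conv kap phi).
Proof.
apply: (@measurable_fun_Rintegral _ _ _ _ _ lam (fun z : V * V => ker kap z.1 z.2 * phi z.2)).
apply: measurable_funM; first exact: measurable_ker_pair.
exact: (measurableT_comp mphi).
Qed.

Lemma conv_le p : `|conv kap phi p| <=
  C ^+ n * localcst p * \int[lam]_q (\prod_i decay (tnth q i) * `|phi q|).
Proof.
rewrite -RintegralZl//; last exact: integrable_decay_mul.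
apply: normr_Rintegral_le.
- by apply: measurable_funM => //; exact: measurable_ker.
- by apply: integrableZ_EFin; exact: integrable_decay_mul.
- move=> q /=; rewrite normrM mulrA ler_wpM2r//; apply: ker_dom => i; exact: near_self.
Qed.

Definition young_cst : R := (C ^+ n) ^+ 2 * (\int[@lebesgue_measure R]_t decay t) ^+ n *
  (energy_cst m * (\int[@lebesgue_measure R]_t lorentz t) ^+ n).

Let W1 p q : R := \prod_i lorentz (tnth p i - tnth q i).
Let W p q : R := \prod_i decay (tnth p i - tnth q i).

Let WE p q : W p q = W1 p q ^+ 2.
Proof. by rewrite /W /W1 -prodrXl. Qed.

Let W1_ge0 p q : 0 <= W1 p q.
Proof. by apply: prodr_ge0 => i _; exact/ltW/lorentz_gt0. Qed.

Let mW1 p : measurable_fun setT (W1 p).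
Proof.
have := measurable_fun_slice1 (measurable_ker_pair (fun=> @measurable_lorentz R)) p.
by apply: eq_measurable_fun.
Qed.

Let mW2 : measurable_fun setT (fun z : V * V => W z.1 z.2).
Proof. exact: (measurable_ker_pair (fun=> @measurable_decay R)). Qed.

Let mW p : measurable_fun setT (W p).
Proof.
have := measurable_fun_slice1 mW2 p.
by apply: eq_measurable_fun.
Qed.

Let intW p : lam.-integrable setT (EFin \o W p) /\
  \int[lam]_q W p q = (\int[@lebesgue_measure R]_t decay t) ^+ n.
Proof.
have [i e] := @integrable_Rintegral_tensor R n (fun i t => decay (tnth p i - t))
  (fun i => integrable_reflect (tnth p i) integrable_decay).
split=> //; rewrite e (eq_bigr (fun=> \int[@lebesgue_measure R]_t decay t)).
  by rewrite prodr_const card_ord.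
by move=> i' _; exact: Rintegral_reflect integrable_decay.
Qed.

Let intW1 q : lam.-integrable setT (EFin \o (W1 ^~ q)) /\
  \int[lam]_p W1 p q = (\int[@lebesgue_measure R]_t lorentz t) ^+ n.
Proof.
have [i e] := @integrable_Rintegral_tensor R n (fun i t => lorentz (t - tnth q i))
  (fun i => integrable_shift (tnth q i) integrable_lorentz).
split=> //; rewrite e (eq_bigr (fun=> \int[@lebesgue_measure R]_t lorentz t)).
  by rewrite prodr_const card_ord.
by move=> i' _; exact: Rintegral_shift integrable_lorentz.
Qed.

Let iWphi2 p : lam.-integrable setT (EFin \o (fun q => W p q * phi q ^+ 2)).
Proof.
apply: (integrable_dom _ (integrableZ_EFin (localcst p * (1 + m ^+ 2)) iphi)).
  by apply: measurable_funM => //; exact: measurable_funX.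
move=> q; have E0 := energy_gt0 m0 q.
rewrite ger0_norm; last by rewrite mulr_ge0 ?sqr_ge0// WE sqr_ge0.
have h : W p q * energy m q <= localcst p * (1 + m ^+ 2).
  apply: (@le_trans _ _ (localcst p * \prod_i decay (tnth q i) * energy m q)).
    by rewrite ler_wpM2r ?(ltW E0)//; apply: prod_decay_sub => i; exact: near_self.
  rewrite -mulrA ler_wpM2l ?localcst_ge0// mulrC.
  apply: (le_trans (energy_prod_decay_le q)).
  rewrite ger_pMr; last by rewrite ltr_pwDl// sqr_ge0.
  by apply: prodr_ile1 => i _; rewrite (ltW (lorentz_gt0 _)) lorentz_le1.
have -> : W p q * phi q ^+ 2 = W p q * energy m q * (phi q ^+ 2 / energy m q).
  by field; rewrite gt_eqF.
by rewrite ler_wpM2r// divr_ge0 ?sqr_ge0// ltW.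
Qed.

(** Cauchy-Schwarz for the majorant [W = W1 * W1]: one factor [W1] stands alone, the other stays
    with [|phi|]. *)
Let conv_sqr_le p : conv kap phi p ^+ 2 <=
  (C ^+ n) ^+ 2 * (\int[@lebesgue_measure R]_t decay t) ^+ n * \int[lam]_q (W p q * phi q ^+ 2).
Proof.
have iW1 : lam.-integrable setT (EFin \o (fun q => W1 p q ^+ 2)).
  have [+ _] := intW p; congr (lam.-integrable _ (_ \o _)).
  by apply/funext => q; rewrite WE.
have iv : lam.-integrable setT (EFin \o (fun q => (W1 p q * `|phi q|) ^+ 2)).
  have := iWphi2 p; congr (lam.-integrable _ (_ \o _)); apply/funext => q.
  by rewrite exprMn real_sqr_normr WE.
have mv : measurable_fun setT (fun q => W1 p q * `|phi q|).
  by apply: measurable_funM => //; exact: measurableT_comp.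
have i1 := integrable_mul_sqr (mW1 p) mv iW1 iv.
have cs := Rintegral_cauchy_schwarz (mW1 p) mv iW1 iv.
have -> : \int[lam]_q (W p q * phi q ^+ 2) = \int[lam]_q ((W1 p q * `|phi q|) ^+ 2).
  by apply: eq_Rintegral => q _; rewrite exprMn real_sqr_normr WE.
have <- : \int[lam]_q (W1 p q ^+ 2) = (\int[@lebesgue_measure R]_t decay t) ^+ n.
  by have [_ <-] := intW p; apply: eq_Rintegral => q _; rewrite WE.
rewrite -mulrA; apply: (@le_trans _ _ ((C ^+ n * \int[lam]_q (W1 p q * (W1 p q * `|phi q|))) ^+ 2)).
  rewrite -real_sqr_normr lerXn2r ?nnegrE//.
    rewrite mulr_ge0 ?decay_cst_ge0//; apply: Rintegral_ge0 => q _.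
    by rewrite !mulr_ge0.
  rewrite -RintegralZl//; apply: normr_Rintegral_le.
  - by apply: measurable_funM => //; exact: measurable_ker.
  - exact: integrableZ_EFin.
  - move=> q /=; rewrite normrM [W1 p q * (_ * _)]mulrA -expr2 -WE mulrA.
    by rewrite ler_wpM2r// ker_le.
by rewrite exprMn ler_wpM2l ?sqr_ge0.
Qed.

(** [conv_sqr_le] is divided by [E(p)] and integrated, with [p] first by Tonelli. Peetre's
    inequality exchanges [1 / E(p)] for [1 / E(q)], and the remaining factor [W1] has an integral
    independent of [q]. *)
Lemma young : lam.-integrable setT (EFin \o (fun p => conv kap phi p ^+ 2 / energy m p)) /\
  \int[lam]_p (conv kap phi p ^+ 2 / energy m p) <=
  young_cst * \int[lam]_q (phi q ^+ 2 / energy m q).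
Proof.
set D := (C ^+ n) ^+ 2 * (\int[@lebesgue_measure R]_t decay t) ^+ n.
have D0 : 0 <= D.
  rewrite mulr_ge0 ?sqr_ge0// exprn_ge0//; apply: Rintegral_ge0 => t _.
  exact/ltW/decay_gt0.
set L := (\int[@lebesgue_measure R]_t lorentz t) ^+ n.
have K0 := energy_cst_gt0 m0.
pose f p := conv kap phi p ^+ 2 / energy m p.
have mE := @measurable_energy R n m.
have mEV : measurable_fun setT (fun p : V => (energy m p)^-1).
  have -> : (fun p : V => (energy m p)^-1) = fun p : V => energy m p `^ (-1).
    by apply/funext => p; rewrite powR_inv1// sqrtr_ge0.
  exact: (measurableT_comp (measurable_powR (-1)) mE).
have f0 p : 0 <= f p by rewrite divr_ge0 ?sqr_ge0// sqrtr_ge0.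
have mf : measurable_fun setT f.
  by apply: measurable_funM => //; apply: measurable_funX; exact: measurable_conv.
pose H (z : V * V) := D * (W z.1 z.2 * phi z.2 ^+ 2 * (energy m z.1)^-1).
have mHr : measurable_fun setT H.
  apply: measurable_funM => //.
  apply: measurable_funM; last exact: (measurableT_comp mEV).
  apply: measurable_funM => //; apply: measurable_funX.
  exact: (measurableT_comp mphi).
have mH : measurable_fun setT (EFin \o H) by exact/measurable_EFinP.
have H0 z : 0 <= H z.
  rewrite /H WE; apply: mulr_ge0 => //; apply: mulr_ge0; last by rewrite invr_ge0 sqrtr_ge0.
  by apply: mulr_ge0; exact: sqr_ge0.
have inner q : (\int[lam]_p (H (p, q))%:E <=
    (D * (energy_cst m * L) * (phi q ^+ 2 / energy m q))%:E)%E.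
  have [iL LE] := intW1 q.
  have -> : D * (energy_cst m * L) * (phi q ^+ 2 / energy m q) =
      \int[lam]_p (D * energy_cst m * (phi q ^+ 2 / energy m q) * W1 p q).
    by rewrite RintegralZl// LE -/L; ring.
  rewrite EFin_Rintegral; last exact: integrableZ_EFin.
  apply: ge0_le_integral => //.
  - by move=> p _; rewrite lee_fin.
  - by apply/measurable_EFinP; exact: (measurable_fun_slice2 mHr q).
  - by apply: (measurable_int lam); exact: integrableZ_EFin.
  - move=> p _; rewrite lee_fin /H /=.
    have Ep := energy_gt0 m0 p; have Eq := energy_gt0 m0 q.
    have Wp : 0 < W p q by apply: prodr_gt0 => i _; exact: decay_gt0.
    (* The product [prod_i (1 + (p_i - q_i)^2)] from Peetre's inequality cancels one of the two
       factors [W1] of [W]. *)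
    have hW : W p q / energy m p <= energy_cst m * W1 p q / energy m q.
      rewrite ler_pdivrMr// mulrAC ler_pdivlMr// mulrC.
      have := energy_peetre m0 p q; rewrite -(ler_pM2r Wp) => h.
      apply: (le_trans h); rewrite -[leLHS]mulrA.
      have -> : \prod_i (1 + (tnth p i - tnth q i) ^+ 2) * W p q = W1 p q.
        rewrite /W /W1 -big_split /=; apply: eq_bigr => i _.
        by rewrite /decay expr2 mulrA /lorentz mulfV ?mul1r// gt_eqF// oneDsqr_gt0.
      by rewrite [leLHS]mulrAC.
    have -> : D * (W p q * phi q ^+ 2 * (energy m p)^-1) =
      D * phi q ^+ 2 * (W p q / energy m p) by ring.
    have -> : D * energy_cst m * (phi q ^+ 2 / energy m q) * W1 p q =
      D * phi q ^+ 2 * (energy_cst m * W1 p q / energy m q) by ring.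
    by rewrite ler_wpM2l// mulr_ge0// sqr_ge0.
have le1 : (\int[lam]_p (f p)%:E <=
    \int[lam]_q (D * (energy_cst m * L) * (phi q ^+ 2 / energy m q))%:E)%E.
  apply: (@le_trans _ _ (\int[lam]_p \int[lam]_q (H (p, q))%:E)%E).
    apply: ge0_le_integral => //.
    - by move=> p _; rewrite lee_fin.
    - exact/measurable_EFinP.
    - exact: (measurable_fun_fubini_tonelli_F (EFin \o H)).
    - move=> p _.
      have -> : (\int[lam]_q (H (p, q))%:E = (D * (energy m p)^-1 * \int[lam]_q (W p q * phi q ^+ 2))%:E)%E.
        rewrite -RintegralZl// EFin_Rintegral; last exact: integrableZ_EFin.
        by apply: eq_integral => q _; rewrite /H /=; congr EFin; ring.
      rewrite lee_fin /f [leRHS]mulrAC ler_wpM2r ?invr_ge0 ?sqrtr_ge0//; exact: conv_sqr_le.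
  have H0' z : (0 <= (EFin \o H) z)%E by rewrite lee_fin.
  rewrite (@fubini_tonelli _ _ _ _ _ lam lam (EFin \o H) mH H0').
  apply: ge0_le_integral => //.
  - by move=> q _; apply: integral_ge0 => p _.
  - exact: (measurable_fun_fubini_tonelli_G (EFin \o H)).
  - apply/measurable_EFinP; apply: measurable_funM => //.
    exact: (integrable_measurable iphi).
  - by move=> q _; exact: inner.
have yE : young_cst = D * (energy_cst m * L) by [].
have iY := integrableZ_EFin young_cst iphi.
have fi : lam.-integrable setT (EFin \o f).
  have lty := le_lt_trans le1 (integrable_lty measurableT iY).
  by apply: ge0_integrable_lty; [exact: mf|exact: f0|exact: lty].
split; first exact: fi.
rewrite -lee_fin EFin_Rintegral// -RintegralZl// EFin_Rintegral//.
Qed.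

End weighted.
End convolution.

Section setc_facts.
Context {R : realType} {n : nat}.
Local Notation V := (Rn[R]_n).
Implicit Types (p x : V) (i j : 'I_n) (s t : R).

Lemma tnth_setc x j t i : tnth (setc x j t) i = if i == j then t else tnth x i.
Proof. by rewrite tnth_mktuple. Qed.

Lemma setc_setc x j s t : setc (setc x j s) j t = setc x j t.
Proof. by apply: eq_from_tnth => i; rewrite !tnth_setc; case: eqP. Qed.

Lemma setc_id x j : setc x j (coord x j) = x.
Proof. by apply: eq_from_tnth => i; rewrite !tnth_setc; case: eqP => // ->. Qed.

Lemma coord_setc x j t : coord (setc x j t) j = t.
Proof. by rewrite /coord tnth_setc eqxx. Qed.

End setc_facts.

Section lipschitz.
Context {R : realType}.

Lemma lipschitz_derive (f df : R -> R) (a b L : R) :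
  (forall t, is_derive t (1 : R) f (df t)) ->
  (forall t, a <= t -> t <= b -> `|df t| <= L) ->
  forall s t, a <= s -> s <= t -> t <= b -> `|f t - f s| <= L * (t - s).
Proof.
move=> dF dL s t sa st tb; have [->|nst] := eqVneq s t.
  by rewrite !subrr normr0 mulr0.
have lt_st : s < t by rewrite lt_neqAle nst.
have [c] := MVT lt_st (fun x _ => dF x) (continuous_subspaceT (derive_continuous dF)).
rewrite in_itv/= => /andP[sc ct] ->.
rewrite normrM (gtr0_norm (_ : 0 < t - s)) ?subr_gt0// ler_wpM2r ?subr_ge0//.
by apply: dL; [rewrite (le_trans sa)// ltW|rewrite (le_trans (ltW ct))].
Qed.

Lemma lipschitz_abs_continuous (h : R -> R[i]) (a b L : R) : 0 <= L ->
  (forall s t, a <= s -> s <= t -> t <= b -> cabs (h t - h s) <= L * (t - s)) ->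
  abs_continuous_on a b h.
Proof.
(* Dividing by [L + 1] covers the case [L = 0]. *)
move=> L0 hL e e0; exists (e / (L + 1)); first by rewrite divr_gt0// ltr_wpDl.
move=> N s t sab _ std.
apply: (@le_lt_trans _ _ (\sum_(k < N) (L * (t k - s k)))).
  by apply: ler_sum => k _; have [h1 h2 h3] := sab k; exact: hL.
rewrite -mulr_sumr; set D := \sum_(k < N) _ in std *.
have D0 : 0 <= D by apply: sumr_ge0 => k _; have [_ h2 _] := sab k; rewrite subr_ge0.
move: std; rewrite ltr_pdivlMr ?ltr_wpDl//; nra.
Qed.

End lipschitz.

(** * Convolutions along coordinate lines *)

Section conv_derivative.
Context {R : realType} {n : nat}.
Local Notation V := (Rn[R]_n).
Local Notation lam := (lebesgue_Rn R n).
Variables (kap : 'I_n -> R -> R) (C : R) (j : 'I_n) (k' : R -> R).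
Hypothesis mk : forall i, measurable_fun setT (kap i).
Hypothesis kC : forall i t, `|kap i t| <= C * decay t.
Hypothesis mk' : measurable_fun setT k'.
Hypothesis k'C : forall t, `|k' t| <= C * decay t.
Hypothesis dk : forall t, is_derive t (1 : R) (kap j) (k' t).

(** Only the [j]th factor is differentiated, so [ker dkap] is the [j]th partial derivative in [p] of
    the tensor kernel. *)
Definition dkap (i : 'I_n) : R -> R := if i == j then k' else kap i.

Lemma measurable_dkap i : measurable_fun setT (dkap i).
Proof. by rewrite /dkap; case: eqP. Qed.

Lemma dkap_le i t : `|dkap i t| <= C * decay t.
Proof. by rewrite /dkap; case: eqP. Qed.

Lemma is_derive_ker (p q : V) t :
  is_derive t (1 : R) (fun t => ker kap (setc p j t) q) (ker dkap (setc p j t) q).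
Proof.
pose P := \prod_(i | i != j) kap i (tnth p i - tnth q i).
have kE s : ker kap (setc p j s) q = P * kap j (s - tnth q j).
  rewrite /ker (bigD1 j)//= tnth_setc eqxx mulrC; congr (_ * _).
  by apply: eq_bigr => i ij; rewrite tnth_setc (negbTE ij).
have dkE s : ker dkap (setc p j s) q = P * k' (s - tnth q j).
  rewrite /ker (bigD1 j)//= tnth_setc eqxx mulrC /dkap eqxx; congr (_ * _).
  by apply: eq_bigr => i ij; rewrite tnth_setc (negbTE ij).
have ds : is_derive t (1 : R) (fun t => t - tnth q j) 1.
  by apply: is_derive_ext (der_sub (der_id t) (der_cst t _)) => //; rewrite subr0.
have := der_scale P (@der_comp _ (kap j) (fun t => t - tnth q j) t _ _ (dk _) ds).
apply: is_derive_ext => [s|]; first by rewrite kE.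
by rewrite dkE mulr1.
Qed.

Variables (m : R) (m0 : 0 < m) (phi : V -> R).
Hypothesis mphi : measurable_fun setT phi.
Hypothesis iphi : lam.-integrable setT (EFin \o (fun q => phi q ^+ 2 / energy m q)).

Lemma is_derive_conv (p : V) (t : R) :
  is_derive t (1 : R) (fun t => conv kap phi (setc p j t)) (conv dkap phi (setc p j t)).
Proof.
pose G q := C ^+ n * localcst (setc p j t) * (\prod_i decay (tnth q i) * `|phi q|).
apply: (@is_derive_Rintegral _ _ _ lam setT measurableT
  (fun s q => ker kap (setc p j s) q * phi q)
  (fun s q => ker dkap (setc p j s) q * phi q) G).
- by move=> s; exact: (integrable_ker_mul mk kC m0 mphi iphi).
- by apply: integrableZ_EFin; exact: (integrable_decay_mul m0 mphi iphi).
- move=> s q; apply: is_derive_ext (der_mul (is_derive_ker p q s) (der_cst s (phi q))) => //.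
  by rewrite mulr0 addr0.
- move=> s q s1 s2; rewrite /G normrM [leRHS]mulrA ler_wpM2r//.
  apply: (ker_dom dkap_le) => i; rewrite !tnth_setc; case: ifP => _.
    by rewrite ler_norml; lra.
  by rewrite subrr normr0.
Qed.

Lemma localcst_setc_le (p : V) (s t : R) : `|s| <= `|t| ->
  localcst (setc p j s) <= localcst (setc p j t).
Proof.
move=> st; apply: ler_prod => i _; rewrite sqr_ge0/= !tnth_setc.
have h (x : R) : 0 <= 2 * (3 + 2 * x ^+ 2) by have := sqr_ge0 x; lra.
case: ifP => _ //; rewrite lerXn2r ?nnegrE//.
have : s ^+ 2 <= t ^+ 2 by rewrite -(real_sqr_normr s) -(real_sqr_normr t) lerXn2r ?nnegrE.
lra.
Qed.

Lemma conv_lipschitz (p : V) (a b : R) : exists2 L, 0 <= L &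
  forall s t, a <= s -> s <= t -> t <= b ->
    `|conv kap phi (setc p j t) - conv kap phi (setc p j s)| <= L * (t - s).
Proof.
(* This bounds [|t|] on [[a, b]] whatever the signs of the endpoints, hence also the local constants
   on the segment. *)
pose M := `|a| + `|b|.
pose I := \int[lam]_q (\prod_i decay (tnth q i) * `|phi q|).
have I0 : 0 <= I by apply: Rintegral_ge0 => q _; rewrite mulr_ge0// prod_decay_ge0.
have C0 := @decay_cst_ge0 R n _ C kC.
exists (C ^+ n * localcst (setc p j M) * I); first by rewrite !mulr_ge0// localcst_ge0.
apply: lipschitz_derive; first exact: is_derive_conv.
move=> t ta tb; apply: (le_trans (conv_le measurable_dkap dkap_le m0 mphi iphi _)).
rewrite ler_wpM2r// ler_wpM2l// localcst_setc_le// [leRHS]ger0_norm ?addr_ge0//.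
have := ler_norm a; have := ler_norm (- a); have := ler_norm b; have := ler_norm (- b).
by rewrite !normrN /M ler_norml => *; apply/andP; split; lra.
Qed.

End conv_derivative.

Lemma is_derive_unique (R : realType) (f : R -> R) (t a b : R) :
  is_derive t (1 : R) f a -> is_derive t (1 : R) f b -> a = b.
Proof.
move=> da db; rewrite -(derive_val (is_derive := da)).
exact: (derive_val (is_derive := db)).
Qed.

(** * Fourier transforms of functions supported in S *)

Section half_power.
Context {R : realType}.
Implicit Types x : \bar R.

(** The norms of the statement are square roots in the extended reals, while the estimates concern
    the integrals under the root. *)
Lemma poweR_half_lt x (e : R) : (0 <= x)%E -> 0 < e ->
  (x `^ 2^-1 < e%:E)%E -> (x < (e ^+ 2)%:E)%E.
Proof.
move=> x0 e0; apply: contraTT; rewrite -!leNgt => ex.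
have : ((e ^+ 2)%:E `^ 2^-1 <= x `^ 2^-1)%E.
  apply: gt0_ler_poweR => //; rewrite ?in_itv/= ?leey ?andbT//.
  by rewrite lee_fin sqr_ge0.
by rewrite poweR_EFin powR12_sqrt ?sqr_ge0// sqrtr_sqr gtr0_norm.
Qed.

Lemma poweR_half_lty x : (0 <= x)%E -> (x `^ 2^-1 < +oo)%E -> (x < +oo)%E.
Proof.
move=> x0; rewrite !ltey; apply: contra => /eqP ->.
by rewrite poweRyr// invr_eq0.
Qed.

End half_power.

Section square_integrable.
Context d (T : measurableType d) (R : realType).
Variable mu : {measure set T -> \bar R}.
Implicit Types f g : T -> R[i].

Lemma ae_integral_cabs2 (w : T -> R) f g : (forall x, 0 <= w x) ->
  measurable_fun setT w -> cmeas g -> {ae mu, forall x, f x = g x} ->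
  (\int[mu]_x (cabs (f x) ^+ 2 * w x)%:E = \int[mu]_x (cabs (g x) ^+ 2 * w x)%:E)%E.
Proof.
move=> w0 mw mg fg; apply: ge0_ae_eq_integralT.
- by move=> x; rewrite lee_fin mulr_ge0// sqr_ge0.
- by move=> x; rewrite lee_fin mulr_ge0// sqr_ge0.
- apply/measurable_EFinP; apply: measurable_funM => //; apply: measurable_funX.
  exact: measurable_cabs.
- by apply: filterS fg => x ->.
Qed.

Lemma cabs_cint_mul_le f g (e : R) : cmeas f -> cmeas g -> 0 <= e ->
  (\int[mu]_x (cabs (f x) ^+ 2)%:E <= (e ^+ 2)%:E)%E ->
  mu.-integrable setT (EFin \o (fun x => cabs (g x) ^+ 2)) ->
  cintegrable mu (fun x => f x * g x) /\
  cabs (cint mu (fun x => f x * g x)) <=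
    2 * (e * Num.sqrt (\int[mu]_x (cabs (g x) ^+ 2))).
Proof.
move=> mf mg e0 fe ig.
have mcf := measurable_cabs mf; have mcg := measurable_cabs mg.
have if_ : mu.-integrable setT (EFin \o (fun x => cabs (f x) ^+ 2)).
  apply: ge0_integrable_lty => //; first exact: measurable_funX.
    by move=> x; exact: sqr_ge0.
  by apply: le_lt_trans fe _; exact: ltry.
have ifg := integrable_mul_sqr mcf mcg if_ ig.
have cs := Rintegral_cauchy_schwarz mcf mcg if_ ig.
have mfg := cmeasM mf mg.
split.
  by apply: (cintegrable_dom mfg ifg) => x; rewrite cabsM.
apply: le_trans (cabs_cint mfg ifg _) _ => [x|]; first by rewrite cabsM.
rewrite ler_pM2l//.
have fe' : \int[mu]_x (cabs (f x) ^+ 2) <= e ^+ 2 by rewrite -lee_fin EFin_Rintegral.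
have g0 : 0 <= \int[mu]_x (cabs (g x) ^+ 2) by apply: Rintegral_ge0 => x _; exact: sqr_ge0.
rewrite -(ler_pXn2r (_ : (0 < 2)%N)) ?nnegrE//.
- by rewrite exprMn sqr_sqrtr//; apply: (le_trans cs); rewrite ler_wpM2r.
- by apply: Rintegral_ge0 => x _; rewrite mulr_ge0 ?cabs_ge0.
- by rewrite mulr_ge0// sqrtr_ge0.
Qed.

End square_integrable.

Section fourier_of_integrable.
Context {R : realType} {n : nat}.
Local Notation V := (Rn[R]_n).
Local Notation lam := (lebesgue_Rn R n).
Implicit Types (p q x : V) (v : V -> R[i]).

Lemma cintegralE v : cintegral v = cint lam v.
Proof. by []. Qed.

Lemma measurable_dotp : measurable_fun setT (fun z : V * V => dotp z.1 z.2).
Proof.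
apply: measurable_sum => i; apply: measurable_funM.
  exact: (measurableT_comp (@measurable_coord R n i)).
exact: (measurableT_comp (@measurable_coord R n i)).
Qed.

Lemma cmeas_expi_dotp : cmeas (fun z : V * V => expi (- dotp z.1 z.2)).
Proof. by apply: cmeas_expi; exact: measurable_funN measurable_dotp. Qed.

Lemma cmeas_slice1 d1 d2 (T1 : measurableType d1) (T2 : measurableType d2)
  (F : T1 * T2 -> R[i]) (x : T1) : cmeas F -> cmeas (fun y => F (x, y)).
Proof.
by move=> [r i]; split; [exact: (measurable_fun_slice1 r)|exact: (measurable_fun_slice1 i)].
Qed.

Lemma expi_dotp p x : expi (- dotp p x) = \prod_i expi (- (tnth p i * tnth x i)).
Proof.
rewrite /dotp -sumrN; apply: (big_morph (@expi R)); last exact: expi0.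
exact: expiD.
Qed.

Lemma cmeas_fourier v : cmeas v -> cmeas (fourier v).
Proof.
move=> mv; apply: cmeasM; first exact: cmeas_cst.
have mF : cmeas (fun z : V * V => expi (- dotp z.1 z.2) * v z.2).
  by apply: cmeasM; [exact: cmeas_expi_dotp|exact: (cmeas_comp mv)].
by split; [exact: (measurable_fun_Rintegral lam mF.1)|exact: (measurable_fun_Rintegral lam mF.2)].
Qed.

Lemma fourier_ae v w : cmeas w -> {ae lam, forall x, v x = w x} ->
  fourier v = fourier w.
Proof.
move=> mw vw; apply/funext => p; rewrite /fourier !cintegralE; congr (_ * _).
apply: cint_ae; last by apply: filterS vw => x ->.
by apply: cmeasM => //; exact: (cmeas_slice1 p cmeas_expi_dotp).
Qed.

Lemma cabs_fourier_le v p : cintegrable lam v ->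
  cabs (fourier v p) <= cabs (@fourier_cst R n) * (2 * \int[lam]_x cabs (v x)).
Proof.
move=> iv; rewrite /fourier cabsM ler_wpM2l ?cabs_ge0//.
apply: cabs_cint.
- apply: cmeasM; last exact: cintegrable_cmeas iv.
  exact: (cmeas_slice1 p cmeas_expi_dotp).
- exact: cintegrable_cabs.
- by move=> x; rewrite cabsM cabs_expi mul1r.
Qed.

End fourier_of_integrable.

Lemma complexr_prod (R : realType) (I : Type) (s : seq I) (P : pred I) (f : I -> R) :
  ((\prod_(i <- s | P i) f i)%:C = \prod_(i <- s | P i) (f i)%:C)%C.
Proof.
apply: (big_morph (fun x : R => x%:C%C)) => // x y.
by apply: complex_eq => /=; ring.
Qed.

(** * Fourier transforms of indicators of boxes *)

Section fourier_box.
Context {R : realType}.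
Local Notation mu := (@lebesgue_measure R).

Definition interval_fourier (a b s : R) : R[i] :=
  cint mu (fun t => ((\1_(`]a, b]%classic) t : R)%:C)%C * expi (- (t * s))).

(** The integral is at most the length of the interval, and [s] times it is a difference of two
    values of [F], hence at most 2. Cosine and sine are both instances. *)
Lemma oscillation_le (F f : R -> R) (a b s : R) :
  (forall t, is_derive t (1 : R) F (s * f t)) -> continuous f ->
  (forall t, `|F t| <= 1) -> (forall t, `|f t| <= 1) ->
  `|\int[mu]_t (\1_(`]a, b]%classic) t * f t)| <= (`|b - a| + 2) / (1 + `|s|).
Proof.
move=> dF cf F1 f1.
have p : 0 < 1 + `|s| by rewrite ltr_pwDl.
have ->: \int[mu]_t (\1_(`]a, b]%classic) t * f t) = \int[mu]_(t in `]a, b]) f t.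
  rewrite [RHS]Rintegral_mkcond; apply: eq_Rintegral => t _.
  by rewrite patchE indicE; case: ifPn => _; rewrite ?mul1r ?mul0r.
have [ba|ab] := leP b a.
  rewrite set_itv_ge ?bnd_simp -?leNgt// Rintegral_set0 normr0.
  by rewrite divr_ge0// ?addr_ge0// ltW.
have ii : mu.-integrable `[a, b] (EFin \o f).
  apply: continuous_compact_integrable; first exact: segment_compact.
  exact: continuous_subspaceT.
rewrite Rintegral_itv_obnd_cbnd; last first.
  by apply: integrableS ii => //; exact: subset_itv_oc_cc.
rewrite ler_pdivlMr// mulrDr mulr1; apply: lerD.
  apply: (le_trans (le_normr_Rintegral _ ii)) => //.
  have <- : \int[mu]_(t in `[a, b]) 1 = `|b - a|.
    rewrite Rintegral_cst// mul1r -[LHS]/(fine (lebesgue_measure `[a, b]%classic)).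
    by rewrite lebesgue_measure_itv/= lte_fin ab -EFinD/= gtr0_norm// subr_gt0.
  apply: le_Rintegral => //; first exact: integrable_norm.
  apply: continuous_compact_integrable; first exact: segment_compact.
  by apply: continuous_subspaceT => t; exact: cvg_cst.
rewrite -normrM mulrC -RintegralZl//.
have csf : continuous (fun t => s * f t).
  by move=> t; apply: cvgM; [exact: cvg_cst|exact: cf].
rewrite (Rintegral_FTC2 ab dF csf).
by apply: (le_trans (ler_normB _ _)); have := F1 a; have := F1 b; lra.
Qed.

Lemma interval_fourier_integrable (a b s : R) :
  cintegrable mu (fun t => ((\1_(`]a, b]%classic) t : R)%:C)%C * expi (- (t * s))).
Proof.
have i1 : mu.-integrable setT (EFin \o (\1_(`]a, b]%classic) : R -> R)) by exact: integrable_indic_itv.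
apply: (cintegrable_dom _ i1).
  apply: cmeasM; first by apply: cmeas_real; exact: measurable_indic.
  by apply: cmeas_expi; apply: measurable_funN; exact: measurable_funM.
by move=> t; rewrite cabsM cabs_expi mulr1 cabs_real ger0_norm.
Qed.

Lemma interval_fourier_le (a b s : R) :
  cabs (interval_fourier a b s) ^+ 2 <= 2 * (`|b - a| + 2) ^+ 2 * lorentz s.
Proof.
have p : 0 < 1 + `|s| by rewrite ltr_pwDl.
have h (x : R) : `|x| <= (`|b - a| + 2) / (1 + `|s|) ->
    x ^+ 2 <= (`|b - a| + 2) ^+ 2 * lorentz s.
  move=> xl; rewrite -real_sqr_normr.
  apply: (@le_trans _ _ (((`|b - a| + 2) / (1 + `|s|)) ^+ 2)).
    by rewrite lerXn2r ?nnegrE// divr_ge0 ?addr_ge0// ltW.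
  rewrite expr_div_n ler_wpM2l ?sqr_ge0// /lorentz lef_pV2 ?posrE ?exprn_gt0 ?oneDsqr_gt0//.
  exact: oneDabs_oneDsqr.
rewrite sqr_cabs -mulrA [2 * _]mulr_natl mulr2n; apply: lerD; apply: h => /=.
  have -> : \int[mu]_t (\1_(`]a, b]%classic) t * cos (- (t * s)) - 0 * sin (- (t * s))) =
    \int[mu]_t (\1_(`]a, b]%classic) t * cos (t * s)).
    by apply: eq_Rintegral => t _; rewrite mul0r subr0 cosN.
  apply: (@oscillation_le (fun t => sin (t * s)) (fun t => cos (t * s))).
  - by move=> t; exact: der_sinM.
  - exact: (derive_continuous (fun t => der_cosM t s)).
  - by move=> t; rewrite ler_norml sin_geN1 sin_le1.
  - by move=> t; rewrite ler_norml cos_geN1 cos_le1.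
have -> : \int[mu]_t (\1_(`]a, b]%classic) t * sin (- (t * s)) + 0 * cos (- (t * s))) =
    \int[mu]_t (\1_(`]a, b]%classic) t * - sin (t * s)).
  by apply: eq_Rintegral => t _; rewrite mul0r addr0 sinN.
apply: (@oscillation_le (fun t => cos (t * s)) (fun t => - sin (t * s))).
- by move=> t; rewrite mulrN; exact: der_cosM.
- by move=> t; apply: cvgN; exact: (derive_continuous (fun t => der_sinM t s)).
- by move=> t; rewrite ler_norml cos_geN1 cos_le1.
- by move=> t; rewrite normrN ler_norml sin_geN1 sin_le1.
Qed.

Context {n : nat}.
Local Notation V := (Rn[R]_n).
Local Notation lam := (lebesgue_Rn R n).
Variables a b : 'I_n -> R.

Definition box_indic (p : V) : R := \prod_i \1_(`]a i, b i]%classic) (tnth p i).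

Definition box_fourier (x : V) : R[i] := \prod_i interval_fourier (a i) (b i) (tnth x i).

Lemma box_indicE (p : V) : box_indic p = \1_(box (fun i => `]a i, b i]%classic)) p.
Proof.
rewrite indicE; have [/set_mem h|h] := boolP (p \in _).
  by rewrite /box_indic big1// => i _; rewrite indicE mem_set//; exact: h.
have [i hi] : exists i, ~ `]a i, b i]%classic (tnth p i).
  apply/not_existsP => hp; move/negP: h; apply; apply/mem_set => i.
  by apply: contrapT; exact: hp.
by rewrite /box_indic (bigD1 i)//= indicE memNset// mul0r.
Qed.

Lemma box_indic_ge0 (p : V) : 0 <= box_indic p.
Proof. by rewrite box_indicE. Qed.

Lemma integrable_box_indic : lam.-integrable setT (EFin \o box_indic).
Proof.
have [] // := @integrable_Rintegral_tensor R n (fun i => \1_(`]a i, b i]%classic)).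
by move=> i; exact: integrable_indic_itv.
Qed.

Lemma measurable_box_indic : measurable_fun setT box_indic.
Proof. exact: integrable_measurable integrable_box_indic. Qed.

Lemma integrable_box_indic_sqr :
  lam.-integrable setT (EFin \o (fun p => cabs (box_indic p)%:C%C ^+ 2)).
Proof.
have := integrable_box_indic; congr (lam.-integrable _ (_ \o _)); apply/funext => p.
by rewrite cabs_real box_indicE indicE; case: (_ \in _); rewrite ?normr1 ?normr0 ?expr1n ?expr0n.
Qed.

Lemma cmeas_interval_fourier (u v : R) : cmeas (interval_fourier u v : measurableTypeR R -> _).
Proof.
pose F (z : measurableTypeR R * measurableTypeR R) : R[i] :=
  ((\1_(`]u, v]%classic) z.2 : R)%:C)%C * expi (- ((z.2 : R) * (z.1 : R))).
have mF : cmeas F.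
  apply: cmeasM.
    by apply: cmeas_real; apply: measurableT_comp => //; exact: measurable_indic.
  by apply: cmeas_expi; apply: measurable_funN; exact: measurable_funM.
by split; [exact: (measurable_fun_Rintegral mu mF.1)|exact: (measurable_fun_Rintegral mu mF.2)].
Qed.

Lemma cmeas_box_fourier : cmeas box_fourier.
Proof.
apply: cmeas_bigprod => i.
apply: (@cmeas_comp _ _ _ _ _ (interval_fourier (a i) (b i)) (fun x : V => tnth x i)).
  exact: cmeas_interval_fourier.
exact: measurable_tnth.
Qed.

Lemma integrable_box_fourier_sqr :
  lam.-integrable setT (EFin \o (fun x => cabs (box_fourier x) ^+ 2)).
Proof.
have [i _] := @integrable_Rintegral_tensor R n
  (fun i t => 2 * (`|b i - a i| + 2) ^+ 2 * lorentz t)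
  (fun i => integrableZ_EFin _ integrable_lorentz).
apply: (integrable_dom _ i).
  by apply: measurable_funX; apply: measurable_cabs; exact: cmeas_box_fourier.
move=> x; rewrite ger0_norm ?sqr_ge0// cabs_prod -prodrXl.
by apply: ler_prod => k _; rewrite sqr_ge0 interval_fourier_le.
Qed.

(** The multiplication formula, by Fubini: the transform passes from [v] to the indicator, whose
    transform factors over the coordinates. *)
Lemma cint_box_fourier (v : V -> R[i]) : cintegrable lam v ->
  cint lam (fun p => fourier v p * (box_indic p)%:C%C) =
  @fourier_cst R n * cint lam (fun x => v x * box_fourier x).
Proof.
move=> iv; have mv := cintegrable_cmeas iv.
pose F (z : V * V) := (box_indic z.1)%:C%C * (expi (- dotp z.1 z.2) * v z.2).
have mF : cmeas F.
  apply: cmeasM.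
    by apply: cmeas_real; apply: (measurableT_comp measurable_box_indic).
  by apply: cmeasM; [exact: cmeas_expi_dotp|exact: (cmeas_comp mv)].
have dom (p x : V) : cabs (F (p, x)) <= box_indic p * cabs (v x).
  by rewrite /F !cabsM cabs_expi mul1r cabs_real ger0_norm// box_indic_ge0.
have iB := integrable_box_indic; have icv := cintegrable_cabs iv.
have i1 (p : V) : cintegrable lam (fun x => expi (- dotp p x) * v x).
  apply: (cintegrable_dom _ icv); last by move=> x; rewrite cabsM cabs_expi mul1r.
  by apply: cmeasM => //; exact: (cmeas_slice1 p cmeas_expi_dotp).
have E1 (p : V) : fourier v p * (box_indic p)%:C%C =
    @fourier_cst R n * cint lam (fun x => F (p, x)).
  by rewrite /fourier -mulrA; congr (_ * _); rewrite mulrC -cintZ.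
under eq_cint do rewrite E1.
rewrite cintZ; last exact: (cintegrable_fubini1 mF iB icv dom).
congr (_ * _); rewrite (cfubini mF iB icv dom); apply: eq_cint => x.
have [ib ibE] := @cintegrable_cint_tensor R n
  (fun i t => ((\1_(`]a i, b i]%classic) t : R)%:C)%C * expi (- (t * tnth x i)))
  (fun i => interval_fourier_integrable _ _ _).
rewrite /box_fourier /interval_fourier -ibE -cintZ//; apply: eq_cint => p.
rewrite /F /= mulrA [RHS]mulrC; congr (_ * _).
by rewrite big_split /= -expi_dotp complexr_prod.
Qed.

End fourier_box.

(** * The L^2 transform of an integrable function is its Fourier integral *)

Section fourier_L2_unique.
Context {R : realType} {n : nat}.
Local Notation V := (Rn[R]_n).
Local Notation lam := (lebesgue_Rn R n).

Lemma eq0_of_le_eps (x A : R) : 0 <= x -> (forall e, 0 < e -> x <= e * A) -> x = 0.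
Proof.
move=> x0 h; apply/eqP; rewrite eq_le x0 andbT leNgt; apply/negP => xp.
have B0 : 0 < `|A| + 1 by rewrite ltr_wpDl.
have := h (x / (2 * (`|A| + 1))).
rewrite divr_gt0 ?mulr_gt0// => /(_ isT).
have -> : x / (2 * (`|A| + 1)) * A = x * (A / (2 * (`|A| + 1))) by field; rewrite gt_eqF.
have : A / (2 * (`|A| + 1)) <= 2^-1.
  by rewrite ler_pdivrMr ?mulr_gt0//; have := ler_norm A; lra.
by nra.
Qed.

(* Both limits are tested against indicators of boxes, whose Fourier transforms
   are square integrable. *)
Lemma fourier_L2_unique (v f : V -> R[i]) (u : nat -> V -> R[i]) :
  cintegrable lam v -> cmeas f ->
  lam.-integrable setT (EFin \o (fun p => cabs (f p) ^+ 2)) ->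
  (forall k, cintegrable lam (u k)) ->
  (forall e : R, 0 < e -> exists k,
    (\int[lam]_x (cabs (u k x - v x) ^+ 2)%:E <= (e ^+ 2)%:E)%E /\
    (\int[lam]_p (cabs (fourier (u k) p - f p) ^+ 2)%:E <= (e ^+ 2)%:E)%E) ->
  {ae lam, forall p, f p = fourier v p}.
Proof.
move=> iv mf if2 iu uv.
have mv := cintegrable_cmeas iv; have mFv := cmeas_fourier mv.
have boxE a b : cint lam (fun p => f p * (box_indic a b p)%:C%C) =
    cint lam (fun p => fourier v p * (box_indic a b p)%:C%C).
  set X := cint _ _; set Y := cint _ _.
  have mI : cmeas (fun p : V => (box_indic a b p)%:C%C) by apply: cmeas_real; exact: measurable_box_indic.
  have iI2 := integrable_box_indic_sqr a b.
  have iI := integrable_box_indic a b.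
  have iFI w : cintegrable lam w -> cintegrable lam (fun p => fourier w p * (box_indic a b p)%:C%C).
    move=> iw; apply: (cintegrable_dom _ (integrableZ_EFin (cabs (@fourier_cst R n) * (2 * \int[lam]_x cabs (w x))) iI)).
      by apply: cmeasM => //; apply: cmeas_fourier; exact: cintegrable_cmeas iw.
    move=> p; rewrite cabsM cabs_real ger0_norm ?box_indic_ge0// ler_wpM2r ?box_indic_ge0//.
    exact: cabs_fourier_le.
  pose B := Num.sqrt (\int[lam]_p (cabs (box_indic a b p)%:C%C ^+ 2)).
  pose D := Num.sqrt (\int[lam]_p (cabs (box_fourier a b p) ^+ 2)).
  suff : cabs (X - Y) = 0.
    by move=> /ComplexField.Normc.eq0_normc /eqP; rewrite subr_eq0 => /eqP.
  apply: (@eq0_of_le_eps _ (2 * B + cabs (@fourier_cst R n) * (2 * D))); first exact: cabs_ge0.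
  move=> e e0; have [k [uk fk]] := uv e e0.
  have muk := cintegrable_cmeas (iu k).
  have mFu := cmeas_fourier muk.
  have [i1 c1] := cabs_cint_mul_le (cmeasD mFu (cmeasN mf)) mI (ltW e0) fk iI2.
  have [i2 c2] := cabs_cint_mul_le (cmeasD muk (cmeasN mv)) (cmeas_box_fourier a b) (ltW e0) uk
    (integrable_box_fourier_sqr a b).
  have iuv : cintegrable lam (fun x => u k x - v x).
    by have [ur ui] := iu k; have [vr vi] := iv; split;
      [have := integrableB_EFin ur vr|have := integrableB_EFin ui vi];
      congr (lam.-integrable _ (_ \o _)); apply/funext => x; rewrite ?cReD ?cImD ?cReN ?cImN.
  have E2 : cint lam (fun p => (fourier (u k) p - fourier v p) * (box_indic a b p)%:C%C) =
      @fourier_cst R n * cint lam (fun x => (u k x - v x) * box_fourier a b x).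
    rewrite -(cint_box_fourier _ _ iuv); apply: eq_cint => p; congr (_ * _).
    rewrite /fourier -mulrBr; congr (_ * _); rewrite !cintegralE -cintB.
    - by apply: eq_cint => x; rewrite mulrBr.
    - apply: (cintegrable_dom _ (cintegrable_cabs (iu k))).
        by apply: cmeasM => //; exact: (cmeas_slice1 p cmeas_expi_dotp).
      by move=> x; rewrite cabsM cabs_expi mul1r.
    - apply: (cintegrable_dom _ (cintegrable_cabs iv)).
        by apply: cmeasM => //; exact: (cmeas_slice1 p cmeas_expi_dotp).
      by move=> x; rewrite cabsM cabs_expi mul1r.
  have ifI : cintegrable lam (fun p => f p * (box_indic a b p)%:C%C).
    apply: (cintegrable_dom (cmeasM mf mI) (integrableD_EFin if2 iI2)) => p.
    by rewrite cabsM; have := cabs_ge0 (f p); have := cabs_ge0 (box_indic a b p)%:C%C; nra.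
  (* Inserting [fourier (u k)]: the first term is small because the transforms approach [f], the
     second, rewritten by the multiplication formula, because [u k] approaches [v]. *)
  have -> : X - Y = - cint lam (fun p => (fourier (u k) p - f p) * (box_indic a b p)%:C%C)
      + cint lam (fun p => (fourier (u k) p - fourier v p) * (box_indic a b p)%:C%C).
    under eq_cint do rewrite mulrBl.
    under [X in _ = _ + X]eq_cint do rewrite mulrBl.
    rewrite !cintB//; [|exact: iFI..].
    by rewrite -/X -/Y; ring.
  apply: (le_trans (cabsD _ _)); rewrite cabsN mulrDr; apply: lerD.
    by apply: (le_trans c1); rewrite /B mulrCA.
  by rewrite E2 cabsM [leRHS]mulrCA ler_wpM2l ?cabs_ge0//; apply: (le_trans c2); rewrite /D mulrCA.
(* Real and imaginary parts are compared separately: [g] comes from [f] and is controlled by its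
   square, [h] comes from [fourier v] and is bounded, so [g - h] is integrable over cubes. *)
have real_case (g h : V -> R) : measurable_fun setT g -> measurable_fun setT h ->
    (forall p, `|g p| <= 1 + cabs (f p) ^+ 2) ->
    (exists M, forall p, `|h p| <= M) ->
    (forall a b, \int[lam]_p (g p * box_indic a b p) = \int[lam]_p (h p * box_indic a b p)) ->
    {ae lam, forall p, g p = h p}.
  move=> mg mh gf [M hM] gh.
  have icube k (w : V -> R) : lam.-integrable setT (EFin \o w) -> lam.-integrable (@cube R n k) (EFin \o w).
    by apply: integrableS => //; apply: measurable_ocbox; exact: cube_ocbox.
  have mck k : measurable (@cube R n k) by apply: measurable_ocbox; exact: cube_ocbox.
  have igh k : lam.-integrable (@cube R n k) (EFin \o (fun p => g p - h p)).
    have ic : lam.-integrable (@cube R n k) (EFin \o cst (1 + M)).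
      apply: measurable_bounded_integrable => //; first exact: lebesgue_cube_lty.
      by exists `|1 + M|; split => // y yM x _ /=; rewrite ltW.
    have i1 := integrableD (mck k) ic (icube k _ if2).
    apply: le_integrable i1 => //.
      by apply: measurable_funTS; apply/measurable_EFinP; exact: measurable_funB.
    move=> p _ /=; rewrite lee_fin; apply: le_trans (ler_norm _).
    by apply: (le_trans (ler_normB _ _)); have := gf p; have := hM p; lra.
  have := ae_eq0_ocbox (measurable_funB mg mh) igh _.
  have h0 X : @ocbox R n X -> \int[lam]_(p in X) (g p - h p) = 0.
    move=> [a [b ->]]; rewrite Rintegral_mkcond.
    have iI := integrable_box_indic a b; have mI := measurable_box_indic a b.
    have iw (w : V -> R) : measurable_fun setT w -> (forall p, `|w p| <= 1 + M + cabs (f p) ^+ 2) ->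
        lam.-integrable setT (EFin \o (fun p => w p * box_indic a b p)).
      move=> mw wM; apply: (integrable_dom (measurable_funM mw mI)
        (integrableD_EFin (integrableZ_EFin (1 + M) iI) if2)) => p.
      rewrite normrM (ger0_norm (box_indic_ge0 a b p)).
      have I1 : box_indic a b p <= 1 by rewrite box_indicE indicE; case: (_ \in _).
      have := wM p; have := box_indic_ge0 a b p; have := sqr_ge0 (cabs (f p)).
      by have := normr_ge0 (w p); nra.
    have M0 : 0 <= M by apply: le_trans (hM point).
    have ig : lam.-integrable setT (EFin \o (fun p => g p * box_indic a b p)).
      by apply: iw => // p; have := gf p; lra.
    have ih : lam.-integrable setT (EFin \o (fun p => h p * box_indic a b p)).
      by apply: iw => // p; have := hM p; have := sqr_ge0 (cabs (f p)); lra.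
    transitivity (\int[lam]_p (g p * box_indic a b p - h p * box_indic a b p)).
      apply: eq_Rintegral => p _; rewrite patchE -mulrBl box_indicE indicE.
      by case: ifPn => _; rewrite ?mulr1 ?mulr0.
    by rewrite RintegralB// gh subrr.
  by move=> /(_ h0); apply: filterS => p /eqP; rewrite subr_eq0 => /eqP.
have boxR a b (g h : V -> R[i]) : cint lam (fun p => g p * (box_indic a b p)%:C%C) =
    cint lam (fun p => h p * (box_indic a b p)%:C%C) ->
    \int[lam]_p (complex.Re (g p) * box_indic a b p) = \int[lam]_p (complex.Re (h p) * box_indic a b p) /\
    \int[lam]_p (complex.Im (g p) * box_indic a b p) = \int[lam]_p (complex.Im (h p) * box_indic a b p).
  have rw (w : V -> R[i]) : cint lam (fun p => w p * (box_indic a b p)%:C%C) =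
      ((\int[lam]_p (complex.Re (w p) * box_indic a b p)) +i*
       (\int[lam]_p (complex.Im (w p) * box_indic a b p)))%C.
    apply: complex_eq => /=; apply: eq_Rintegral => p _.
      by rewrite cReM /= mulr0 subr0.
    by rewrite cImM /= mulr0 add0r.
  by rewrite !rw => -[-> ->].
pose M := cabs (@fourier_cst R n) * (2 * \int[lam]_x cabs (v x)).
have FM p : cabs (fourier v p) <= M by exact: cabs_fourier_le.
have f1 p : cabs (f p) <= 1 + cabs (f p) ^+ 2 by have := sqr_ge0 (cabs (f p) - 1); have := cabs_ge0 (f p); nra.
have aeR := real_case _ _ mf.1 mFv.1
  (fun p => le_trans (cRe_le _) (f1 p)) (ex_intro _ M (fun p => le_trans (cRe_le _) (FM p)))
  (fun a b => (boxR a b _ _ (boxE a b)).1).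
have aeI := real_case _ _ mf.2 mFv.2
  (fun p => le_trans (cIm_le _) (f1 p)) (ex_intro _ M (fun p => le_trans (cIm_le _) (FM p)))
  (fun a b => (boxR a b _ _ (boxE a b)).2).
by apply: filterS2 aeR aeI => p; exact: complex_eq.
Qed.

End fourier_L2_unique.

(** * The kernel reproduces transforms supported in the cube *)

Section reproducing.
Context {R : realType} {n : nat}.
Local Notation mu := (@lebesgue_measure R).
Local Notation V := (Rn[R]_n).
Local Notation lam := (lebesgue_Rn R n).
Variables (k : R -> R) (C M : R).
Hypothesis mk : measurable_fun setT k.
Hypothesis kC : forall t, `|k t| <= C * decay t.
Hypothesis flat : forall x, `|x| <= M -> cint mu (fun t => expi (t * x) * (k t)%:C%C) = 1.

Local Notation kap := ((fun=> k) : 'I_n -> R -> R).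

Lemma integrable_flat : mu.-integrable setT (EFin \o k).
Proof. by apply: (integrable_dom _ (integrableZ_EFin C integrable_decay) kC); exact: mk. Qed.

(** Replacing [t] by [p - t] turns the integral into [expi (- (p * x))] times the transform of [k]
    at [x], which is 1. *)
Lemma flat_shift (p x : R) : `|x| <= M ->
  cintegrable mu (fun t => (k (p - t))%:C%C * expi (- (t * x))) /\
  cint mu (fun t => (k (p - t))%:C%C * expi (- (t * x))) = expi (- (p * x)).
Proof.
move=> xM.
have ik := integrable_flat.
have mexp (y : R) : cmeas (fun t : measurableTypeR R => expi (- ((t : R) * y))).
  by apply: cmeas_expi; apply: measurable_funN; exact: measurable_funM.
have mexp' (y : R) : cmeas (fun t : measurableTypeR R => expi ((t : R) * y)).
  by apply: cmeas_expi; exact: measurable_funM.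
have ikp := integrable_reflect p ik.
have i1 : cintegrable mu (fun t => (k (p - t))%:C%C * expi (- (t * x))).
  apply: (cintegrable_dom _ (integrable_norm ikp)).
    by apply: cmeasM => //; apply: cmeas_real; exact: (integrable_measurable ikp).
  by move=> t; rewrite cabsM cabs_expi mulr1 cabs_real.
split=> //.
have i2 : cintegrable mu (fun t => expi (t * x) * (k t)%:C%C).
  apply: (cintegrable_dom _ (integrable_norm ik)).
    by apply: cmeasM => //; apply: cmeas_real; exact: mk.
  by move=> t; rewrite cabsM cabs_expi mul1r cabs_real.
have refl : cint mu (fun t => expi ((p - t) * x) * (k (p - t))%:C%C) = 1.
  rewrite -(flat xM); apply: complex_eq => /=.
    exact: (Rintegral_reflect p i2.1).
  exact: (Rintegral_reflect p i2.2).
have i3 : cintegrable mu (fun t => expi ((p - t) * x) * (k (p - t))%:C%C).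
  by split; [exact: (integrable_reflect p i2.1)|exact: (integrable_reflect p i2.2)].
rewrite -[RHS]mulr1 -refl -cintZ//; apply: eq_cint => t.
rewrite mulrA -expiD mulrC; congr (expi _ * _); ring.
Qed.

(** After Fubini the inner integral is a product of one-dimensional ones; wherever [v] does not
    vanish, [flat_shift] evaluates each factor and the exponential is recovered. *)
Lemma conv_fourier (v : V -> R[i]) : cintegrable lam v ->
  (forall x, v x != 0 -> forall i, `|tnth x i| <= M) ->
  forall p, cint lam (fun q => (ker kap p q)%:C%C * fourier v q) = fourier v p.
Proof.
move=> iv vM p; have mv := cintegrable_cmeas iv.
have mkap i : measurable_fun setT (kap i) by [].
have kapC i t : `|kap i t| <= C * decay t by exact: kC.
have iD : lam.-integrable setT (EFin \o (fun q => C ^+ n * localcst p * \prod_i decay (tnth q i))).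
  by apply: integrableZ_EFin; exact: integrable_prod_decay.
pose F (z : V * V) := (ker kap p z.1)%:C%C * (expi (- dotp z.1 z.2) * v z.2).
have mK : cmeas (fun q : V => (ker kap p q)%:C%C).
  by apply: cmeas_real; exact: (measurable_ker mkap).
have mF : cmeas F.
  apply: cmeasM; first exact: (cmeas_comp mK).
  by apply: cmeasM; [exact: cmeas_expi_dotp|exact: (cmeas_comp mv)].
have dom (q x : V) : cabs (F (q, x)) <=
    (C ^+ n * localcst p * \prod_i decay (tnth q i)) * cabs (v x).
  rewrite /F !cabsM cabs_expi mul1r cabs_real ler_wpM2r ?cabs_ge0//.
  by apply: (ker_dom kapC) => i; exact: near_self.
have icv := cintegrable_cabs iv.
have i1 (q : V) : cintegrable lam (fun x => expi (- dotp q x) * v x).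
  apply: (cintegrable_dom _ icv); last by move=> x; rewrite cabsM cabs_expi mul1r.
  by apply: cmeasM => //; exact: (cmeas_slice1 q cmeas_expi_dotp).
have E1 (q : V) : (ker kap p q)%:C%C * fourier v q =
    @fourier_cst R n * cint lam (fun x => F (q, x)).
  by rewrite /fourier mulrCA; congr (_ * _); rewrite -cintZ.
under eq_cint do rewrite E1.
rewrite cintZ; last exact: (cintegrable_fubini1 mF iD icv dom).
rewrite /fourier; congr (_ * _); rewrite (cfubini mF iD icv dom); apply: eq_cint => x.
have [vx0|vx0] := eqVneq (v x) 0.
  rewrite vx0 mulr0 (_ : (fun q => _) = (fun=> 0)); last first.
    by apply/funext => q; rewrite /F /= vx0 !mulr0.
  by apply: complex_eq => /=; rewrite /Rintegral (eq_integral (cst 0%E)) ?integral0.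
have xM := vM x vx0.
have [ib ibE] := @cintegrable_cint_tensor R n
  (fun i t => (k (tnth p i - t))%:C%C * expi (- (t * tnth x i)))
  (fun i => (flat_shift _ (xM i)).1).
transitivity (cint lam (fun q : V => v x * \prod_i ((k (tnth p i - tnth q i))%:C%C * expi (- (tnth q i * tnth x i))))).
  apply: eq_cint => q; rewrite /F /= mulrA [LHS]mulrC; congr (_ * _).
  by rewrite big_split /= -expi_dotp -complexr_prod.
rewrite cintZ// ibE mulrC; congr (_ * _); rewrite expi_dotp.
by apply: eq_bigr => i _; exact: (flat_shift _ (xM i)).2.
Qed.

End reproducing.

Section HS_reproducing.
Context {R : realType} {n : nat}.
Local Notation V := (Rn[R]_n).
Local Notation lam := (lebesgue_Rn R n).

Lemma ae_integral_sqr_cabs (f g : V -> R[i]) : cmeas g ->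
  {ae lam, forall x, f x = g x} ->
  (\int[lam]_x (cabs (f x) ^+ 2)%:E = \int[lam]_x (cabs (g x) ^+ 2)%:E)%E.
Proof.
move=> mg fg; apply: ge0_ae_eq_integralT.
- by move=> x; rewrite lee_fin sqr_ge0.
- by move=> x; rewrite lee_fin sqr_ge0.
- by apply/measurable_EFinP; apply: measurable_funX; exact: measurable_cabs.
- by apply: filterS fg => x ->.
Qed.

Lemma cvg0_lt (u : nat -> \bar R) (e : R) : u k @[k --> \oo] --> 0%E -> 0 < e ->
  \forall k \near \oo, (u k < e%:E)%E.
Proof.
by move=> u0 e0; exact: (u0 _ (@nbhs_open_ereal_lt R 0 (fun=> e) e0)).
Qed.

Lemma coord_le_enorm (x : V) (i : 'I_n) : `|tnth x i| <= enorm x.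
Proof.
rewrite -(ler_pXn2r (_ : (0 < 2)%N)) ?nnegrE ?sqrtr_ge0// sqr_enorm real_sqr_normr.
by rewrite (bigD1 i)//= lerDl sumr_ge0// => j _; exact: sqr_ge0.
Qed.

(** A Borel representative is multiplied by the indicator of a cube containing [S]. The support
    condition then holds at every point, and a square-integrable function on a bounded set is
    integrable. *)
Lemma L2_on_repr (S : set V) (M : R) (psi : V -> R[i]) :
  (forall x, S x -> enorm x <= M) -> L2_on S psi ->
  exists v : V -> R[i], [/\ cintegrable lam v,
    forall x, v x != 0 -> forall i, `|tnth x i| <= M &
    {ae lam, forall x, psi x = v x}].
Proof.
move=> SM [[[g [gr gi psig]] psi2] psi0].
pose b (x : V) : R := \prod_i \1_(`[- M, M]%classic) (tnth x i).
have [ib _] : lam.-integrable setT (EFin \o b) /\ _ := @integrable_Rintegral_tensor R n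
  (fun=> \1_(`[- M, M]%classic)) (fun=> integrable_indic_itv _ _ _ _).
have mb : measurable_fun setT b := integrable_measurable ib.
have b01 x : 0 <= b x <= 1.
  rewrite /b prodr_ge0 ?prodr_ile1// => i _; rewrite indicE; case: (_ \in _); rewrite ?ler01 ?lexx//.
have b0 x : b x != 0 -> forall i, `|tnth x i| <= M.
  move=> /prodf_neq0 h i; have := h i isT; rewrite indicE; case: (boolP (_ \in _)) => [|_].
    by rewrite inE /= in_itv/= -ler_norml.
  by rewrite eqxx.
pose v x := (b x)%:C%C * g x.
have mg : cmeas g by [].
have mv : cmeas v by apply: cmeasM => //; exact: cmeas_real.
exists v; split.
- have i2 : lam.-integrable setT (EFin \o (fun x => cabs (g x) ^+ 2)).
    apply: ge0_integrable_lty; first by apply: measurable_funX; exact: measurable_cabs.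
      by move=> x; exact: sqr_ge0.
    rewrite -(ae_integral_sqr_cabs mg psig).
    by apply: poweR_half_lty => //; apply: integral_ge0 => x _; rewrite lee_fin sqr_ge0.
  apply: (cintegrable_dom mv (integrableD_EFin i2 ib)) => x.
  rewrite /v cabsM cabs_real; have /andP[h0 h1] := b01 x.
  rewrite (ger0_norm h0); have := cabs_ge0 (g x); have := sqr_ge0 (cabs (g x) - 1); nra.
- move=> x; rewrite /v mulf_eq0 negb_or => /andP[bx _]; apply: b0.
  by apply: contra bx => /eqP ->.
- apply: filterS2 psig psi0 => x gx sx; rewrite /v.
  have [Sx|/sx ps] := pselect (S x).
    rewrite gx (_ : b x = 1) ?mul1r// /b big1// => i _.
    by rewrite indicE mem_set//= in_itv/= -ler_norml (le_trans (coord_le_enorm x i))// SM.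
  by rewrite -gx ps mulr0.
Qed.

(** The function, its transform and every term of the approximating sequence are known only up to
    null sets; each is replaced by a Borel representative so that [fourier_L2_unique] applies. *)
Lemma fourier_L2_repr (S : set V) (M : R) (psi f : V -> R[i]) :
  (forall x, S x -> enorm x <= M) -> L2_on S psi -> fourier_L2 psi f ->
  exists v : V -> R[i], [/\ cintegrable lam v,
    forall x, v x != 0 -> forall i, `|tnth x i| <= M &
    {ae lam, forall p, f p = fourier v p}].
Proof.
move=> SM Spsi [_ [[f0 [f0r f0i ff0]] f2] [u [Lu upsi uf]]].
have [v [iv vM psiv]] := L2_on_repr SM Spsi.
exists v; split => //.
have mv := cintegrable_cmeas iv.
have mf0 : cmeas f0 by [].
have if0 : lam.-integrable setT (EFin \o (fun p => cabs (f0 p) ^+ 2)).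
  apply: ge0_integrable_lty; first by apply: measurable_funX; exact: measurable_cabs.
    by move=> x; exact: sqr_ge0.
  rewrite -(ae_integral_sqr_cabs mf0 ff0).
  by apply: poweR_half_lty => //; apply: integral_ge0 => x _; rewrite lee_fin sqr_ge0.
have repr k : exists w, cintegrable lam w /\ {ae lam, forall x, u k x = w x}.
  have [[[w [wr wi uw]] u1] _] := Lu k; exists w; split => //.
  have mw : cmeas w by [].
  have iw : lam.-integrable setT (EFin \o (fun x => cabs (w x))).
    apply: ge0_integrable_lty; [exact: measurable_cabs|by move=> x; exact: cabs_ge0|].
    have <- : (\int[lam]_x (cabs (u k x))%:E = \int[lam]_x (cabs (w x))%:E)%E.
      apply: ge0_ae_eq_integralT => //; try by move=> x; rewrite lee_fin cabs_ge0.
        by apply/measurable_EFinP; exact: measurable_cabs.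
      by apply: filterS uw => x ->.
    exact: u1.
  exact: (cintegrable_dom mw iw).
have [w wP] := choice repr.
suff aef : {ae lam, forall p, f0 p = fourier v p}.
  by apply: filterS2 ff0 aef => p ->.
apply: (fourier_L2_unique iv mf0 if0 (fun k => (wP k).1)) => e e0.
have h1 := cvg0_lt upsi e0; have h2 := cvg0_lt uf e0.
have [N _ HN] := filterI h1 h2.
have [k1 k2] := HN N (leqnn N).
have mw := cintegrable_cmeas (wP N).1.
exists N; split.
  rewrite -(@ae_integral_sqr_cabs (fun x => u N x - psi x)).
  - apply/ltW/poweR_half_lt => //; apply: integral_ge0 => x _; by rewrite lee_fin sqr_ge0.
  - by apply: cmeasD => //; exact: cmeasN.
  - by apply: filterS2 (wP N).2 psiv => x -> ->.
rewrite -(@ae_integral_sqr_cabs (fun p => fourier (u N) p - f p)).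
- apply/ltW/poweR_half_lt => //; apply: integral_ge0 => x _; by rewrite lee_fin sqr_ge0.
- by apply: cmeasD; [exact: cmeas_fourier|exact: cmeasN].
- by rewrite (fourier_ae mw (wP N).2); apply: filterS ff0 => p ->.
Qed.

(** The kernel is real, so convolution acts on real and imaginary parts separately and the real
    estimates carry over. *)
Definition cconv (kap : 'I_n -> R -> R) (phi : V -> R[i]) (p : V) : R[i] :=
  (conv kap (fun q => complex.Re (phi q)) p +i* conv kap (fun q => complex.Im (phi q)) p)%C.

Variables (m : R) (m0 : 0 < m).

(** Borel real functions in L^2_r: the form in which the real and imaginary parts of representatives
    enter the estimates. *)
Definition weighted (phi : V -> R) := measurable_fun setT phi /\
  lam.-integrable setT (EFin \o (fun q => phi q ^+ 2 / energy m q)).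

Lemma measurable_energyV : measurable_fun setT (fun p : V => (energy m p)^-1).
Proof.
have -> : (fun p : V => (energy m p)^-1) = fun p : V => energy m p `^ (-1).
  by apply/funext => p; rewrite powR_inv1// sqrtr_ge0.
by apply: (measurableT_comp (measurable_powR (-1))); exact: measurable_energy.
Qed.

Lemma L2r_repr (phi : V -> R[i]) : L2r m phi -> exists g : V -> R[i],
  [/\ {ae lam, forall x, phi x = g x}, weighted (fun q => complex.Re (g q)) &
      weighted (fun q => complex.Im (g q))].
Proof.
move=> [[g [gr gi pg]] phi2]; exists g; have mg : cmeas g by [].
have ig : lam.-integrable setT (EFin \o (fun q => cabs (g q) ^+ 2 / energy m q)).
  apply: ge0_integrable_lty.
  - apply: measurable_funM; last exact: measurable_energyV.
    by apply: measurable_funX; exact: measurable_cabs.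
  - by move=> q; rewrite divr_ge0 ?sqr_ge0// sqrtr_ge0.
  - rewrite -(ae_integral_cabs2 _ measurable_energyV mg pg); last first.
      by move=> q; rewrite invr_ge0 sqrtr_ge0.
    apply: poweR_half_lty => //; apply: integral_ge0 => x _.
    by rewrite lee_fin divr_ge0 ?sqr_ge0// sqrtr_ge0.
have E0 q := ltW (energy_gt0 m0 (q : V)).
split=> //; split => //; apply: (integrable_dom _ ig).
- by apply: measurable_funM; [exact: measurable_funX|exact: measurable_energyV].
- move=> q; rewrite ger0_norm ?divr_ge0 ?sqr_ge0// ler_wpM2r ?invr_ge0//.
  by rewrite sqr_cabs lerDl sqr_ge0.
- by apply: measurable_funM; [exact: measurable_funX|exact: measurable_energyV].
- move=> q; rewrite ger0_norm ?divr_ge0 ?sqr_ge0// ler_wpM2r ?invr_ge0//.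
  by rewrite sqr_cabs lerDr sqr_ge0.
Qed.

End HS_reproducing.

(** * Convolution fixes the closed space H_S *)

Section HS_conv.
Context {R : realType} {n : nat}.
Local Notation V := (Rn[R]_n).
Local Notation lam := (lebesgue_Rn R n).
Variables (m : R) (m0 : 0 < m).

Lemma convB (kap : 'I_n -> R -> R) (C : R) (f g : V -> R) :
  (forall i, measurable_fun setT (kap i)) ->
  (forall i t, `|kap i t| <= C * decay t) -> weighted m f -> weighted m g ->
  forall p, conv kap (fun q => f q - g q) p = conv kap f p - conv kap g p.
Proof.
move=> mk kC [mf wf] [mg wg] p; rewrite /conv -RintegralB//.
- by apply: eq_Rintegral => q _; rewrite mulrBr.
- exact: (integrable_ker_mul mk kC m0 mf wf).
- exact: (integrable_ker_mul mk kC m0 mg wg).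
Qed.

Lemma weightedB (f g : V -> R) : weighted m f -> weighted m g ->
  weighted m (fun q => f q - g q).
Proof.
move=> [mf wf] [mg wg]; have mfg := measurable_funB mf mg; split => //.
apply: (integrable_dom _ (integrableD_EFin (integrableZ_EFin 2 wf) (integrableZ_EFin 2 wg))).
  by apply: measurable_funM; [exact: measurable_funX|exact: (@measurable_energyV R n m)].
move=> q; have E0 := energy_gt0 m0 q.
rewrite ger0_norm; last by rewrite divr_ge0 ?sqr_ge0 ?ltW.
have -> : 2 * (f q ^+ 2 / energy m q) + 2 * (g q ^+ 2 / energy m q) =
  (2 * f q ^+ 2 + 2 * g q ^+ 2) / energy m q by ring.
rewrite ler_wpM2r ?invr_ge0 ?(ltW E0)//.
by have := sqr_ge0 (f q + g q); nra.
Qed.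

Lemma weighted_conv (kap : 'I_n -> R -> R) (C : R) (f : V -> R) :
  (forall i, measurable_fun setT (kap i)) ->
  (forall i t, `|kap i t| <= C * decay t) -> weighted m f -> weighted m (conv kap f).
Proof.
move=> mk kC [mf wf]; split; first exact: measurable_conv.
by have [] := young mk kC m0 mf wf.
Qed.

(** If [G - d] is fixed, then [G - K * G = d - K * d], and by [young] the weighted square integral
    of the right-hand side is at most [(2 + 2 Y) e]. Letting [e] tend to 0, the left-hand side
    vanishes almost everywhere. *)
Lemma conv_fixed_of_approx (kap : 'I_n -> R -> R) (C : R) (G : V -> R) :
  (forall i, measurable_fun setT (kap i)) ->
  (forall i t, `|kap i t| <= C * decay t) -> weighted m G ->
  (forall e : R, 0 < e -> exists d, [/\ weighted m d,
    \int[lam]_q (d q ^+ 2 / energy m q) <= e &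
    forall p, conv kap (fun q => G q - d q) p = G p - d p]) ->
  {ae lam, forall p, G p = conv kap G p}.
Proof.
move=> mk kC wG happ.
have wcG := weighted_conv mk kC wG; have [md wd] := weightedB wG wcG.
pose Y := @young_cst R n C m.
have I0 : \int[lam]_p ((G p - conv kap G p) ^+ 2 / energy m p) = 0.
  apply: (@eq0_of_le_eps _ _ (2 + 2 * Y)).
    by apply: Rintegral_ge0 => p _; rewrite divr_ge0 ?sqr_ge0 ?sqrtr_ge0.
  move=> e e0; have [d [wdd de dE]] := happ e e0.
  have [mdd idd] := wdd.
  have wcd := weighted_conv mk kC wdd; have [_ yd] := young mk kC m0 mdd idd.
  have E p : G p - conv kap G p = d p - conv kap d p.
    by have := convB mk kC wG wdd p; rewrite dE; lra.
  apply: (@le_trans _ _ (2 * \int[lam]_p (d p ^+ 2 / energy m p) + 2 * \int[lam]_p (conv kap d p ^+ 2 / energy m p))).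
    have [_ i1] := wcd.
    rewrite -!RintegralZl// -RintegralD//; [|exact: integrableZ_EFin..].
    apply: le_Rintegral => //.
      by apply: integrableD_EFin; exact: integrableZ_EFin.
    move=> p _; have Ep := energy_gt0 m0 p.
    have -> : 2 * (d p ^+ 2 / energy m p) + 2 * (conv kap d p ^+ 2 / energy m p) =
      (2 * d p ^+ 2 + 2 * conv kap d p ^+ 2) / energy m p by ring.
    rewrite E ler_wpM2r ?invr_ge0 ?(ltW Ep)//.
    by have := sqr_ge0 (d p + conv kap d p); nra.
  have Y0 : 0 <= Y.
    have D0 : 0 <= \int[@lebesgue_measure R]_t decay t.
      by apply: Rintegral_ge0 => t _; exact/ltW/decay_gt0.
    have L0 : 0 <= \int[@lebesgue_measure R]_t lorentz t.
      by apply: Rintegral_ge0 => t _; exact/ltW/lorentz_gt0.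
    exact: mulr_ge0 (mulr_ge0 (sqr_ge0 _) (exprn_ge0 n D0))
      (mulr_ge0 (ltW (energy_cst_gt0 m0)) (exprn_ge0 n L0)).
  rewrite -/Y in yd; set I := \int[lam]_q (d q ^+ 2 / energy m q) in de yd *.
  have := ler_wpM2l Y0 de; lra.
have : ae_eq lam setT (EFin \o (fun p => (G p - conv kap G p) ^+ 2 / energy m p)) (cst 0%E).
  apply/ae_eq_integral_abs => //; first exact: (measurable_int _ wd).
  rewrite -[RHS]/(0%:E) -I0 (EFin_Rintegral wd).
  by apply: eq_integral => p _ /=; rewrite ger0_norm ?divr_ge0 ?sqr_ge0 ?sqrtr_ge0.
apply: filterS => p /(_ I) [] /eqP; rewrite mulf_eq0 invr_eq0 (gt_eqF (energy_gt0 m0 p)) orbF.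
by rewrite sqrf_eq0 subr_eq0 => /eqP.
Qed.

Variables (k : R -> R) (C M : R) (S : set V).
Hypothesis mk : measurable_fun setT k.
Hypothesis kC : forall t, `|k t| <= C * decay t.
Hypothesis flat : forall x, `|x| <= M ->
  cint (@lebesgue_measure R) (fun t => expi (t * x) * (k t)%:C%C) = 1.
Hypothesis SM : forall x, S x -> enorm x <= M.
Local Notation kap := ((fun=> k) : 'I_n -> R -> R).

Lemma HS_cconv (phi g : V -> R[i]) : HS m S phi ->
  {ae lam, forall x, phi x = g x} ->
  weighted m (fun q => complex.Re (g q)) -> weighted m (fun q => complex.Im (g q)) ->
  {ae lam, forall x, phi x = cconv kap g x}.
Proof.
move=> [_ Hphi] pg wr wi.
have mkap i : measurable_fun setT (kap i) by [].
have kapC i t : `|kap i t| <= C * decay t by exact: kC.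
have mg : cmeas g by split; [exact: wr.1|exact: wi.1].
have E0 (q : V) : 0 <= (energy m q)^-1 by rewrite invr_ge0 sqrtr_ge0.
have approx (e : R) : 0 < e -> exists h : V -> R[i], [/\ cmeas h,
    forall p, cint lam (fun q => (ker kap p q)%:C%C * h q) = h p &
    (\int[lam]_q (cabs (g q - h q) ^+ 2 / energy m q)%:E <= e%:E)%E].
  (* The closure is formulated with the norm, while the squared norm has to be below [e]. *)
  move=> e0; have s0 : 0 < Num.sqrt e by rewrite sqrtr_gt0.
  have [psi [f [Spsi psif pf]]] := Hphi _ s0.
  have [v [iv vM fv]] := fourier_L2_repr SM Spsi psif.
  have mFv := cmeas_fourier (cintegrable_cmeas iv).
  exists (fourier v); split => //.
    exact: (conv_fourier mk kC flat iv vM).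
  have mgv : cmeas (fun q => g q - fourier v q) by apply: cmeasD => //; exact: cmeasN.
  rewrite -(@ae_integral_cabs2 _ _ _ _ _ (fun p => phi p - f p) _ E0 (@measurable_energyV R n m) mgv); last first.
    by apply: filterS2 pg fv => q -> ->.
  rewrite -[X in (_ <= X%:E)%E](sqr_sqrtr (ltW e0)); apply/ltW/poweR_half_lt => //.
  by apply: integral_ge0 => q _; rewrite lee_fin mulr_ge0 ?sqr_ge0.
(* [P] stands for the real or the imaginary part, so the approximation argument is written once. *)
have comp (P : R[i] -> R) : (forall z, P z ^+ 2 <= cabs z ^+ 2) ->
    (forall z w, P (z - w) = P z - P w) ->
    (forall h, cmeas h -> measurable_fun setT (fun q : V => P (h q))) ->
    (forall h p, cint lam (fun q => (ker kap p q)%:C%C * h q) = h p ->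
       conv kap (fun q => P (h q)) p = P (h p)) ->
    weighted m (fun q => P (g q)) ->
    {ae lam, forall p, P (g p) = conv kap (fun q => P (g q)) p}.
  move=> Ple PB mP Pconv wP; apply: (conv_fixed_of_approx mkap kapC wP) => e e0.
  have [h [mh hE he]] := approx e e0.
  have mgh : cmeas (fun q => g q - h q) by apply: cmeasD => //; exact: cmeasN.
  have ig : lam.-integrable setT (EFin \o (fun q => cabs (g q - h q) ^+ 2 / energy m q)).
    apply: ge0_integrable_lty.
    - apply: measurable_funM; last exact: (@measurable_energyV R n m).
      by apply: measurable_funX; exact: measurable_cabs.
    - by move=> q; rewrite mulr_ge0 ?sqr_ge0.
    - by apply: le_lt_trans he _; exact: ltry.
  have wd : weighted m (fun q => P (g q - h q)).
    split; first exact: mP.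
    apply: (integrable_dom _ ig).
      by apply: measurable_funM; [by apply: measurable_funX; exact: mP|exact: (@measurable_energyV R n m)].
    move=> q; rewrite ger0_norm; last by rewrite mulr_ge0 ?sqr_ge0.
    exact: (ler_wpM2r (E0 q) (Ple _)).
  exists (fun q => P (g q - h q)); split => //.
  - apply: (@le_trans _ _ (\int[lam]_q (cabs (g q - h q) ^+ 2 / energy m q))).
      apply: le_Rintegral => //; first exact: wd.2.
      by move=> q _; exact: (ler_wpM2r (E0 q) (Ple _)).
    by rewrite -lee_fin EFin_Rintegral.
  - move=> p; have E q : P (g q) - P (g q - h q) = P (h q) by rewrite PB; ring.
    rewrite E -(Pconv h p (hE p)); congr (conv _ _ p); apply/funext => q; exact: E.
have aeR : {ae lam, forall p, complex.Re (g p) = conv kap (fun q => complex.Re (g q)) p}.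
  apply: (comp (@complex.Re R)) => //.
  - by move=> z; rewrite sqr_cabs lerDl sqr_ge0.
  - by move=> z w; rewrite cReD cReN.
  - by move=> h [].
  - move=> h p hE; rewrite -[in RHS]hE /conv /=; apply: eq_Rintegral => q _.
    by rewrite cReM /= mul0r subr0.
have aeI : {ae lam, forall p, complex.Im (g p) = conv kap (fun q => complex.Im (g q)) p}.
  apply: (comp (@complex.Im R)) => //.
  - by move=> z; rewrite sqr_cabs lerDr sqr_ge0.
  - by move=> z w; rewrite cImD cImN.
  - by move=> h [].
  - move=> h p hE; rewrite -[in RHS]hE /conv /=; apply: eq_Rintegral => q _.
    by rewrite cImM /= mul0r addr0.
apply: filterS3 pg aeR aeI => p -> r i; exact: complex_eq.
Qed.

End HS_conv.

(** * The position operators on H_S *)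

Section continuity_lines.
Context {R : realType}.
Local Notation mu := (@lebesgue_measure R).

(** The definition of absolute continuity is applied to a single interval, inside
    [[t - 1, t + 1]]. *)
Lemma loc_abs_continuous_dist (h : R -> R[i]) : loc_abs_continuous h ->
  forall t e : R, 0 < e -> exists2 d, 0 < d & forall s, `|t - s| < d -> cabs (h t - h s) < e.
Proof.
move=> hac t e e0; have t11 : t - 1 <= t + 1 by lra.
have [d d0 hd] := hac _ _ t11 e e0.
exists (Num.min d 1); first by rewrite lt_min d0 ltr01.
have key u v : t - 1 <= u -> u <= v -> v <= t + 1 -> v - u < d -> cabs (h v - h u) < e.
  move=> tu uv vt vud; have := hd 1%N (fun=> u) (fun=> v).
  rewrite !big_ord1; apply=> //.
  by move=> i j; rewrite !ord1 eqxx.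
move=> s; rewrite lt_min ltr_norml => /andP[/andP[h1 h2]]; rewrite ltr_norml => /andP[h3 h4].
have [st|ts] := leP s t; first by apply: key => //; lra.
by rewrite -opprB cabsN; apply: key => //; lra.
Qed.

Lemma continuous_of_dist (f : R -> R) :
  (forall t e : R, 0 < e -> exists2 d, 0 < d & forall s, `|t - s| < d -> `|f t - f s| < e) ->
  continuous f.
Proof.
move=> H t; apply/cvgrPdist_lt => e e0; have [d d0 hd] := H t e e0.
by exists d => //= s; exact: hd.
Qed.

Lemma loc_abs_continuousP (h : R -> R[i]) : loc_abs_continuous h ->
  continuous (fun t => complex.Re (h t)) /\ continuous (fun t => complex.Im (h t)).
Proof.
move=> hac; split; apply: continuous_of_dist => t e e0;
  have [d d0 hd] := loc_abs_continuous_dist hac t e0; exists d => // s /hd;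
  apply: le_lt_trans.
- by apply: le_trans (cRe_le _); rewrite cReD cReN.
- by apply: le_trans (cIm_le _); rewrite cImD cImN.
Qed.

(** If the functions differed at one point they would differ on an open interval, which has positive
    measure. *)
Lemma continuous_ae_eq (f g : R -> R) : continuous f -> continuous g ->
  mu.-negligible [set t | f t <> g t] -> f = g.
Proof.
move=> cf cg [N [mN N0 fgN]]; apply/funext => t; apply: contrapT => fgt.
have cu : continuous (fun t => f t - g t) by move=> s; apply: cvgB; [exact: cf|exact: cg].
have u0 : 0 < `|f t - g t| by rewrite normr_gt0 subr_eq0; apply/eqP.
have /cvgrPdist_lt /(_ _ u0) [d /= d0 hd] := cu t.
have : (mu `](t - d)%R, (t + d)%R[ <= mu N)%E.
  apply: le_measure; rewrite ?inE//.
  move=> s; rewrite /= in_itv/= => /andP[h1 h2]; apply: fgN => fgs.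
  have := hd s; rewrite fgs subrr subr0 ltxx => H; suff : false by [].
  by apply: H; rewrite /ball_ /= ltr_norml; lra.
rewrite [X in (_ <= X)%E -> _]N0 lebesgue_measure_itv/= lte_fin.
rewrite ifT; last by lra.
by rewrite -EFinD lee_fin; lra.
Qed.

End continuity_lines.

(** * The graph of Q_j over a function fixed by convolution *)

Section position.
Context {R : realType} {n : nat}.
Local Notation V := (Rn[R]_n.+1).
Local Notation lam := (lebesgue_Rn R n.+1).
Variables (m : R) (m0 : 0 < m) (k k' : R -> R) (C : R) (j : 'I_n.+1).
Hypothesis dk : forall t, is_derive t (1 : R) k (k' t).
Hypothesis ck' : continuous k'.
Hypothesis kC : forall t, `|k t| <= C * decay t.
Hypothesis k'C : forall t, `|k' t| <= C * decay t.
Local Notation kap := ((fun=> k) : 'I_n.+1 -> R -> R).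
Local Notation dk' := (dkap kap j k').
Variables (phi g : V -> R[i]).
Hypothesis Lphi : L2r m phi.
Hypothesis pg : {ae lam, forall x, phi x = g x}.
Hypothesis wr : weighted m (fun q => complex.Re (g q)).
Hypothesis wi : weighted m (fun q => complex.Im (g q)).
Hypothesis fixed : {ae lam, forall x, phi x = cconv kap g x}.

Let mkap i : measurable_fun setT (kap i).
Proof. by apply: continuous_measurable_R; exact: derive_continuous dk. Qed.
Let kapC i t : `|kap i t| <= C * decay t. Proof. exact: kC. Qed.
Let mk' : measurable_fun setT k'. Proof. exact: continuous_measurable_R. Qed.
Let dkC i t : `|dk' i t| <= C * decay t. Proof. exact: dkap_le. Qed.
Let mdk i : measurable_fun setT (dk' i). Proof. exact: measurable_dkap. Qed.

Lemma is_cderive_cconv p t : is_cderive (cconv kap g \o setc p j) t (cconv dk' g (setc p j t)).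
Proof.
split => /=.
  exact: (is_derive_conv mkap kapC k'C dk m0 wr.1 wr.2).
exact: (is_derive_conv mkap kapC k'C dk m0 wi.1 wi.2).
Qed.

Lemma loc_abs_continuous_cconv (w : Rn[R]_n) :
  loc_abs_continuous (cconv kap g \o @insc R n.+1 j w).
Proof.
move=> a b ab.
have [A A0 hA] := conv_lipschitz (j := j) mkap kapC mk' k'C dk m0 wr.1 wr.2 (@insc R n.+1 j w 0) a b.
have [B B0 hB] := conv_lipschitz (j := j) mkap kapC mk' k'C dk m0 wi.1 wi.2 (@insc R n.+1 j w 0) a b.
apply: (lipschitz_abs_continuous (addr_ge0 A0 B0)).
move=> s t sa st tb; apply: (le_trans (cabs_le _)); rewrite mulrDl.
have := hA s t sa st tb; have := hB s t sa st tb; rewrite !setc_insc => hB' hA'.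
by rewrite cReD cReN cImD cImN; exact: lerD.
Qed.

Lemma weighted_cconv (kp : 'I_n.+1 -> R -> R) : (forall i, measurable_fun setT (kp i)) ->
  (forall i t, `|kp i t| <= C * decay t) -> L2r m (fun p => 'i%C * cconv kp g p).
Proof.
move=> mkp kpC.
have [mr ir] := weighted_conv m0 mkp kpC wr; have [mi ii] := weighted_conv m0 mkp kpC wi.
have mc : cmeas (cconv kp g) by [].
have mic : cmeas (fun p => 'i%C * cconv kp g p) by apply: cmeasM => //; exact: cmeas_cst.
split.
  exists (fun p => 'i%C * cconv kp g p); split; [exact: mic.1|exact: mic.2|].
  by apply: aeW.
rewrite /norm_r poweR_lty//.
have E : (\int[lam]_p (cabs ('i%C * cconv kp g p) ^+ 2 / energy m p)%:E =
    \int[lam]_p (conv kp (fun q => complex.Re (g q)) p ^+ 2 / energy m p +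
      conv kp (fun q => complex.Im (g q)) p ^+ 2 / energy m p)%:E)%E.
  apply: eq_integral => p _; congr EFin.
  rewrite cabsM (_ : cabs 'i%C = 1) ?mul1r ?sqr_cabs ?mulrDl//.
  by rewrite /cabs /= expr0n/= add0r expr1n sqrtr1.
by rewrite E; exact: (integrable_lty measurableT (integrableD_EFin ir ii)).
Qed.

(** The representative [cconv kap g] is absolutely continuous on every line and differentiable at
    every point, so the last two clauses of [KGpos] hold without exceptions. *)
Lemma KGpos_cconv : KGpos m j phi (fun p => 'i%C * cconv dk' g p).
Proof.
split => //; first exact: weighted_cconv.
exists (cconv kap g); split => //.
  by apply: aeW => w; exact: loc_abs_continuous_cconv.
apply: aeW => p; exists (cconv dk' g p); split => //.
by have := is_cderive_cconv p (coord p j); rewrite setc_id.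
Qed.

(* On almost every line [phi] and its convolution have representatives that are
   continuous and equal a.e., hence equal, so their derivatives agree. *)
Lemma KGpos_unique (chi : V -> R[i]) : KGpos m j phi chi ->
  {ae lam, forall p, chi p = 'i%C * cconv dk' g p}.
Proof.
move=> [_ _ [f [pf fac fd]]].
have fg : lam.-negligible [set p | f p <> cconv kap g p].
  by apply: filterS2 pf fixed => p -> ->.
have lines : {ae lebesgue_Rn R n, forall w,
    forall t, f (@insc R n.+1 j w t) = cconv kap g (@insc R n.+1 j w t)}.
  apply: filterS2 fac (negligible_insc j fg) => w ac neg.
  have [cfr cfi] := loc_abs_continuousP ac.
  have [cgr cgi] := loc_abs_continuousP (loc_abs_continuous_cconv w).
  have er := continuous_ae_eq cfr cgr; have ei := continuous_ae_eq cfi cgi.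
  move=> t; apply: complex_eq.
    apply: (congr1 (fun u => u t) (er _)); apply: negligibleS neg => s /= + fs.
    by rewrite fs.
  apply: (congr1 (fun u => u t) (ei _)); apply: negligibleS neg => s /= + fs.
  by rewrite fs.
(* Almost every line becomes almost every point: the union of the exceptional lines is a cylinder
   over a null set. *)
have lines' := negligible_delc j lines.
have lines'' : {ae lam, forall p, forall t, f (setc p j t) = cconv kap g (setc p j t)}.
  apply: negligibleS lines' => p /= np h; apply: np => t.
  by rewrite setc_delc; exact: h.
apply: filterS2 fd lines'' => p [d [dd ->]] eqs; congr (_ * _).
have E : f \o setc p j = cconv kap g \o setc p j by apply/funext => t; exact: eqs.
have [dr di] := is_cderive_cconv p (coord p j); rewrite setc_id in dr di.
case: dd; rewrite E => ddr ddi.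
apply: complex_eq; [exact: (is_derive_unique ddr dr)|exact: (is_derive_unique ddi di)].
Qed.

End position.

(** * Schwartz functions and their Fourier transforms *)

Section cderive.
Context {R : realType}.
Implicit Types (u v : R -> R[i]) (t : R) (a b z : R[i]).

Lemma is_cderiveM u v t a b : is_cderive u t a -> is_cderive v t b ->
  is_cderive (fun s => u s * v s) t (a * v t + u t * b).
Proof.
move=> [ur ui] [vr vi]; split.
  apply: is_derive_ext (der_sub (der_mul ur vr) (der_mul ui vi)) => [s|].
    by rewrite cReM.
  by rewrite cReD !cReM; ring.
apply: is_derive_ext (der_add (der_mul ur vi) (der_mul ui vr)) => [s|].
  by rewrite cImM.
by rewrite cImD !cImM; ring.
Qed.

Lemma is_cderive_expi (c y t : R) :
  is_cderive (fun s => expi (- (c + s * y))) t (- 'i%C * (y%:C)%C * expi (- (c + t * y))).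
Proof.
have d : is_derive t (1 : R) (fun s => - (c + s * y)) (- y).
  apply: is_derive_ext (der_opp (der_add (der_cst t c) (der_mulr t y))) => //.
  by rewrite add0r.
have -> : - 'i%C * (y%:C)%C * expi (- (c + t * y)) =
    ((sin (- (c + t * y)) * y) +i* (- cos (- (c + t * y)) * y))%C.
  by apply: complex_eq; rewrite !(cReM, cImM) /expi /=; ring.
split.
  apply: is_derive_ext (@der_comp _ cos (fun s => - (c + s * y)) t _ _ (is_derive_cos _) d) => //=.
  by rewrite mulrNN.
apply: is_derive_ext (@der_comp _ sin (fun s => - (c + s * y)) t _ _ (is_derive_sin _) d) => //=.
by rewrite mulrN mulNr.
Qed.

Lemma cderive_continuous u (du : R -> R[i]) : (forall t, is_cderive u t (du t)) ->
  continuous (fun t => complex.Re (u t)) /\ continuous (fun t => complex.Im (u t)).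
Proof.
by move=> du'; split; [exact: (derive_continuous (fun t => (du' t).1))|exact: (derive_continuous (fun t => (du' t).2))].
Qed.

End cderive.

(** * Vanishing integrals of partial derivatives *)

Section divergence.
Context {R : realType} {n : nat}.
Local Notation V := (Rn[R]_n.+1).
Local Notation lam := (lebesgue_Rn R n.+1).
Local Notation mu := (@lebesgue_measure R).

(** The sign [e] treats both ends of the line at once; the comparison is
    [1 / (1 + (i + 1)^2) <= 1 / (i + 1)]. *)
Lemma cvg_lorentz (B : R) (u : R -> R) (e : R) : `|e| = 1 ->
  (forall t, `|u t| <= B * lorentz t) -> u (e * i.+1%:R) @[i --> \oo] --> 0.
Proof.
move=> e1 uB; apply: norm_cvg0; apply: (@squeeze_cvgr _ _ _ _ (cst 0) (fun i => B * harmonic i)).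
- apply: nearW => i; rewrite normr_ge0 /=; apply: (le_trans (uB _)).
  have B0 : 0 <= B.
    by have := le_trans (normr_ge0 _) (uB 0); rewrite pmulr_lge0// lorentz_gt0.
  rewrite ler_wpM2l// /lorentz /harmonic/= lef_pV2 ?posrE ?oneDsqr_gt0//.
  rewrite -real_sqr_normr normrM e1 mul1r ger0_norm//.
  have : 1 <= i.+1%:R :> R by rewrite ler1n.
  by nra.
- exact: (@cvg_cst R).
- rewrite -[X in _ --> X](mulr0 B); apply: cvgM; first exact: cvg_cst.
  exact: cvg_harmonic.
Qed.

Lemma prod_lorentz_insc (j : 'I_n.+1) (w : Rn[R]_n) (t : R) :
  \prod_i lorentz (tnth (@insc R n.+1 j w t) i) = lorentz t * \prod_i lorentz (tnth w i).
Proof.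
rewrite (bigD1 j)//= tnth_insc_id; congr (_ * _).
rewrite (reindex_omap (lift j) (unlift j)) /=; last first.
  by move=> i; rewrite eq_sym => /unlift_some[k -> _] /=; rewrite liftK.
rewrite (eq_bigl xpredT); last by move=> k; rewrite liftK eqxx andbT eq_sym neq_lift.
by apply: eq_bigr => k _; rewrite tnth_insc_lift.
Qed.

(** Fubini, integrating first along direction [j]: on each line the integrand is the derivative of a
    function that tends to 0 at both ends. *)
Lemma Rintegral_partial_eq0 (j : 'I_n.+1) (F D : V -> R) (B : R) :
  measurable_fun setT D ->
  (forall x, `|F x| <= B * \prod_i lorentz (tnth x i)) ->
  (forall x, `|D x| <= B * \prod_i lorentz (tnth x i)) ->
  (forall x t, is_derive t (1 : R) (fun s => F (setc x j s)) (D (setc x j t))) ->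
  (forall x, continuous (fun t => D (setc x j t))) ->
  \int[lam]_x D x = 0.
Proof.
move=> mD FB DB dF cD.
have T := @lebesgue_Rn_insc R n j.
rewrite (Rintegral_transfer (measurable_pair_insc j) T)//.
have mDp : measurable_fun setT (D \o pair_insc j).
  by apply: (measurableT_comp mD); exact: measurable_pair_insc.
have dom t w : `|(D \o pair_insc j) (t, w)| <= (B * lorentz t) * \prod_i lorentz (tnth w i).
  rewrite /= -mulrA -(prod_lorentz_insc j w t); exact: DB.
have iB := integrableZ_EFin B (@integrable_lorentz R).
have iL := @integrable_prod_lorentz R n.
rewrite (Rfubini2 mDp iB iL dom).
rewrite /Rintegral (eq_integral (cst 0%E)) ?integral0// => w _; congr EFin.
have insE t : @insc R n.+1 j w t = setc (@insc R n.+1 j w 0) j t by rewrite setc_insc.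
have Fl t : `|F (@insc R n.+1 j w t)| <= (B * \prod_i lorentz (tnth w i)) * lorentz t.
  rewrite -mulrA [_ * lorentz t]mulrC -(prod_lorentz_insc j w t); exact: FB.
apply: (@Rintegral_derive_eq0 _ (fun t => F (@insc R n.+1 j w t)) (fun t => D (@insc R n.+1 j w t))).
- move=> t; rewrite insE; under eq_fun do rewrite insE; exact: dF.
- under eq_fun do rewrite insE; exact: cD.
- exact: (integrable_slice2 mDp iB dom w).
- have := cvg_lorentz (normr1 R) Fl.
  by under eq_fun do rewrite mul1r.
- have := cvg_lorentz (normrN1 R) Fl.
  by under eq_fun do rewrite mulN1r.
Qed.

End divergence.

Section schwartz_facts.
Context {R : realType} {n : nat}.
Local Notation V := (Rn[R]_n).
Local Notation lam := (lebesgue_Rn R n).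
Implicit Types (f : V -> R[i]) (x y : V).

(** The head of the list is the derivative taken last, so a derivative taken beforehand is appended
    at the end. *)
Lemma schwartz_cpartial f j : schwartz f -> schwartz (cpartial j f).
Proof.
move=> Sf s; have := Sf (rcons s j).
by rewrite /cpartials foldr_rcons.
Qed.

Lemma schwartz_is_cderive f j x t : schwartz f ->
  is_cderive (f \o setc x j) t (cpartial j f (setc x j t)).
Proof.
move=> Sf; have [h _] := Sf [::]; have [d [dr di]] := h j (setc x j t).
have E : (cpartials [::] f \o setc (setc x j t) j) = f \o setc x j.
  by apply/funext => s /=; rewrite setc_setc.
rewrite coord_setc E in dr di.
have -> : cpartial j f (setc x j t) = d.
  have E2 : (fun s => f (setc (setc x j t) j s)) = f \o setc x j.
    by apply/funext => s /=; rewrite setc_setc.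
  apply: complex_eq; rewrite /cpartial /= coord_setc derive1E.
    under eq_fun do rewrite setc_setc; exact: (derive_val (is_derive := dr)).
  under eq_fun do rewrite setc_setc; exact: (derive_val (is_derive := di)).
by split.
Qed.

Lemma prodsqr_le_enorm x : prodsqr x <= (1 + enorm x) ^+ (2 * n).
Proof.
have e0 : 0 <= enorm x by exact: sqrtr_ge0.
rewrite exprM -[in X in _ ^+ X](card_ord n) -prodr_const; apply: ler_prod => i _.
rewrite (ltW (oneDsqr_gt0 _))/=; have := coord_le_enorm x i.
by rewrite -(real_sqr_normr (tnth x i)); have := normr_ge0 (tnth x i); nra.
Qed.

(** The seminorm of exponent [2 * n * N] suffices, because each factor [1 + x_i^2] is at most
    [(1 + |x|)^2]. *)
Lemma schwartz_decay f N : schwartz f -> exists2 M : R, 0 <= M &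
  forall x, cabs (f x) <= M * (\prod_i lorentz (tnth x i)) ^+ N.
Proof.
move=> Sf; have [_ h] := Sf [::]; have [M hM] := h (2 * n * N)%N.
exists `|M| => // x; have P0 := prodsqr_gt0 x.
rewrite prod_lorentz exprVn ler_pdivlMr ?exprn_gt0// mulrC.
apply: le_trans (le_trans (hM x) (ler_norm M)).
rewrite ler_wpM2r ?cabs_ge0// exprM lerXn2r ?nnegrE ?prodsqr_le_enorm ?(ltW P0)//.
by rewrite exprn_ge0// addr_ge0// sqrtr_ge0.
Qed.

Lemma schwartz_bounded f : schwartz f -> exists2 M : R, 0 <= M & forall x, cabs (f x) <= M.
Proof.
by move=> /(@schwartz_decay f 0) [M M0 h]; exists M => // x; have := h x; rewrite expr0 mulr1.
Qed.

Definition lipschitz_sum (L : R) f := forall x y,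
  cabs (f x - f y) <= L * \sum_i `|tnth x i - tnth y i|.

(** All partial derivatives are bounded, and [y] is changed into [x] one coordinate at a time. This
    supplies the joint continuity that measurability and the heat kernel estimate rely on. *)
Lemma schwartz_lipschitz f : schwartz f -> exists2 L : R, 0 <= L & lipschitz_sum L f.
Proof.
move=> Sf.
have [B hB] : exists B : 'I_n -> R, forall j, 0 <= B j /\ forall x, cabs (cpartial j f x) <= B j.
  have : forall j, exists B : R, 0 <= B /\ forall x, cabs (cpartial j f x) <= B.
    by move=> j; have [B B0 h] := schwartz_bounded (schwartz_cpartial j Sf); exists B.
  by move=> /choice[B hB]; exists B.
pose L := \sum_j B j.
have L0 : 0 <= L by apply: sumr_ge0 => j _; have [] := hB j.
have BL j : B j <= L.
  by rewrite /L (bigD1 j)//= lerDl sumr_ge0// => i _; have [] := hB i.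
have one x j s t : cabs (f (setc x j t) - f (setc x j s)) <= 2 * L * `|t - s|.
  wlog st : s t / s <= t.
    move=> H; have [st|/ltW ts] := leP s t; first exact: H.
    by rewrite -opprB cabsN distrC; exact: H.
  have dR u := (schwartz_is_cderive j x u Sf).1.
  have dI u := (schwartz_is_cderive j x u Sf).2.
  have bR u : `|complex.Re (cpartial j f (setc x j u))| <= L.
    exact: le_trans (cRe_le _) (le_trans ((hB j).2 _) (BL j)).
  have bI u : `|complex.Im (cpartial j f (setc x j u))| <= L.
    exact: le_trans (cIm_le _) (le_trans ((hB j).2 _) (BL j)).
  have hr := lipschitz_derive dR (fun u _ _ => bR u) (lexx s) st (lexx t).
  have hi := lipschitz_derive dI (fun u _ _ => bI u) (lexx s) st (lexx t).
  apply: (le_trans (cabs_le _)); rewrite (ger0_norm (_ : 0 <= t - s)) ?subr_ge0//.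
  rewrite cReD cReN cImD cImN; apply: (le_trans (lerD hr hi)).
  by move: (L) => L1; clear; nra.
exists (2 * L); first by rewrite mulr_ge0.
move=> x y.
(* The intermediate points: coordinates of [x] at the indices in [s], coordinates of [y]
   elsewhere. *)
pose hyb (s : seq 'I_n) := foldr (fun j z => setc z j (tnth x j)) y s.
have hybE s i : tnth (hyb s) i = if i \in s then tnth x i else tnth y i.
  elim: s => [|j s IHs] //=; rewrite tnth_setc in_cons IHs.
  by case: eqP => [->|].
have step s : uniq s -> cabs (f (hyb s) - f y) <= 2 * L * \sum_(i <- s) `|tnth x i - tnth y i|.
  elim: s => [|j s IHs] /=; first by rewrite subrr cabs0 big_nil mulr0.
  move=> /andP[js us]; rewrite big_cons mulrDr.
  have -> : f (setc (hyb s) j (tnth x j)) - f y =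
      (f (setc (hyb s) j (tnth x j)) - f (setc (hyb s) j (tnth y j))) + (f (hyb s) - f y).
    rewrite (_ : setc (hyb s) j (tnth y j) = hyb s); first by ring.
    by rewrite -[RHS](setc_id (hyb s) j) /coord hybE (negbTE js).
  by apply: (le_trans (cabsD _ _)); apply: lerD; [exact: one|exact: IHs].
have := step (index_enum 'I_n) (index_enum_uniq _).
congr (cabs (f _ - _) <= _).
by apply: eq_from_tnth => i; rewrite hybE mem_index_enum.
Qed.

End schwartz_facts.

Section lipschitz_measurable.
Context {R : realType} {n : nat}.
Local Notation V := (Rn[R]_n).

Lemma near_rat (x : V) (d : R) : 0 < d ->
  exists q : n.-tuple rat, forall i, `|tnth x i - ratr (tnth q i)| < d.
Proof.
move=> d0.
have : forall i, exists q : rat, `|tnth x i - ratr q| < d.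
  move=> i; have [q] := @rat_in_itvoo R (tnth x i - d) (tnth x i + d) ltac:(lra).
  rewrite in_itv/= => /andP[h1 h2]; exists q; rewrite ltr_norml.
  by apply/andP; split; lra.
move=> /choice[q hq]; exists [tuple q i | i < n] => i.
by rewrite tnth_mktuple.
Qed.

(* {u < c} is the union over rational points q of {u q + L |x - q|_1 < c}. *)
Lemma measurable_lipschitz (u : V -> R) (L : R) : 0 <= L ->
  (forall x y, `|u x - u y| <= L * \sum_i `|tnth x i - tnth y i|) ->
  measurable_fun setT u.
Proof.
move=> L0 uL.
pose r (q : n.-tuple rat) : V := [tuple ratr (tnth q i) | i < n].
have mL q : measurable_fun setT (fun x : V => u (r q) + L * \sum_i `|tnth x i - tnth (r q) i|).
  apply: measurable_funD => //; apply: measurable_funM => //.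
  apply: measurable_sum => i; apply: measurableT_comp => //.
  by apply: measurable_funB => //; exact: measurable_coord.
apply: (measurability _ (@RGenInftyO.measurableE R)) => // _ [_ [c ->] <-].
rewrite setTI.
have -> : u @^-1` `]-oo, c[ = \bigcup_(q : n.-tuple rat)
    [set x | u (r q) + L * \sum_i `|tnth x i - tnth (r q) i| < c].
  apply/seteqP; split => x /=.
    (* At this precision [2 (L + 1)] times the l^1 distance to the rational point is at most
       [c - u x]. Using [L + 1] and [n.+1] keeps the denominator positive for [L = 0] or [n = 0]. *)
    rewrite in_itv/= => uc; have d0 : 0 < (c - u x) / (2 * (L + 1) * (n.+1)%:R).
      by rewrite divr_gt0 ?subr_gt0// !mulr_gt0// ltr_wpDl.
    have [q hq] := near_rat x d0; exists q => //=.
    set s := \sum_i _.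
    have s0 : 0 <= s by exact: sumr_ge0.
    have hs : s * (2 * (L + 1)) <= c - u x.
      rewrite -ler_pdivlMr ?mulr_gt0// ?ltr_wpDl//.
      apply: (@le_trans _ _ (\sum_(i < n) ((c - u x) / (2 * (L + 1) * (n.+1)%:R)))).
        by apply: ler_sum => i _; rewrite tnth_mktuple ltW.
      have L1 : L + 1 != 0 by rewrite gt_eqF// ltr_wpDl.
      have -> : (c - u x) / (2 * (L + 1)) =
          (c - u x) / (2 * (L + 1) * n.+1%:R) * n.+1%:R.
        by field; rewrite L1 addrC natr1 pnatr_eq0.
      by rewrite sumr_const card_ord [leRHS]mulr_natr; apply: ler_wpMn2l => //; exact: ltW.
    have := uL (r q) x; rewrite (eq_bigr (fun i => `|tnth x i - tnth (r q) i|)); last first.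
      by move=> i _; rewrite distrC.
    rewrite -/s ler_norml => /andP[_ h].
    by nra.
  move=> [q _ /= h]; rewrite in_itv/=; apply: le_lt_trans h.
  by have := uL x (r q); rewrite ler_norml => /andP[_]; rewrite lerBlDl.
apply: countable_bigcupT_measurable; first exact: countableP.
move=> q; rewrite -[X in measurable X]setTI.
have := mL q measurableT `]-oo, c[%classic (measurable_itv _).
by congr measurable; congr (_ `&` _); apply/seteqP; split => x /=; rewrite in_itv.
Qed.

Lemma cmeas_schwartz (f : V -> R[i]) : schwartz f -> cmeas f.
Proof.
move=> /schwartz_lipschitz[L L0 fL]; split; apply: (measurable_lipschitz L0) => x y.
  by apply: le_trans (fL x y); apply: le_trans (cRe_le _); rewrite cReD cReN.
by apply: le_trans (fL x y); apply: le_trans (cIm_le _); rewrite cImD cImN.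
Qed.

End lipschitz_measurable.

Section continuous_lines.
Context {R : realType}.
Implicit Types (u v : R -> R[i]).

Definition ccont u := continuous (fun t => complex.Re (u t)) /\
  continuous (fun t => complex.Im (u t)).

Lemma ccontM u v : ccont u -> ccont v -> ccont (fun t => u t * v t).
Proof.
move=> [ur ui] [vr vi]; split.
  under eq_fun do rewrite cReM.
  by move=> t; apply: cvgB; apply: cvgM; [exact: ur|exact: vr|exact: ui|exact: vi].
under eq_fun do rewrite cImM.
by move=> t; apply: cvgD; apply: cvgM; [exact: ur|exact: vi|exact: ui|exact: vr].
Qed.

Lemma ccontD u v : ccont u -> ccont v -> ccont (fun t => u t + v t).
Proof.
move=> [ur ui] [vr vi]; split.
  by under eq_fun do rewrite cReD; move=> t; apply: cvgD; [exact: ur|exact: vr].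
by under eq_fun do rewrite cImD; move=> t; apply: cvgD; [exact: ui|exact: vi].
Qed.

Lemma ccont_cst (z : R[i]) : ccont (fun=> z).
Proof. by split => t; exact: cvg_cst. Qed.

End continuous_lines.

(** * Integration by parts and the decay of Fourier transforms *)

Section integration_by_parts.
Context {R : realType} {n : nat}.
Local Notation V := (Rn[R]_n.+1).
Local Notation lam := (lebesgue_Rn R n.+1).
Implicit Types (f G : V -> R[i]) (x p : V).

Lemma cint_partial_eq0 (j : 'I_n.+1) (F D : V -> R[i]) (B : R) : cmeas D ->
  (forall x, cabs (F x) <= B * \prod_i lorentz (tnth x i)) ->
  (forall x, cabs (D x) <= B * \prod_i lorentz (tnth x i)) ->
  (forall x t, is_cderive (F \o setc x j) t (D (setc x j t))) ->
  (forall x, ccont (D \o setc x j)) ->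
  cint lam D = 0.
Proof.
move=> [mr mi] FB DB dF cD; apply: complex_eq => /=.
  apply: (@Rintegral_partial_eq0 _ _ j (fun x => complex.Re (F x)) _ B) => //.
  - by move=> x; exact: le_trans (cRe_le _) (FB x).
  - by move=> x; exact: le_trans (cRe_le _) (DB x).
  - by move=> x t; exact: (dF x t).1.
  - by move=> x; exact: (cD x).1.
apply: (@Rintegral_partial_eq0 _ _ j (fun x => complex.Im (F x)) _ B) => //.
- by move=> x; exact: le_trans (cIm_le _) (FB x).
- by move=> x; exact: le_trans (cIm_le _) (DB x).
- by move=> x t; exact: (dF x t).2.
- by move=> x; exact: (cD x).2.
Qed.

Lemma cintegrable_schwartz f : schwartz f -> cintegrable lam f.
Proof.
move=> Sf; have [M M0 h] := schwartz_decay 1 Sf.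
apply: (cintegrable_dom (cmeas_schwartz Sf) (integrableZ_EFin M (@integrable_prod_lorentz R n.+1))).
by move=> x; rewrite -[X in M * X]expr1.
Qed.

Lemma cabs_mul_le (z w : R[i]) (a b : R) : cabs z <= a -> cabs w <= b -> cabs (z * w) <= a * b.
Proof. by move=> za wb; rewrite cabsM; apply: ler_pM => //; exact: cabs_ge0. Qed.

Lemma cintegrable_schwartzM f G (K : R) : schwartz f -> cmeas G ->
  (forall x, cabs (G x) <= K) -> cintegrable lam (fun x => f x * G x).
Proof.
move=> Sf mG GK; have [M M0 h] := schwartz_decay 1 Sf.
apply: (cintegrable_dom (cmeasM (cmeas_schwartz Sf) mG)
  (integrableZ_EFin (M * K) (@integrable_prod_lorentz R n.+1))) => x.
by rewrite mulrAC; apply: cabs_mul_le => //; rewrite -[X in M * X]expr1.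
Qed.

(** The partial derivative of [f * G] integrates to 0. The factor [G] is merely bounded, so that it
    may be an exponential or a translated kernel; [f] provides all the decay. *)
Lemma schwartz_by_parts (j : 'I_n.+1) f G DG (K : R) : schwartz f ->
  cmeas G -> cmeas DG ->
  (forall x, cabs (G x) <= K) -> (forall x, cabs (DG x) <= K) ->
  (forall x t, is_cderive (G \o setc x j) t (DG (setc x j t))) ->
  (forall x, ccont (DG \o setc x j)) ->
  cint lam (fun x => cpartial j f x * G x) = - cint lam (fun x => f x * DG x).
Proof.
move=> Sf mG mDG GK DGK dG cDG.
have Sp := schwartz_cpartial j Sf.
have i1 := cintegrable_schwartzM Sp mG GK.
have i2 := cintegrable_schwartzM Sf mDG DGK.
apply/eqP; rewrite -subr_eq0 opprK -cintD//; apply/eqP.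
have [M1 M10 h1] := schwartz_decay 1 Sf.
have [M2 M20 h2] := schwartz_decay 1 Sp.
have K0 : 0 <= K := le_trans (cabs_ge0 _) (GK [tuple 0 | i < n.+1]).
apply: (@cint_partial_eq0 j (fun x => f x * G x) _ (M1 * K + M2 * K)).
- by apply: cmeasD; apply: cmeasM => //; exact: cmeas_schwartz.
- move=> x; apply: (@le_trans _ _ (M1 * K * \prod_i lorentz (tnth x i))).
    by rewrite mulrAC; apply: cabs_mul_le => //; rewrite -[X in M1 * X]expr1.
  rewrite ler_wpM2r ?prodr_ge0//; first by move=> i _; exact: ltW (lorentz_gt0 _).
  by rewrite lerDl mulr_ge0.
- move=> x; rewrite mulrDl addrC; apply: (le_trans (cabsD _ _)); apply: lerD.
    by rewrite mulrAC; apply: cabs_mul_le => //; rewrite -[X in M2 * X]expr1.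
  by rewrite mulrAC; apply: cabs_mul_le => //; rewrite -[X in M1 * X]expr1.
- move=> x t; exact: (is_cderiveM (schwartz_is_cderive j x t Sf) (dG x t)).
- move=> x; have cf := cderive_continuous (fun t => schwartz_is_cderive j x t Sf).
  have cp := cderive_continuous (fun t => schwartz_is_cderive j x t Sp).
  have cG := cderive_continuous (dG x).
  by apply: ccontD; apply: ccontM => //; exact: cDG.
Qed.

Lemma dotp_setc (p x : V) (j : 'I_n.+1) (t : R) :
  dotp p (setc x j t) = dotp p (setc x j 0) + t * coord p j.
Proof.
rewrite /dotp (bigD1 j)//= [in RHS](bigD1 j)//= !coord_setc mulr0 add0r addrC mulrC; congr (_ + _).
by apply: eq_bigr => i ij; rewrite /coord !tnth_setc (negbTE ij).
Qed.

(** Integration by parts against the bounded function [expi (- dotp p x)]. *)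
Lemma fourier_cpartial (j : 'I_n.+1) f p : schwartz f ->
  fourier (cpartial j f) p = 'i%C * ((coord p j)%:C)%C * fourier f p.
Proof.
move=> Sf; rewrite /fourier !cintegralE mulrCA; congr (_ * _).
pose G x := expi (- dotp p x); pose DG x := - 'i%C * ((coord p j)%:C)%C * G x.
have mG : cmeas G.
  by apply: cmeas_expi; apply: measurable_funN; exact: (measurable_fun_slice1 measurable_dotp).
have mDG : cmeas DG by apply: cmeasM => //; exact: cmeas_cst.
have G1 x : cabs (G x) = 1 by exact: cabs_expi.
have ci : cabs ('i%C : R[i]) = 1.
  by rewrite /cabs /= expr0n expr1n add0r sqrtr1.
have dG x t : is_cderive (G \o setc x j) t (DG (setc x j t)).
  have -> : G \o setc x j = fun t => expi (- (dotp p (setc x j 0) + t * coord p j)).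
    by apply/funext => s; rewrite /G /= dotp_setc.
  by rewrite /DG /G (dotp_setc p x j t); exact: is_cderive_expi.
have K1 x : cabs (G x) <= 1 + `|coord p j| by rewrite G1 lerDl.
have K2 x : cabs (DG x) <= 1 + `|coord p j|.
  by rewrite /DG !cabsM cabsN ci G1 cabs_real mulr1 mul1r lerDr.
have := schwartz_by_parts Sf mG mDG K1 K2 dG.
rewrite (_ : (fun x => cpartial j f x * G x) = fun x => expi (- dotp p x) * cpartial j f x); last first.
  by apply/funext => x; rewrite mulrC.
move=> ->.
  rewrite (_ : (fun x => f x * DG x) = fun x => (- 'i%C * ((coord p j)%:C)%C) * (expi (- dotp p x) * f x)); last first.
    by apply/funext => x; rewrite /DG /G; ring.
  rewrite cintZ; first by rewrite !mulNr opprK.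
  have := cintegrable_schwartzM Sf mG K1.
  by under eq_fun do rewrite mulrC.
move=> x; apply: ccontM; first exact: ccont_cst.
exact: cderive_continuous (dG x).
Qed.

(** Multiplying the transform by [p_i^2] amounts, up to sign, to differentiating twice in direction
    [i]. The induction on the list of coordinates is over all Schwartz functions because these
    derivatives replace the function. *)
Lemma fourier_decay f : schwartz f -> exists2 B : R, 0 <= B &
  forall p, cabs (fourier f p) <= B * \prod_i lorentz (tnth p i).
Proof.
move=> Sf0.
suff H (s : seq 'I_n.+1) : forall f, schwartz f -> exists2 B : R, 0 <= B &
    forall p, \prod_(i <- s) (1 + tnth p i ^+ 2) * cabs (fourier f p) <= B.
  have [B B0 hB] := H (index_enum _) f Sf0; exists B => // p.
  have := hB p; rewrite (_ : \prod_(i <- _) _ = prodsqr p)// => h.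
  by rewrite prod_lorentz ler_pdivlMr ?prodsqr_gt0// mulrC.
elim: s => [|i s IHs] h Sh.
  exists (cabs (@fourier_cst R n.+1) * (2 * \int[lam]_x cabs (h x))).
    rewrite mulr_ge0 ?cabs_ge0// mulr_ge0// Rintegral_ge0// => x _; exact: cabs_ge0.
  by move=> p; rewrite big_nil mul1r; apply: cabs_fourier_le; exact: cintegrable_schwartz.
have [B1 B10 hB1] := IHs h Sh.
have Sp := schwartz_cpartial i Sh.
have [B2 B20 hB2] := IHs _ (schwartz_cpartial i Sp).
exists (B1 + B2); first exact: addr_ge0.
move=> p; rewrite big_cons; set P := \prod_(k <- s) _; rewrite mulrAC mulrDl mul1r mulrDl.
apply: lerD; first by rewrite mulrC; exact: hB1.
have := hB2 p; rewrite -/P !fourier_cpartial// !cabsM cabs_real /coord.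
have -> : cabs ('i%C : R[i]) = 1 by rewrite /cabs /= expr0n expr1n add0r sqrtr1.
rewrite !mul1r; apply: le_trans; rewrite -real_sqr_normr expr2 le_eqVlt; apply/orP; left; apply/eqP; ring.
Qed.

End integration_by_parts.

(** * Fourier inversion by Gaussian summation *)

Section gauss_fourier.
Context {R : realType}.
Local Notation mu := (@lebesgue_measure R).
Local Notation gauss := (@gauss_fun R).

(** The Gaussian is the square of [expR (- (t^2 / 2))], and [1 + x <= expR x]. *)
Lemma gauss_bound (t : R) : (1 + t ^+ 2 / 2) ^+ 2 * gauss t <= 1.
Proof.
have -> : gauss t = expR (- (t ^+ 2 / 2)) ^+ 2.
  by rewrite /gauss_fun [in RHS](expr2 (expR _)) -expRD; congr expR; field.
rewrite -exprMn -[X in _ <= X](expr1n _ 2) lerXn2r ?nnegrE//.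
  by rewrite mulr_ge0 ?expR_ge0// addr_ge0// divr_ge0// sqr_ge0.
by rewrite expRN ler_pdivrMr ?expR_gt0// mul1r expR_ge1Dx.
Qed.

Lemma gauss_le_lorentz (t : R) : gauss t <= lorentz t.
Proof.
rewrite /lorentz -[leRHS]mul1r ler_pdivlMr ?oneDsqr_gt0// mulrC.
apply: le_trans (gauss_bound t); rewrite ler_wpM2r ?gauss_fun_ge0//.
by have := sqr_ge0 (t ^+ 2); nra.
Qed.

Lemma mul_gauss_le_lorentz (t : R) : `|t| * gauss t <= 2 * lorentz t.
Proof.
rewrite /lorentz ler_pdivlMr ?oneDsqr_gt0//.
apply: (@le_trans _ _ (2 * ((1 + t ^+ 2 / 2) ^+ 2 * gauss t))); last first.
  by have := gauss_bound t; lra.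
rewrite mulrAC mulrA ler_wpM2r ?gauss_fun_ge0// -(real_sqr_normr t).
have := normr_ge0 t; move: `|t| => s s0.
have := sqr_ge0 (s - 1); have := sqr_ge0 (s * (s - 1)); nra.
Qed.

Lemma integrable_gaussM (f : R -> R) (C : R) : continuous f ->
  (forall t, `|f t| <= C) -> mu.-integrable setT (EFin \o (fun t => gauss t * f t)).
Proof.
move=> cf fC; apply: (integrable_dom _ (integrableZ_EFin C (@integrable_lorentz R))) => [|t].
  apply: measurable_funM; first exact: measurable_gauss_fun.
  exact: continuous_measurable_R.
rewrite normrM (ger0_norm (gauss_fun_ge0 _)) mulrC; apply: ler_pM => //.
  exact: gauss_fun_ge0.
exact: gauss_le_lorentz.
Qed.

Lemma der_gauss (t : R) : is_derive t (1 : R) gauss (- (2 * t) * gauss t).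
Proof.
apply: is_derive_ext (@der_comp _ expR (fun t => - (t * t)) t _ _ (is_derive_expR _)
  (der_opp (der_mul (der_id t) (der_id t)))) => [s|].
  by rewrite /gauss_fun expr2.
by rewrite /gauss_fun expr2; ring.
Qed.

(** The difference of the two sides is the integral of the derivative of
    [gauss t * sin (s * t) / 2], which vanishes at both ends. *)
Lemma Rintegral_gauss_sin (s : R) :
  \int[mu]_t (- (t * gauss t * sin (s * t))) = - (s / 2) * \int[mu]_t (gauss t * cos (s * t)).
Proof.
have cg := @continuous_gauss_fun R.
have i1 : mu.-integrable setT (EFin \o (fun t => - (t * gauss t * sin (s * t)))).
  apply: (integrable_dom _ (integrableZ_EFin 2 (@integrable_lorentz R))) => [|t].
    apply: continuous_measurable_R => t; apply: cvgN; apply: cvgM; last exact: continuous_sinMr.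
    by apply: cvgM; [exact: cvg_id|exact: cg].
  rewrite normrN !normrM (ger0_norm (gauss_fun_ge0 _)); apply: le_trans (mul_gauss_le_lorentz t).
  by rewrite -[leRHS]mulr1 ler_wpM2l ?mulr_ge0 ?gauss_fun_ge0// ler_norml sin_geN1 sin_le1.
have i2 := integrable_gaussM (@continuous_cosMr R s) (fun t => cos_max (s * t)).
have H : \int[mu]_t (- (t * gauss t * sin (s * t)) + (s / 2) * (gauss t * cos (s * t))) = 0.
  apply: (@Rintegral_derive_eq0 _ (fun t => 2^-1 * (gauss t * sin (s * t)))).
  - move=> t; apply: is_derive_ext (der_scale 2^-1 (der_mul (der_gauss t)
      (@der_comp _ sin (fun t => s * t) t _ _ (is_derive_sin _) (der_mull t s)))) => //.
    by field.
  - move=> t; apply: cvgD.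
      apply: cvgN; apply: cvgM; last exact: continuous_sinMr.
      by apply: cvgM; [exact: cvg_id|exact: cg].
    apply: cvgM; first exact: cvg_cst.
    by apply: cvgM; [exact: cg|exact: continuous_cosMr].
  - exact: integrableD_EFin i1 (integrableZ_EFin _ i2).
  - have := @cvg_lorentz R 1 (fun t => 2^-1 * (gauss t * sin (s * t))) 1 (normr1 R).
    under eq_fun do rewrite mul1r; apply => t.
    rewrite mul1r !normrM (ger0_norm (gauss_fun_ge0 _)) ger0_norm//.
    have := gauss_le_lorentz t; have := gauss_fun_ge0 t.
    have : `|sin (s * t)| <= 1 by rewrite ler_norml sin_geN1 sin_le1.
    by have := normr_ge0 (sin (s * t)); nra.
  - have := @cvg_lorentz R 1 (fun t => 2^-1 * (gauss t * sin (s * t))) (-1) (normrN1 R).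
    under eq_fun do rewrite mulN1r; apply => t.
    rewrite mul1r !normrM (ger0_norm (gauss_fun_ge0 _)) ger0_norm//.
    have := gauss_le_lorentz t; have := gauss_fun_ge0 t.
    have : `|sin (s * t)| <= 1 by rewrite ler_norml sin_geN1 sin_le1.
    by have := normr_ge0 (sin (s * t)); nra.
move: H; rewrite RintegralD//; last exact: integrableZ_EFin.
by rewrite RintegralZl// mulNr => /eqP; rewrite addr_eq0 => /eqP.
Qed.

(** As a function of [s] the integral solves [y' = - (s / 2) y], so its product with
    [expR (s^2 / 4)] is constant; at 0 it is the Gaussian integral. *)
Lemma Rintegral_gauss_cos (s : R) :
  \int[mu]_t (gauss t * cos (s * t)) = Num.sqrt pi * expR (- (s ^+ 2 / 4)).
Proof.
pose Ga (s : R) := \int[mu]_t (gauss t * cos (s * t)).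
have i2 s := integrable_gaussM (@continuous_cosMr R s) (fun t => cos_max (s * t)).
have dG (x : R) : is_derive x (1 : R) Ga (- (x / 2) * Ga x).
  rewrite /Ga -Rintegral_gauss_sin.
  apply: (@is_derive_Rintegral _ _ _ mu setT measurableT
    (fun s t => gauss t * cos (s * t)) (fun s t => - (t * gauss t * sin (s * t)))
    (fun t => 2 * lorentz t) x) => //.
  - exact: integrableZ_EFin (@integrable_lorentz R).
  - move=> y t; apply: is_derive_ext (der_scale (gauss t) (der_cosM y t)) => //.
    by ring.
  - move=> y t _ _; rewrite normrN !normrM (ger0_norm (gauss_fun_ge0 _)).
    apply: le_trans (mul_gauss_le_lorentz t).
    by rewrite -[leRHS]mulr1 ler_wpM2l ?mulr_ge0 ?gauss_fun_ge0// ler_norml sin_geN1 sin_le1.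
have dE (x : R) : is_derive x (1 : R) (fun s => Ga s * expR (s * s / 4)) 0.
  have d2 : is_derive x (1 : R) (fun s => s * s / 4) (x / 2).
    apply: is_derive_ext (der_scale 4^-1 (der_mul (der_id x) (der_id x))) => [y|].
      by rewrite mulrC.
    by field.
  apply: is_derive_ext (der_mul (dG x) (@der_comp _ expR (fun s => s * s / 4) x _ _
    (is_derive_expR _) d2)) => //.
  by ring.
have Ga0 : Ga 0 = Num.sqrt pi.
  rewrite /Ga; transitivity (\int[mu]_t gauss t).
    by apply: eq_Rintegral => t _; rewrite mul0r cos0 mulr1.
  by rewrite /Rintegral integralT_gauss.
have := is_derive_0_is_cst s 0 dE.
rewrite Ga0 !mul0r expR0 mulr1 -expr2 expRN => <-.
by rewrite -mulrA divff ?mulr1// gt_eqF// expR_gt0.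
Qed.

Lemma cint_gauss_expi (s : R) : cintegrable mu (fun t => (gauss t)%:C%C * expi (s * t)) /\
  cint mu (fun t => (gauss t)%:C%C * expi (s * t)) =
  (Num.sqrt pi * expR (- (s ^+ 2 / 4)))%:C%C.
Proof.
have ic := integrable_gaussM (@continuous_cosMr R s) (fun t => cos_max (s * t)).
have is_ : mu.-integrable setT (EFin \o (fun t => gauss t * sin (s * t))).
  apply: (integrable_gaussM (@continuous_sinMr R s) (C := 1)) => t.
  by rewrite ler_norml sin_geN1 sin_le1.
have Er : (fun t => complex.Re ((gauss t)%:C%C * expi (s * t))) = fun t => gauss t * cos (s * t).
  by apply/funext => t; rewrite cReM /= mul0r subr0.
have Ei : (fun t => complex.Im ((gauss t)%:C%C * expi (s * t))) = fun t => gauss t * sin (s * t).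
  by apply/funext => t; rewrite cImM /= mul0r addr0.
split; first by rewrite /cintegrable Er Ei.
apply: complex_eq; rewrite /cint /= ?Er ?Ei; first exact: Rintegral_gauss_cos.
apply: Rintegral_odd => // t.
by rewrite mulrN sinN mulrN /gauss_fun sqrrN.
Qed.

(* The Fourier transform of t |-> gauss (e * t), divided by [2 * pi]. *)
Definition heat (e t : R) : R := (2 * e * Num.sqrt pi)^-1 * gauss (t / (2 * e)).

Lemma cint_gauss_scaled (e s : R) : 0 < e ->
  cintegrable mu (fun t => (gauss (e * t))%:C%C * expi (s * t)) /\
  cint mu (fun t => (gauss (e * t))%:C%C * expi (s * t)) = (2 * pi * heat e s)%:C%C.
Proof.
move=> e0; have en : e != 0 by rewrite gt_eqF.
have [[ir ii] h] := cint_gauss_expi (s / e).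
have Eq t : (gauss (e * t))%:C%C * expi (s * t) =
    (fun t => (gauss t)%:C%C * expi (s / e * t)) (e * t + 0).
  by rewrite addr0; congr (_ * expi _); field.
under eq_fun do rewrite Eq.
split; first by split; [exact: (integrable_affine 0 en ir)|exact: (integrable_affine 0 en ii)].
have hr := Rintegral_affine 0 en ir; have hi := Rintegral_affine 0 en ii.
have := congr1 (@complex.Re R) h; have := congr1 (@complex.Im R) h.
rewrite /cint /= hr hi (gtr0_norm e0) => /eqP; rewrite mulf_eq0 (negbTE en)/= => /eqP i0 r0.
apply: complex_eq => //=.
apply: (mulfI en); rewrite r0 /heat /gauss_fun.
have p0 : Num.sqrt pi != 0 :> R by rewrite gt_eqF// sqrtr_gt0 pi_gt0.
have -> : - (s / (2 * e)) ^+ 2 = - ((s / e) ^+ 2 / 4) by field.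
have pE : Num.sqrt pi ^+ 2 = pi :> R by rewrite sqr_sqrtr// ltW// pi_gt0.
move: (expR _) => E; rewrite -[X in 2 * X * _]pE.
by move: (Num.sqrt _) p0 => q q0; field; rewrite q0 en.
Qed.

Lemma heat_ge0 (e t : R) : 0 < e -> 0 <= heat e t.
Proof.
by move=> e0; rewrite mulr_ge0 ?gauss_fun_ge0// invr_ge0 !mulr_ge0 ?sqrtr_ge0// ltW.
Qed.

Lemma Rintegral_heat (e : R) : 0 < e -> mu.-integrable setT (EFin \o heat e) /\
  \int[mu]_t heat e t = 1.
Proof.
move=> e0; have e2 : (2 * e)^-1 != 0 by rewrite invr_eq0 mulf_neq0// gt_eqF.
have ig := @integrableT_gauss R.
have Eq t : heat e t = (2 * e * Num.sqrt pi)^-1 * gauss ((2 * e)^-1 * t + 0).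
  by rewrite addr0 [(2 * e)^-1 * t]mulrC.
have ia := integrable_affine 0 e2 ig.
have E : heat e = fun t => (2 * e * Num.sqrt pi)^-1 * gauss ((2 * e)^-1 * t + 0) by apply/funext.
rewrite E; split; first exact: integrableZ_EFin.
rewrite RintegralZl//.
have := Rintegral_affine 0 e2 ig; rewrite {1}/Rintegral integralT_gauss /=.
have e2p : 0 < (2 * e)^-1 by rewrite invr_gt0 mulr_gt0.
rewrite (gtr0_norm e2p) => h.
have p0 : Num.sqrt pi != 0 :> R by rewrite gt_eqF// sqrtr_gt0 pi_gt0.
rewrite invfM [(2 * e)^-1 * _]mulrC -mulrA -h mulVf//.
Qed.

(** The first absolute moment is proportional to [e], which turns a Lipschitz bound into a rate of
    convergence. *)
Lemma Rintegral_abs_heat (e : R) : 0 < e ->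
  mu.-integrable setT (EFin \o (fun t => `|t| * heat e t)) /\
  \int[mu]_t (`|t| * heat e t) = e * (2 / Num.sqrt pi * \int[mu]_t (`|t| * gauss t)).
Proof.
move=> e0; have e2 : (2 * e)^-1 != 0 by rewrite invr_eq0 mulf_neq0// gt_eqF.
have e2p : 0 < (2 * e)^-1 by rewrite invr_gt0 mulr_gt0.
have p0 : Num.sqrt pi != 0 :> R by rewrite gt_eqF// sqrtr_gt0 pi_gt0.
have ig : mu.-integrable setT (EFin \o (fun t => `|t| * gauss t)).
  apply: (integrable_dom _ (integrableZ_EFin 2 (@integrable_lorentz R))) => [|t].
    by apply: measurable_funM; [exact: normr_measurable|exact: measurable_gauss_fun].
  by rewrite normrM normr_id (ger0_norm (gauss_fun_ge0 _)) mul_gauss_le_lorentz.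
have E : (fun t => `|t| * heat e t) = fun t => (Num.sqrt pi)^-1 *
    (fun t => `|t| * gauss t) ((2 * e)^-1 * t + 0).
  apply/funext => t; rewrite addr0 normrM (gtr0_norm e2p) /heat [t / _]mulrC.
  by rewrite invfM; ring.
have ia := integrable_affine 0 e2 ig.
rewrite E; split; first exact: integrableZ_EFin.
rewrite RintegralZl// (Rintegral_affine 0 e2 ig) (gtr0_norm e2p).
by move: (\int[mu]_t _) => I; field; rewrite p0 gt_eqF.
Qed.

End gauss_fourier.

Lemma integrable_Rintegral_sum d (T : measurableType d) (R : realType)
    (mu : {measure set T -> \bar R}) (I : Type) (s : seq I) (f : I -> T -> R) :
  (forall i, mu.-integrable setT (EFin \o f i)) ->
  mu.-integrable setT (EFin \o (fun x => \sum_(i <- s) f i x)) /\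
  \int[mu]_x (\sum_(i <- s) f i x) = \sum_(i <- s) \int[mu]_x f i x.
Proof.
move=> fi; elim: s => [|i s [IHi IHs]].
  under eq_fun do rewrite big_nil; rewrite big_nil; split; first exact: integrable0.
  by rewrite /Rintegral integral0.
under eq_fun do rewrite big_cons; rewrite big_cons; split; first exact: integrableD_EFin.
by rewrite RintegralD// IHs.
Qed.

(** * Gaussian regularisation of the inversion integral *)

Section inversion.
Context {R : realType} {n : nat}.
Local Notation V := (Rn[R]_n.+1).
Local Notation lam := (lebesgue_Rn R n.+1).
Local Notation gauss := (@gauss_fun R).
Variables (h : V -> R[i]) (Sh : schwartz h) (y : V).

Local Notation mollified e :=
  (cint lam (fun p => (\prod_i gauss (e * tnth p i))%:C%C * expi (dotp p y) * fourier h p)).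

(** Induction with [1 - a P = (1 - a) + a (1 - P)] and [a <= 1]. *)
Lemma ler1_sub_prod (I : Type) (s : seq I) (a : I -> R) : (forall i, 0 <= a i <= 1) ->
  0 <= \prod_(i <- s) a i <= 1 /\ 1 - \prod_(i <- s) a i <= \sum_(i <- s) (1 - a i).
Proof.
move=> a01; elim: s => [|i s [/andP[P0 P1] IHs]]; first by rewrite !big_nil subrr ler01 lexx.
rewrite !big_cons; have /andP[a0 a1] := a01 i; split.
  by apply/andP; split; [exact: mulr_ge0|exact: mulr_ile1].
by nra.
Qed.

Lemma measurable_prod_gauss (e : R) :
  measurable_fun setT (fun p : V => \prod_i gauss (e * tnth p i)).
Proof.
apply: measurable_fun_bigprod => i.
apply: (measurableT_comp (@measurable_gauss_fun R)).
by apply: measurable_funM => //; exact: measurable_coord.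
Qed.

Lemma measurable_fourier_schwartz : cmeas (fourier h).
Proof. exact: cmeas_fourier (cmeas_schwartz Sh). Qed.

Lemma cmeas_expi_dotpl : cmeas (fun p : V => expi (dotp p y)).
Proof. by apply: cmeas_expi; exact: (measurable_fun_slice2 (@measurable_dotp R n.+1)). Qed.

(** Removing the Gaussian factors costs at most [e^2] times the sum of the [p_i^2], and [p_i^2]
    times the transform is integrable, being up to sign the transform of a second derivative. The
    explicit rate takes the place of a limit theorem. *)
Lemma mollified_near : exists2 K : R, 0 <= K & forall e : R,
  cabs (@fourier_cst R n.+1 * mollified e - inv_fourier (fourier h) y) <= e ^+ 2 * K.
Proof.
have [B0 B00 hB0] := fourier_decay Sh.
have [B hB] : exists B : 'I_n.+1 -> R, forall i, 0 <= B i /\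
    forall p, tnth p i ^+ 2 * cabs (fourier h p) <= B i * \prod_i lorentz (tnth p i).
  suff : forall i, exists B, 0 <= B /\
    forall p, tnth p i ^+ 2 * cabs (fourier h p) <= B * \prod_i lorentz (tnth p i).
    by move=> /choice[B hB]; exists B.
  move=> i; have Sp := schwartz_cpartial i Sh.
  have [B B10 hB] := fourier_decay (schwartz_cpartial i Sp); exists B; split => // p.
  apply: le_trans (hB p); rewrite !fourier_cpartial// !cabsM cabs_real /coord.
  have -> : cabs ('i%C : R[i]) = 1 by rewrite /cabs /= expr0n expr1n add0r sqrtr1.
  by rewrite !mul1r -real_sqr_normr expr2 !mulrA.
have BK : 0 <= \sum_i B i by apply: sumr_ge0 => i _; have [] := hB i.
have iL := @integrable_prod_lorentz R n.+1.
have PL0 (p : V) : 0 <= \prod_i lorentz (tnth p i).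
  by apply: prodr_ge0 => i _; exact: ltW (lorentz_gt0 _).
exists (cabs (@fourier_cst R n.+1) * (2 * \int[lam]_p ((\sum_i B i) * \prod_i lorentz (tnth p i)))).
  rewrite mulr_ge0 ?cabs_ge0// mulr_ge0// Rintegral_ge0// => p _.
  by rewrite mulr_ge0.
move=> e.
have mG := measurable_prod_gauss e.
have g01 i (p : V) : 0 <= gauss (e * tnth p i) <= 1 by rewrite gauss_fun_ge0 gauss_fun_le1.
have mf := measurable_fourier_schwartz; have me := cmeas_expi_dotpl.
have i1 : cintegrable lam (fun p => (\prod_i gauss (e * tnth p i))%:C%C * expi (dotp p y) * fourier h p).
  apply: (cintegrable_dom _ (integrableZ_EFin B0 iL)).
    by apply: cmeasM => //; apply: cmeasM => //; exact: cmeas_real.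
  move=> p; have := hB0 p; move: (fourier h p) => z hz.
  rewrite !cabsM cabs_real cabs_expi mulr1.
  have [/andP[P0 P1] _] := ler1_sub_prod (index_enum 'I_n.+1) (fun i => g01 i p).
  rewrite ger0_norm//; apply: le_trans hz.
  by rewrite -[leRHS]mul1r ler_wpM2r ?cabs_ge0.
have i2 : cintegrable lam (fun p => expi (dotp p y) * fourier h p).
  apply: (cintegrable_dom _ (integrableZ_EFin B0 iL)); first exact: cmeasM.
  by move=> p; have := hB0 p; move: (fourier h p) => z hz; rewrite cabsM cabs_expi mul1r.
pose W := \sum_i B i.
have iW := integrableZ_EFin (e ^+ 2) (integrableZ_EFin W iL).
have := cabs_cint (cmeasD (cintegrable_cmeas i1) (cmeasN (cintegrable_cmeas i2))) iW.
rewrite /inv_fourier cintegralE -mulrBr -cintB// cabsM.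
rewrite (RintegralZl _ measurableT (integrableZ_EFin W iL)) => H.
rewrite mulrCA ler_wpM2l ?cabs_ge0// mulrCA; apply: H => p.
have hBp i := (hB i).2 p; move: (fourier h p) hBp => z hBp.
rewrite -[X in _ - X]mul1r -mulrA -mulrBl !cabsM cabs_expi mul1r.
have [_ hs] := ler1_sub_prod (index_enum 'I_n.+1) (fun i => g01 i p).
have [/andP[P0 P1] _] := ler1_sub_prod (index_enum 'I_n.+1) (fun i => g01 i p).
have -> : cabs ((\prod_i gauss (e * tnth p i))%:C%C - 1 : R[i]) = 1 - \prod_i gauss (e * tnth p i).
  by rewrite -[1%R as X in _ - X]/((1 : R)%:C%C) -rmorphB cabs_real distrC ger0_norm// subr_ge0.
apply: (@le_trans _ _ (\sum_i (e ^+ 2 * (tnth p i ^+ 2 * cabs z)))).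
  apply: (@le_trans _ _ ((\sum_i (1 - gauss (e * tnth p i))) * cabs z)).
    by rewrite ler_wpM2r ?cabs_ge0.
  rewrite mulr_suml; apply: ler_sum => i _; rewrite mulrA ler_wpM2r ?cabs_ge0//.
  have := @expR_ge1Dx R (- (e * tnth p i) ^+ 2); rewrite exprMn => hx.
  by rewrite /gauss_fun exprMn lerBlDr -lerBlDl.
rewrite -mulr_sumr ler_wpM2l ?sqr_ge0// /W mulr_suml; apply: ler_sum => i _.
exact: hBp.
Qed.

Lemma fourier_cst_sqr : @fourier_cst R n.+1 * @fourier_cst R n.+1 * \prod_(i < n.+1) ((2 * pi)%:C)%C = 1.
Proof.
have pi2 : 0 < 2 * pi :> R by rewrite mulr_gt0// pi_gt0.
rewrite /fourier_cst prodr_const card_ord -rmorphXn -!rmorphM /=; congr (_ %:C)%C.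
rewrite -powRD; last by rewrite (gt_eqF pi2) implybT.
rewrite -powR_mulrn; last exact: ltW.
rewrite -powRD; last by rewrite (gt_eqF pi2) implybT.
rewrite (_ : _ + _ = 0) ?powRr0//.
by move: (n.+1%:R) => N; field.
Qed.

Definition heatp (e : R) (x : V) : R := \prod_i heat e (tnth y i - tnth x i).

Lemma heatp_ge0 (e : R) (x : V) : 0 < e -> 0 <= heatp e x.
Proof. by move=> e0; apply: prodr_ge0 => i _; exact: heat_ge0. Qed.

Lemma integrable_heatp (e : R) : 0 < e -> lam.-integrable setT (EFin \o heatp e) /\
  \int[lam]_x heatp e x = 1.
Proof.
move=> e0; have [ih Ih] := Rintegral_heat e0.
have [it It] := @integrable_Rintegral_tensor R n.+1 (fun i t => heat e (tnth y i - t))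
  (fun i => integrable_reflect (tnth y i) ih).
split; first exact: it.
rewrite It big1// => i _.
by rewrite (Rintegral_reflect (tnth y i) ih).
Qed.

Lemma cintegrable_mul_heatp (f : V -> R[i]) (K e : R) : 0 < e -> cmeas f ->
  (forall x, cabs (f x) <= K) -> cintegrable lam (fun x => f x * ((heatp e x)%:C)%C).
Proof.
move=> e0 mf fK; have [ih _] := integrable_heatp e0.
apply: (cintegrable_dom _ (integrableZ_EFin K ih)) => [|x].
  by apply: cmeasM => //; apply: cmeas_real; exact: (integrable_measurable ih).
by apply: cabs_mul_le => //; rewrite cabs_real ger0_norm// heatp_ge0.
Qed.

(** By Fubini the Gaussian is integrated against [expi] of the inner product of [p] and [y - x],
    which yields the heat kernel; the two normalising constants cancel the powers of [2 * pi]. *)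
Lemma mollified_heat (e : R) : 0 < e ->
  @fourier_cst R n.+1 * mollified e = cint lam (fun x => h x * ((heatp e x)%:C)%C).
Proof.
move=> e0.
pose F (z : V * V) : R[i] := (\prod_i gauss (e * tnth z.1 i))%:C%C * expi (dotp z.1 y) *
  (expi (- dotp z.1 z.2) * h z.2).
have mF : cmeas F.
  apply: cmeasM; apply: cmeasM.
  - by apply: cmeas_real; apply: (measurableT_comp (measurable_prod_gauss e)).
  - exact: (cmeas_comp cmeas_expi_dotpl).
  - exact: cmeas_expi_dotp.
  - exact: (cmeas_comp (cmeas_schwartz Sh)).
have e1 (t : R) : cabs (expi t) <= 1 by rewrite cabs_expi.
have [M M0 hM] := schwartz_decay 1 Sh.
have ib := integrableZ_EFin M (@integrable_prod_lorentz R n.+1).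
have ig : (@lebesgue_measure R).-integrable setT (EFin \o (fun t => gauss (e * t))).
  have := integrable_affine 0 (lt0r_neq0 e0) (@integrableT_gauss R).
  by under eq_fun do rewrite addr0.
have ia := (@integrable_Rintegral_tensor R n.+1 (fun=> fun t => gauss (e * t)) (fun=> ig)).1.
have Fab p x : cabs (F (p, x)) <= (\prod_i gauss (e * tnth p i)) * (M * \prod_i lorentz (tnth x i)).
  rewrite /F /= !cabsM !cabs_expi mulr1 mul1r cabs_real ger0_norm; last first.
    by apply: prodr_ge0 => i _; exact: gauss_fun_ge0.
  apply: ler_wpM2l; last exact: (hM x).
  by apply: prodr_ge0 => i _; exact: gauss_fun_ge0.
transitivity (@fourier_cst R n.+1 * (@fourier_cst R n.+1 * cint lam (fun p => cint lam (fun x => F (p, x))))).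
  congr (_ * _); rewrite -cintZ; last exact: cintegrable_fubini1 mF ia ib Fab.
  apply: eq_cint => p; rewrite /fourier cintegralE mulrCA; congr (_ * _).
  rewrite -cintZ.
    by apply: eq_cint => x; rewrite /F /=; ring.
  have := cintegrable_schwartzM Sh
    (cmeas_expi (measurable_funN (measurable_fun_slice1 (@measurable_dotp R n.+1) p)))
    (fun x => e1 _).
  by under eq_fun do rewrite mulrC.
have fub x : cint lam (fun p => F (p, x)) =
    \prod_(i < n.+1) ((2 * pi)%:C)%C * (h x * ((heatp e x)%:C)%C).
  have hg i := cint_gauss_scaled (tnth y i - tnth x i) e0.
  have [it T] := cintegrable_cint_tensor (fun i => (hg i).1).
  rewrite (_ : (fun p => F (p, x)) = fun p => h x *
     \prod_i ((gauss (e * tnth p i))%:C%C * expi ((tnth y i - tnth x i) * tnth p i))); last first.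
    apply/funext => p; rewrite /F /= big_split /= -rmorph_prod.
    rewrite -(big_morph (@expi R) (@expiD R) (expi0 R)).
    rewrite (_ : \sum_i _ = dotp p y + - dotp p x); first by rewrite expiD; ring.
    rewrite /dotp -sumrN -big_split /=.
    by apply: eq_bigr => i _; rewrite /coord; ring.
  rewrite cintZ// T mulrCA; congr (_ * _).
  under eq_bigr do rewrite (hg _).2 rmorphM.
  by rewrite big_split /= /heatp rmorph_prod.
rewrite (cfubini mF ia ib Fab) mulrA (eq_cint _ fub) cintZ; last first.
  have [K K0 hK] := schwartz_bounded Sh.
  exact: cintegrable_mul_heatp e0 (cmeas_schwartz Sh) hK.
by rewrite mulrA fourier_cst_sqr mul1r.
Qed.

(** The kernel [heatp] is a probability density, so the difference is an average of [h x - h y]; the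
    Lipschitz bound reduces it to first absolute moments. *)
Lemma heat_near : exists2 K : R, 0 <= K & forall e : R, 0 < e ->
  cabs (cint lam (fun x => h x * ((heatp e x)%:C)%C) - h y) <= e * K.
Proof.
have [L L0 hL] := schwartz_lipschitz Sh; have [B B0 hB] := schwartz_bounded Sh.
pose J : R := 2 / Num.sqrt pi * \int[@lebesgue_measure R]_t (`|t| * gauss t).
have J0 : 0 <= J.
  rewrite mulr_ge0 ?divr_ge0 ?sqrtr_ge0// Rintegral_ge0// => t _.
  by rewrite mulr_ge0// gauss_fun_ge0.
exists (2 * (L * (J *+ n.+1))); first by rewrite !mulr_ge0// mulrn_wge0.
move=> e e0; have [ihp Ihp] := integrable_heatp e0.
have mh := cmeas_schwartz Sh.
have -> : h y = cint lam (fun x => h y * ((heatp e x)%:C)%C).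
  rewrite cintZ; first by rewrite cint_real Ihp mulr1.
  have := cintegrable_mul_heatp (f := fun=> 1) e0 (cmeas_cst _ 1) (fun=> lexx (cabs 1)).
  by under eq_fun do rewrite mul1r.
have i1 := cintegrable_mul_heatp e0 mh hB.
have i2 := cintegrable_mul_heatp e0 (cmeas_cst _ (h y)) (fun=> lexx (cabs (h y))).
rewrite -cintB//.
(* For fixed [j], the product of these factors over [i] is [|y_j - x_j|] times the heat kernel,
   written as a tensor product. *)
pose a (j i : 'I_n.+1) (t : R) := if i == j then `|tnth y i - t| * heat e (tnth y i - t)
  else heat e (tnth y i - t).
have [ih Ih] := Rintegral_heat e0; have [iah Iah] := Rintegral_abs_heat e0.
have ia j i : (@lebesgue_measure R).-integrable setT (EFin \o a j i).
  rewrite /a; case: (i == j); first exact: (integrable_reflect (tnth y i) iah).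
  exact: (integrable_reflect (tnth y i) ih).
have tens j := @integrable_Rintegral_tensor R n.+1 (a j) (ia j).
have Ia j : \int[lam]_x (\prod_i a j i (tnth x i)) = e * J.
  rewrite (tens j).2 (bigD1 j)//= big1 ?mulr1; last first.
    by move=> i ij; rewrite /a (negbTE ij) (Rintegral_reflect (tnth y i) ih).
  by rewrite /a eqxx (Rintegral_reflect (tnth y j) iah).
have [isum Isum] := integrable_Rintegral_sum (index_enum 'I_n.+1) (fun j => (tens j).1).
apply: (le_trans (cabs_cint (cmeasD (cintegrable_cmeas i1) (cmeasN (cintegrable_cmeas i2)))
  (integrableZ_EFin L isum) _)) => [x|].
  rewrite -mulrBl cabsM cabs_real ger0_norm ?heatp_ge0//.
  apply: (le_trans (ler_wpM2r (heatp_ge0 x e0) (hL x y))).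
  rewrite -mulrA ler_wpM2l// mulr_suml; apply: ler_sum => j _.
  rewrite /heatp (bigD1 j)//= [leRHS](bigD1 j)//= mulrA /a eqxx distrC.
  apply: ler_wpM2l; first exact: (mulr_ge0 (normr_ge0 _) (heat_ge0 _ e0)).
  by rewrite le_eqVlt; apply/orP; left; apply/eqP; apply: eq_bigr => i /negbTE ->.
rewrite RintegralZl// Isum (eq_bigr (fun=> e * J)) => [|j _]; last exact: Ia.
by rewrite sumr_const card_ord -mulrnAr le_eqVlt; apply/orP; left; apply/eqP; ring.
Qed.

End inversion.

Lemma inv_fourier_fourier (R : realType) n (h : Rn[R]_n.+1 -> R[i]) : schwartz h ->
  inv_fourier (fourier h) = h.
Proof.
move=> Sh; apply/funext => y.
have [K K0 hK] := mollified_near Sh y; have [J J0 hJ] := heat_near Sh y.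
apply/eqP; rewrite -subr_eq0; apply/eqP.
apply: ComplexField.Normc.eq0_normc.
apply: (@eq0_of_le_eps _ _ (K + J)); first exact: cabs_ge0.
move=> e e0.
(* For [e <= 1] the bound [e^2 K] is at most [e K]; a larger [e] follows from the case [e = 1]. *)
wlog e1 : e e0 / e <= 1.
  move=> H; have [/H|e1] := leP e 1; first by apply.
  apply: le_trans (H 1 ltr01 (lexx _)) _; rewrite ler_wpM2r ?addr_ge0// ltW//.
have := hK e; rewrite (mollified_heat Sh y e0); set z := cint _ _ => h1; have h2 := hJ e e0.
have -> : inv_fourier (fourier h) y - h y = - (z - inv_fourier (fourier h) y) + (z - h y) by ring.
apply: (le_trans (cabsD _ _)); rewrite cabsN mulrDr; apply: lerD => //.
apply: (le_trans h1); rewrite ler_wpM2r// expr2 -[leRHS]mulr1 ler_wpM2l// ltW//.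
Qed.

Section complex_integrable.
Context d (T : measurableType d) (R : realType).
Variable mu : {measure set T -> \bar R}.

Lemma cintegrableZ (z : R[i]) (f : T -> R[i]) : cintegrable mu f ->
  cintegrable mu (fun x => z * f x).
Proof.
move=> fi; apply: (cintegrable_dom _ (integrableZ_EFin (cabs z) (cintegrable_cabs fi))).
  by apply: cmeasM; [exact: cmeas_cst|exact: (cintegrable_cmeas fi)].
by move=> x; rewrite cabsM.
Qed.

Lemma cintegrableD (f g : T -> R[i]) : cintegrable mu f -> cintegrable mu g ->
  cintegrable mu (fun x => f x + g x).
Proof.
move=> fi gi; apply: (cintegrable_dom _ (integrableD_EFin (cintegrable_cabs fi) (cintegrable_cabs gi))).
  exact: (cmeasD (cintegrable_cmeas fi) (cintegrable_cmeas gi)).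
by move=> x; exact: cabsD.
Qed.

End complex_integrable.

(** * Duality with Schwartz functions *)

Section convolution_by_parts.
Context {R : realType} {n : nat}.
Local Notation V := (Rn[R]_n.+1).
Local Notation lam := (lebesgue_Rn R n.+1).
Variables (m : R) (m0 : 0 < m) (C : R).

(** In each coordinate [(2 (3 + 2 t^2))^2 <= 36 (1 + t^2)^2], so two powers of [lorentz] pay for the
    local constant and the third stays integrable. *)
Lemma localcst_lorentz (p : V) :
  localcst p * (\prod_i lorentz (tnth p i)) ^+ 3 <= 36 ^+ n.+1 * \prod_i lorentz (tnth p i).
Proof.
rewrite -[X in 36 ^+ X](card_ord n.+1) -prodr_const -prodrXl /localcst -!big_split /=.
apply: ler_prod => i _; set t := tnth p i; have l0 := lorentz_gt0 t.
have -> : 36 * lorentz t = 36 * (1 + t ^+ 2) ^+ 2 * lorentz t ^+ 3.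
  by rewrite /lorentz; field; rewrite gt_eqF ?oneDsqr_gt0.
have l3 : 0 <= lorentz t ^+ 3 by rewrite exprn_ge0// ltW.
rewrite mulr_ge0 ?sqr_ge0//= ler_wpM2r//.
by have := sqr_ge0 t; nra.
Qed.

Section swap.
Variables (kp : 'I_n.+1 -> R -> R) (u : V -> R) (f : V -> R[i]).
Hypothesis mkp : forall i, measurable_fun setT (kp i).
Hypothesis kpC : forall i t, `|kp i t| <= C * decay t.
Hypothesis wu : weighted m u.
Hypothesis Sf : schwartz f.

(** Fubini for [f p * ker p q * u q]. The kernel bound grows with [p] like [localcst p], which the
    Schwartz decay of [f], taken with exponent 3, compensates. *)
Let cint_mul_conv_aux :
  [/\ cintegrable lam (fun p => f p * ((conv kp u p)%:C)%C),
  cint lam (fun p => f p * ((conv kp u p)%:C)%C) =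
  cint lam (fun q => ((u q)%:C)%C * cint lam (fun p => f p * ((ker kp p q)%:C)%C)) &
  cintegrable lam (fun q => ((u q)%:C)%C * cint lam (fun p => f p * ((ker kp p q)%:C)%C))].
Proof.
have [mu_ iu] := wu.
pose F (z : V * V) : R[i] := f z.1 * ((ker kp z.1 z.2 * u z.2)%:C)%C.
have mF : cmeas F.
  apply: cmeasM; first exact: (cmeas_comp (cmeas_schwartz Sf)).
  apply: cmeas_real; apply: measurable_funM; first exact: measurable_ker_pair.
  exact: (measurableT_comp mu_).
have [M M0 hM] := schwartz_decay 3 Sf.
have Cn : 0 <= C ^+ n.+1 := decay_cst_ge0 kpC.
have ia := integrableZ_EFin (M * C ^+ n.+1 * 36 ^+ n.+1) (@integrable_prod_lorentz R n.+1).
have ib := integrable_decay_mul m0 mu_ iu.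
have Fab p q : cabs (F (p, q)) <= (M * C ^+ n.+1 * 36 ^+ n.+1 * \prod_i lorentz (tnth p i)) *
    (\prod_i decay (tnth q i) * `|u q|).
  rewrite /F /= cabsM cabs_real normrM [leLHS]mulrA [leRHS]mulrA ler_wpM2r//.
  apply: (@le_trans _ _ ((M * (\prod_i lorentz (tnth p i)) ^+ 3) *
      (C ^+ n.+1 * localcst p * \prod_i decay (tnth q i)))).
    by apply: ler_pM => //; [exact: cabs_ge0|apply: (ker_dom kpC) => i; exact: near_self].
  rewrite mulrA ler_wpM2r ?prod_decay_ge0//.
  have -> : M * (\prod_i lorentz (tnth p i)) ^+ 3 * (C ^+ n.+1 * localcst p) =
    (M * C ^+ n.+1) * (localcst p * (\prod_i lorentz (tnth p i)) ^+ 3) by ring.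
  by rewrite -[leRHS]mulrA ler_wpM2l ?mulr_ge0// localcst_lorentz.
have E p : cint lam (fun q => F (p, q)) = f p * ((conv kp u p)%:C)%C.
  rewrite /F /= cintZ ?cint_real//.
  by split => /=; [exact: (integrable_ker_mul mkp kpC m0 mu_ iu)|exact: integrable0].
have E' q : cint lam (fun p => F (p, q)) = ((u q)%:C)%C * cint lam (fun p => f p * ((ker kp p q)%:C)%C).
  rewrite -cintZ; first by apply: eq_cint => p; rewrite /F /= rmorphM /=; ring.
  have mk : measurable_fun setT (ker kp ^~ q) := measurable_fun_slice2 (measurable_ker_pair mkp) q.
  apply: (cintegrable_schwartzM Sf (cmeas_real mk) (K := C ^+ n.+1)) => p.
  rewrite cabs_real; apply: le_trans (ker_le kpC p q) _.
  rewrite -[leRHS]mulr1 ler_wpM2l//; apply: prodr_ile1 => i _.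
  rewrite (ltW (decay_gt0 _))/=; exact: le_trans (decay_le_lorentz _) (lorentz_le1 _).
(* The variables are exchanged to obtain integrability in [q] of the inner integral over [p]. *)
have mS : cmeas (fun z : V * V => F (z.2, z.1)) := cmeas_comp mF (@measurable_swap _ _ V V).
have Sab q p : cabs (F (p, q)) <= (\prod_i decay (tnth q i) * `|u q|) *
    (M * C ^+ n.+1 * 36 ^+ n.+1 * \prod_i lorentz (tnth p i)) by rewrite mulrC.
split; last 1 first.
- have := cintegrable_fubini1 mS ib ia Sab.
  by under eq_fun do rewrite E'.
- have := cintegrable_fubini1 mF ia ib Fab.
  by under eq_fun do rewrite E.
- rewrite -(eq_cint _ E) (cfubini mF ia ib Fab); exact: eq_cint.
Qed.

Lemma cint_mul_conv :
  cintegrable lam (fun p => f p * ((conv kp u p)%:C)%C) /\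
  cint lam (fun p => f p * ((conv kp u p)%:C)%C) =
  cint lam (fun q => ((u q)%:C)%C * cint lam (fun p => f p * ((ker kp p q)%:C)%C)).
Proof. by have [] := cint_mul_conv_aux. Qed.

Lemma cintegrable_mul_cint_ker :
  cintegrable lam (fun q => ((u q)%:C)%C * cint lam (fun p => f p * ((ker kp p q)%:C)%C)).
Proof. by have [] := cint_mul_conv_aux. Qed.

End swap.

Variables (k k' : R -> R) (j : 'I_n.+1).
Hypothesis dk : forall t, is_derive t (1 : R) k (k' t).
Hypothesis ck' : continuous k'.
Hypothesis kC : forall t, `|k t| <= C * decay t.
Hypothesis k'C : forall t, `|k' t| <= C * decay t.
Local Notation kap := ((fun=> k) : 'I_n.+1 -> R -> R).
Local Notation dk' := (dkap kap j k').

Let mkap i : measurable_fun setT (kap i).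
Proof. by apply: continuous_measurable_R; exact: derive_continuous dk. Qed.
Let kapC i t : `|kap i t| <= C * decay t. Proof. exact: kC. Qed.
Let mk' : measurable_fun setT k'. Proof. exact: continuous_measurable_R. Qed.
Let dkC i t : `|dk' i t| <= C * decay t. Proof. exact: dkap_le. Qed.
Let mdk i : measurable_fun setT (dk' i). Proof. exact: measurable_dkap. Qed.

(** For fixed [q] the kernel and its partial derivative are bounded functions of [p], which is what
    [schwartz_by_parts] asks for; [phi] itself is never differentiated. *)
Lemma ker_by_parts (f : V -> R[i]) (q : V) : schwartz f ->
  cint lam (fun p => f p * ((ker dk' p q)%:C)%C) =
  - cint lam (fun p => cpartial j f p * ((ker kap p q)%:C)%C).
Proof.
move=> Sf; apply/eqP; rewrite -eqr_oppLR; apply/eqP; apply/esym.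
have le1 (kp : 'I_n.+1 -> R -> R) p : (forall i t, `|kp i t| <= C * decay t) ->
    cabs ((ker kp p q)%:C)%C <= C ^+ n.+1.
  move=> kpC; rewrite cabs_real; apply: le_trans (ker_le kpC p q) _.
  rewrite -[leRHS]mulr1 ler_wpM2l//; first exact: (decay_cst_ge0 kapC).
  apply: prodr_ile1 => i _; rewrite (ltW (decay_gt0 _))/=.
  exact: le_trans (decay_le_lorentz _) (lorentz_le1 _).
apply: (@schwartz_by_parts _ _ j f (fun p => ((ker kap p q)%:C)%C)
  (fun p => ((ker dk' p q)%:C)%C) (C ^+ n.+1)) => //.
- by apply: cmeas_real; exact: (measurable_fun_slice2 (measurable_ker_pair mkap)).
- by apply: cmeas_real; exact: (measurable_fun_slice2 (measurable_ker_pair mdk)).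
- by move=> p; exact: le1.
- by move=> p; exact: le1.
- by move=> p t; split; [exact: is_derive_ker|exact: der_cst].
- move=> p; split => /=; last by move=> t; exact: cvg_cst.
  have -> : (fun t => ker dk' (setc p j t) q) =
      fun t => k' (t - tnth q j) * \prod_(i | i != j) k (tnth p i - tnth q i).
    apply/funext => t; rewrite /ker (bigD1 j)//= tnth_setc {1}/dkap !eqxx; congr (_ * _).
    by apply: eq_bigr => i ij; rewrite /dkap tnth_setc (negbTE ij).
  move=> t; apply: cvgM; last exact: cvg_cst.
  apply: (@continuous_comp _ _ _ (fun t => t - tnth q j) k'); last exact: ck'.
  by apply: cvgB; [exact: cvg_id|exact: cvg_cst].
Qed.

Lemma conv_by_parts (u : V -> R) (f : V -> R[i]) : weighted m u -> schwartz f ->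
  cint lam (fun p => f p * ((conv dk' u p)%:C)%C) =
  - cint lam (fun p => cpartial j f p * ((conv kap u p)%:C)%C).
Proof.
move=> wu Sf; have Sp := schwartz_cpartial j Sf.
rewrite (cint_mul_conv mdk dkC wu Sf).2 (cint_mul_conv mkap kapC wu Sp).2.
have mI := cintegrable_mul_cint_ker mkap kapC wu Sp.
rewrite -mulN1r -cintZ//; apply: eq_cint => q.
by rewrite ker_by_parts// mulN1r mulrN.
Qed.

Lemma cconvE (kp : 'I_n.+1 -> R -> R) (g : V -> R[i]) p : cconv kp g p =
  ((conv kp (fun q => complex.Re (g q)) p)%:C)%C +
  'i%C * ((conv kp (fun q => complex.Im (g q)) p)%:C)%C.
Proof.
by apply: complex_eq; rewrite !(cReD, cImD, cReM, cImM) /=; ring.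
Qed.

Variable g : V -> R[i].
Hypothesis wr : weighted m (fun q => complex.Re (g q)).
Hypothesis wi : weighted m (fun q => complex.Im (g q)).

Lemma cint_mul_cconv (kp : 'I_n.+1 -> R -> R) (f : V -> R[i]) :
  (forall i, measurable_fun setT (kp i)) ->
  (forall i t, `|kp i t| <= C * decay t) -> schwartz f ->
  cintegrable lam (fun p => cconv kp g p * f p) /\
  cint lam (fun p => cconv kp g p * f p) =
  cint lam (fun p => f p * ((conv kp (fun q => complex.Re (g q)) p)%:C)%C) +
  'i%C * cint lam (fun p => f p * ((conv kp (fun q => complex.Im (g q)) p)%:C)%C).
Proof.
move=> mkp kpC Sf.
have [ir _] := cint_mul_conv mkp kpC wr Sf; have [ii _] := cint_mul_conv mkp kpC wi Sf.
have E p : cconv kp g p * f p = f p * ((conv kp (fun q => complex.Re (g q)) p)%:C)%C +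
  'i%C * (f p * ((conv kp (fun q => complex.Im (g q)) p)%:C)%C) by rewrite cconvE; ring.
under eq_fun do rewrite E.
have iZ := cintegrableZ 'i%C ii.
by split; [exact: cintegrableD|rewrite cintD// cintZ].
Qed.

Lemma cconv_by_parts (f : V -> R[i]) : schwartz f ->
  cint lam (fun p => cconv dk' g p * f p) = - cint lam (fun p => cconv kap g p * cpartial j f p).
Proof.
move=> Sf; have Sp := schwartz_cpartial j Sf.
rewrite (cint_mul_cconv mdk dkC Sf).2 (cint_mul_cconv mkap kapC Sp).2.
by rewrite (conv_by_parts wr Sf) (conv_by_parts wi Sf) mulrN opprD.
Qed.

End convolution_by_parts.

(** [fourier_cpartial] divided by ['i] puts the factor [coord x j] under the transform, as [- 'i]
    times a partial derivative, and inversion removes the transform. *)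
Lemma inv_fourier_mulx (R : realType) n (j : 'I_n.+1) (f : Rn[R]_n.+1 -> R[i]) : schwartz f ->
  inv_fourier (fun x => ((coord x j)%:C)%C * fourier f x) = (fun p => - 'i%C * cpartial j f p).
Proof.
move=> Sf; have Sp := schwartz_cpartial j Sf.
have -> : (fun x => ((coord x j)%:C)%C * fourier f x) = (fun x => - 'i%C * fourier (cpartial j f) x).
  apply/funext => x; rewrite fourier_cpartial//; move: (fourier f x) => z.
  by rewrite !mulrA mulNr -expr2 sqr_i opprK mul1r.
apply/funext => p; rewrite -[in RHS](inv_fourier_fourier Sp) /inv_fourier !cintegralE mulrCA.
congr (_ * _); rewrite -cintZ.
  by apply: eq_cint => x; rewrite mulrCA.
have [B B0 hB] := fourier_decay Sp.
apply: (cintegrable_dom _ (integrableZ_EFin B (@integrable_prod_lorentz R n.+1))) => [|x].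
  apply: cmeasM; last exact: (cmeas_fourier (cmeas_schwartz Sp)).
  by apply: cmeas_expi; exact: (measurable_fun_slice2 (@measurable_dotp R n.+1)).
by have := hB x; move: (fourier _ x) => z hz; rewrite cabsM cabs_expi mul1r.
Qed.

Theorem proposition5 (R : realType) (n : nat) (n_ge1 : (1 <= n)%N)
    (m : R) (m_gt0 : 0 < m) (S : set Rn[R]_n)
    (mS : lebesgue_measurable S) (bS : bounded_Rn S) :
  HS m S `<=` \bigcap_(j in [set: 'I_n]) KGdom m j /\
  (forall phi : Rn[R]_n -> R[i], HS m S phi ->
   forall (j : 'I_n) (chi : Rn[R]_n -> R[i]), KGpos m j phi chi ->
     distr_eq (distr_of chi)
       (distr_fourier (distr_mulx j (distr_inv_fourier (distr_of phi))))).
Proof.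
case: n n_ge1 S mS bS => // n _ S mS [M0 bS].
(* The given bound may be negative when [S] is empty, whereas [flat_kernel] takes a nonnegative
   radius. *)
pose M := Num.max M0 0; have M_ge0 : 0 <= M by rewrite le_max lexx orbT.
have SM x : S x -> enorm x <= M by move=> /bS h; rewrite le_max h.
have [k [k' [C [dk ck' kC k'C flat]]]] := flat_kernel M_ge0.
have mk : measurable_fun setT k.
  by apply: continuous_measurable_R; exact: derive_continuous dk.
have fixed phi : HS m S phi -> exists g : Rn[R]_n.+1 -> R[i],
    [/\ L2r m phi, {ae lebesgue_Rn R n.+1, forall x, phi x = g x},
      weighted m (fun q => complex.Re (g q)), weighted m (fun q => complex.Im (g q)) &
      {ae lebesgue_Rn R n.+1, forall x, phi x = cconv (fun=> k) g x}].
  move=> Hphi; have [Lphi _] := Hphi; have [g [pg wr wi]] := L2r_repr m_gt0 Lphi.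
  by exists g; split => //; exact: (HS_cconv m_gt0 mk kC flat SM Hphi).
split.
  move=> phi /fixed[g [Lphi pg wr wi fx]] j _.
  exists (fun p => 'i%C * cconv (dkap (fun=> k) j k') g p).
  exact: (KGpos_cconv m_gt0 j dk ck' kC k'C Lphi wr wi fx).
move=> phi /fixed[g [Lphi pg wr wi fx]] j chi Kchi f Sf.
(* [chi] is an arbitrary value of the graph at [phi]; up to a null set it is the one produced by the
   kernel. *)
have chiE := KGpos_unique m_gt0 dk ck' kC k'C wr wi fx Kchi.
have Sp := schwartz_cpartial j Sf.
have mkap (i : 'I_n.+1) : measurable_fun setT k by [].
have kapC (i : 'I_n.+1) t : `|k t| <= C * decay t by exact: kC.
have mdk i := measurable_dkap j mkap (continuous_measurable_R ck') i.
have dkC i t := @dkap_le _ _ (fun=> k) C j k' kapC k'C i t.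
have [i1 _] := cint_mul_cconv m_gt0 wr wi mdk dkC Sf.
have [i2 _] := cint_mul_cconv m_gt0 wr wi mkap kapC Sp.
(* Unfolding the duality, the right-hand side is [phi] paired with [inv_fourier] of [coord x j]
   times [fourier f], that is, with [- 'i] times a partial derivative of [f]. *)
rewrite /distr_fourier /distr_mulx /distr_inv_fourier /distr_of inv_fourier_mulx//.
rewrite !cintegralE.
rewrite (@cint_ae _ _ _ _ _ (fun p => 'i%C * (cconv (dkap (fun=> k) j k') g p * f p))); last 2 first.
- exact: cintegrable_cmeas (cintegrableZ _ i1).
- by apply: filterS chiE => p ->; rewrite mulrA.
rewrite cintZ// (cconv_by_parts m_gt0 j dk ck' kC k'C wr wi Sf).
rewrite (@cint_ae _ _ _ _ (fun p => phi p * _)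
  (fun p => - 'i%C * (cconv (fun=> k) g p * cpartial j f p))); last 2 first.
- exact: cintegrable_cmeas (cintegrableZ _ i2).
- by apply: filterS fx => p ->; rewrite mulrCA.
by rewrite cintZ// mulrN mulNr.
Qed.
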